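(* Let $0<r<\pi/2$. Then there exist a Möbius band $\mathbb{M}$ with a Riemannian metric $g$ and a free boundary minimal immersion by first Steklov eigenfunctions $$\Phi=(\phi_0,\dots,\phi_4):(\mathbb{M},g)\to\mathbb{B}^4(r).$$
   Context: $\mathbb{S}^n\subset\mathbb{R}^{n+1}$ is the unit sphere, with coordinates $(x_0,\dots,x_n)$, and $\mathbb{B}^n(r)=\{x\in\mathbb{S}^n : x_0\ge\cos r\}$ is the spherical cap of radius $r$ centered at $e_0=(1,0,\dots,0)$. The Möbius band is compact with boundary. An immersion $\Phi:(\Sigma,g)\to\mathbb{B}^n(r)$ of a compact surface with boundary, where $g$ is the metric induced by $\Phi$ from $\mathbb{S}^n$, with $\Phi(\partial\Sigma)\subset\partial\mathbb{B}^n(r)$, is free boundary minimal if it has zero mean curvature in $\mathbb{S}^n$ and meets $\partial\mathbb{B}^n(r)$ orthogonally, i.e. along $\partial\Sigma$ the image under $\Phi_*$ of the outward unit conormal $\nu$ of $\partial\Sigma$ equals the outward unit normal $N(p)=\frac{1}{\sin r}(\cos r\,p-e_0)$ of $\mathbb{B}^n(r)$. Steklov eigenvalues (with frequency 2): suppose that $2$ is not a Dirichlet eigenvalue of $-\Delta_g$ on $\Sigma$ (with $\Delta_g=\mathrm{div}\,\nabla$). For $u\in C^\infty(\partial\Sigma)$ let $\hat u$ be the unique solution of $\Delta_g\hat u+2\hat u=0$ in $\Sigma$, $\hat u=u$ on $\partial\Sigma$, and let $\mathcal{D}_2u=\frac{\partial\hat u}{\partial\nu}$. The eigenvalues of $\mathcal{D}_2$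 are $\sigma_0(g)<\sigma_1(g)\le\sigma_2(g)\le\cdots\to\infty$, counted with multiplicity. A $\sigma_i(g)$-Steklov eigenfunction is a function $\varphi$ on $\Sigma$ with $\Delta_g\varphi+2\varphi=0$ in $\Sigma$ and $\frac{\partial\varphi}{\partial\nu}=\sigma_i(g)\varphi$ on $\partial\Sigma$. $\Phi=(\phi_0,\dots,\phi_n)$ is an immersion by first Steklov eigenfunctions if (2 is not a Dirichlet eigenvalue and) $\phi_0$ is a $\sigma_0(g)$-Steklov eigenfunction and $\phi_1,\dots,\phi_n$ are $\sigma_1(g)$-Steklov eigenfunctions. *)

(* Defs.v *)
(* Classical reals of the standard library, with Coquelicot's [Derive]. *)
From Stdlib Require Import Reals.
From Coquelicot Require Import Coquelicot.
Open Scope R_scope.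

(** * The Möbius band

  M_T (T > 0) is the quotient of the strip [-T, T] x R, with coordinates
  (t, th), by the group generated by the glide reflection
      iota (t, th) = (-t, th + PI).
  As iota^2 (t, th) = (t, th + 2 PI), this is the compact Möbius band with core
  circle t = 0; its boundary is the single circle t = T, with coordinate th
  modulo 2 PI (the edge t = -T is identified with it by iota).

  Objects on M_T are written as iota-invariant objects on the strip.  A function
  on the closed strip is smooth up to the boundary when it is the restriction of
  a smooth function on R^2, so it is represented by such an extension.
  All conditions only concern the points of the strip; at its edges they do not
  depend on the extension, since all the derivatives there are determined by
  the values on the strip. *)

Definition smooth (f : R -> R -> R) : Prop :=
  forall (n : nat) (t th : R), ex_diff_n f n t th.

Definition in_strip (T t : R) : Prop := Rabs t <= T.

(** C^oo(M_T) *)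
Definition smooth_function (T : R) (f : R -> R -> R) : Prop :=
  smooth f /\
  forall t th, in_strip T t -> f (- t) (th + PI) = f t th.

Definition d_t (f : R -> R -> R) (t th : R) : R := Derive (fun s => f s th) t.
Definition d_th (f : R -> R -> R) (t th : R) : R := Derive (fun s => f t s) th.

(** * Riemannian metrics *)

(** g = E dt^2 + 2 F dt dth + G dth^2 *)
Record metric := Metric {
  gE : R -> R -> R;
  gF : R -> R -> R;
  gG : R -> R -> R
}.

Definition gdet (g : metric) (t th : R) : R :=
  gE g t th * gG g t th - gF g t th ^ 2.

(** The differential of iota is diag (-1, 1), whence the sign in the
    invariance of F. *)
Definition riemannian_metric (T : R) (g : metric) : Prop :=
  smooth (gE g) /\ smooth (gF g) /\ smooth (gG g) /\
  forall t th, in_strip T t ->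
    gE g (- t) (th + PI) = gE g t th /\
    gF g (- t) (th + PI) = - gF g t th /\
    gG g (- t) (th + PI) = gG g t th /\
    0 < gE g t th /\ 0 < gdet g t th.

(** Raising an index: the components (g^{ab} w_b)_a of the vector dual to the
    covector p dt + q dth. *)
Definition sharp_t (g : metric) (t th p q : R) : R :=
  (gG g t th * p - gF g t th * q) / gdet g t th.
Definition sharp_th (g : metric) (t th p q : R) : R :=
  (gE g t th * q - gF g t th * p) / gdet g t th.

Definition grad_t (g : metric) (f : R -> R -> R) (t th : R) : R :=
  sharp_t g t th (d_t f t th) (d_th f t th).
Definition grad_th (g : metric) (f : R -> R -> R) (t th : R) : R :=
  sharp_th g t th (d_t f t th) (d_th f t th).

(** Divergence of the vector field X d/dt + Y d/dth. *)
Definition divergence (g : metric) (X Y : R -> R -> R) (t th : R) : R :=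
  (d_t (fun s x => sqrt (gdet g s x) * X s x) t th
   + d_th (fun s x => sqrt (gdet g s x) * Y s x) t th) / sqrt (gdet g t th).

Definition laplacian (g : metric) (f : R -> R -> R) : R -> R -> R :=
  divergence g (grad_t g f) (grad_th g f).

(** Components at the boundary point (T, th) of the outward unit conormal
    nu = grad t / |grad t|, where grad t = (G, - F) / (E G - F^2) and
    |grad t|^2 = G / (E G - F^2). *)
Definition nu_t (T : R) (g : metric) (th : R) : R :=
  sqrt (gG g T th / gdet g T th).
Definition nu_th (T : R) (g : metric) (th : R) : R :=
  - gF g T th / sqrt (gG g T th * gdet g T th).

Definition conormal_derivative (T : R) (g : metric) (f : R -> R -> R)
    (th : R) : R :=
  nu_t T g th * d_t f T th + nu_th T g th * d_th f T th.

(** * Steklov eigenvalues with frequency 2 *)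

Definition solves_frequency_2 (T : R) (g : metric) (f : R -> R -> R) : Prop :=
  smooth_function T f /\
  forall t th, in_strip T t -> laplacian g f t th + 2 * f t th = 0.

Definition two_is_dirichlet_eigenvalue (T : R) (g : metric) : Prop :=
  exists f,
    solves_frequency_2 T g f /\
    (forall th, f T th = 0) /\
    exists t th, in_strip T t /\ f t th <> 0.

(** Graph of the operator D_2: u and w are functions of the boundary coordinate
    th, f is the extension of u to M_T, and w = D_2 u.  Smoothness and
    2 PI-periodicity of u follow from those of f. *)
Definition D2 (T : R) (g : metric) (u w : R -> R) : Prop :=
  exists f,
    solves_frequency_2 T g f /\
    (forall th, f T th = u th) /\
    (forall th, conormal_derivative T g f th = w th).

(** There are k + 1 linearly independent eigenfunctions of D_2 whose
    eigenvalues all satisfy P. *)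
Definition independent_eigenfunctions (T : R) (g : metric) (P : R -> Prop)
    (k : nat) : Prop :=
  exists (lambda : nat -> R) (u : nat -> R -> R),
    (forall j, (j <= k)%nat ->
       P (lambda j) /\ D2 T g (u j) (fun th => lambda j * u j th)) /\
    (forall c : nat -> R,
       (forall th, sum_f_R0 (fun j => c j * u j th) k = 0) ->
       forall j, (j <= k)%nat -> c j = 0).

(** s = sigma_k (g): s is the term of index k, starting from 0, of the
    nondecreasing list of the eigenvalues of D_2 counted with multiplicity.
    That is, at least k + 1 eigenvalues are <= s and at most k are < s. *)
Definition steklov_eigenvalue (T : R) (g : metric) (k : nat) (s : R) : Prop :=
  independent_eigenfunctions T g (fun l => l <= s) k /\
  ~ independent_eigenfunctions T g (fun l => l < s) k.

Definition steklov_eigenfunction (T : R) (g : metric) (s : R)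
    (f : R -> R -> R) : Prop :=
  solves_frequency_2 T g f /\
  forall th, conormal_derivative T g f th = s * f T th.

(** * Maps into S^n

  A vector of R^{n+1} is a function nat -> R of which only the values at
  0, ..., n matter. *)

Definition dot (n : nat) (x y : nat -> R) : R :=
  sum_f_R0 (fun i => x i * y i) n.

Definition on_sphere (n : nat) (x : nat -> R) : Prop := dot n x x = 1.

(** The cap B^n(r) of centre e_0, its boundary and its outward unit normal *)
Definition in_cap (n : nat) (r : R) (x : nat -> R) : Prop :=
  on_sphere n x /\ cos r <= x 0%nat.

Definition in_cap_boundary (n : nat) (r : R) (x : nat -> R) : Prop :=
  on_sphere n x /\ x 0%nat = cos r.

Definition e0 (i : nat) : R := match i with O => 1 | S _ => 0 end.

Definition cap_normal (r : R) (x : nat -> R) (i : nat) : R :=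
  / sin r * (cos r * x i - e0 i).

(** A map Phi into R^{n+1} is given by its coordinate functions phi_i. *)

Definition at_pt (Phi : nat -> R -> R -> R) (t th : R) : nat -> R :=
  fun i => Phi i t th.
Definition Phi_t (Phi : nat -> R -> R -> R) (t th : R) : nat -> R :=
  fun i => d_t (Phi i) t th.
Definition Phi_th (Phi : nat -> R -> R -> R) (t th : R) : nat -> R :=
  fun i => d_th (Phi i) t th.

(** g is the metric induced by Phi.  When g is positive definite, this makes
    Phi an immersion. *)
Definition induced_metric (n : nat) (T : R) (g : metric)
    (Phi : nat -> R -> R -> R) : Prop :=
  forall t th, in_strip T t ->
    gE g t th = dot n (Phi_t Phi t th) (Phi_t Phi t th) /\
    gF g t th = dot n (Phi_t Phi t th) (Phi_th Phi t th) /\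
    gG g t th = dot n (Phi_th Phi t th) (Phi_th Phi t th).

(** Orthogonal projection of a vector X of R^{n+1} onto the normal space of Phi
    in S^n, i.e. the orthogonal complement of Phi, Phi_t and Phi_th, for Phi
    with values in S^n and inducing g. *)
Definition normal_part (n : nat) (g : metric) (Phi : nat -> R -> R -> R)
    (t th : R) (X : nat -> R) (i : nat) : R :=
  let p := dot n X (Phi_t Phi t th) in
  let q := dot n X (Phi_th Phi t th) in
  X i - dot n X (at_pt Phi t th) * Phi i t th
  - (sharp_t g t th p q * Phi_t Phi t th i
     + sharp_th g t th p q * Phi_th Phi t th i).

(** The second fundamental form of Phi in S^n on two coordinate fields is the
    normal part of the corresponding second derivative of Phi; the mean
    curvature vector is its trace with respect to g. *)
Definition mean_curvature (n : nat) (g : metric) (Phi : nat -> R -> R -> R)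
    (t th : R) (i : nat) : R :=
  let II X := normal_part n g Phi t th X i in
  (gG g t th * II (fun j => d_t (d_t (Phi j)) t th)
   - 2 * gF g t th * II (fun j => d_t (d_th (Phi j)) t th)
   + gE g t th * II (fun j => d_th (d_th (Phi j)) t th)) / gdet g t th.

(** Phi : (M_T, g) -> B^n(r) is a free boundary minimal immersion. *)
Definition free_boundary_minimal_immersion (n : nat) (r T : R) (g : metric)
    (Phi : nat -> R -> R -> R) : Prop :=
  (forall i, (i <= n)%nat -> smooth_function T (Phi i)) /\
  induced_metric n T g Phi /\
  (forall t th, in_strip T t -> in_cap n r (at_pt Phi t th)) /\
  (forall th, in_cap_boundary n r (at_pt Phi T th)) /\
  (forall t th i, in_strip T t -> (i <= n)%nat ->
     mean_curvature n g Phi t th i = 0) /\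
  (forall th i, (i <= n)%nat ->
     conormal_derivative T g (Phi i) th = cap_normal r (at_pt Phi T th) i).

Definition by_first_steklov_eigenfunctions (n : nat) (T : R) (g : metric)
    (Phi : nat -> R -> R -> R) : Prop :=
  ~ two_is_dirichlet_eigenvalue T g /\
  exists s0 s1 : R,
    steklov_eigenvalue T g 0 s0 /\
    steklov_eigenvalue T g 1 s1 /\
    steklov_eigenfunction T g s0 (Phi 0%nat) /\
    forall i, (1 <= i <= n)%nat -> steklov_eigenfunction T g s1 (Phi i).

(* Main.v *)
(* A surface invariant under rotation by theta in (x1, x2) and by 2 theta in (x3, x4) is
   described by a curve (p, a, b) in the round 2-sphere.  In a conformal parameter t the surface
   is minimal when p'' = - 2 m p, a'' = (1 - 2 m) a, b'' = (4 - 2 m) b with m = a^2 + 4 b^2,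
   that is, when the curve is a geodesic of m times the round metric; it closes up to a Möbius
   band when p and b are even and a is odd.  The free boundary condition says that, where
   p = cos r, the geodesic points away from the pole (1, 0, 0).  We shoot geodesics backwards
   from such boundary points.  Those starting with a small reach a = 0 before turning
   perpendicular to the radial direction, those starting with b small turn first, so by
   connectedness one of them does both at once; the symmetries then follow from uniqueness.

   For the eigenvalues, let f solve the equation with d f / d nu = l f, where l < cot r.  Its
   mean over the circles is a multiple of p, by constancy of a Wronskian.  The rest splits into
   a part antiperiodic under theta -> theta + pi, vanishing at t = 0, and a part of period pi,
   mean 0 and with vanishing t-derivative at t = 0.  Comparing these with a and b respectively,
   the Wirtinger inequalities with constants 1 and 4 show that
   J(t) = int (g g_t - (w'/w) g^2) dtheta is nondecreasing from 0 (for g the part and w the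
   corresponding function a or b), while at the boundary it is a negative multiple of
   int g^2.  Hence f is a multiple of p. *)
Require Import Defs.
From Stdlib Require Import Reals Lra Lia Psatz FunctionalExtensionality Classical Nsatz.
From Coquelicot Require Import Coquelicot.
Open Scope R_scope.

(** Orthogonality at the boundary makes the conormal derivative of [phi_0] equal to [- sin r] where
    [phi_0 = cos r], and that of every other coordinate equal to [cot r] times the coordinate. The
    coordinates are thus eigenfunctions for [- tan r] and [cot r]; the issue is that nothing but
    multiples of [p] lies below [cot r]. This is why [a] and [b] have to be positive between core
    and boundary: a solution that keeps its sign can serve as denominator. The geodesics have to
    exist for all times and to depend continuously on the starting point. In the coordinates
    [(v, psi, chi)] the pole lies at [v] infinite and the field is bounded and globally Lipschitz,
    so that Picard iteration on the whole line suffices. [J] is half of [w ^ 2] times the derivative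
    of [N / w ^ 2], where [N] is the integral of [g ^ 2]: a nonzero [g] grows at least as fast as
    [w], which a smaller boundary slope forbids. For [w = a] the quotient [w' / w] is singular at
    the core and is controlled there by a limit. A function vanishing on the boundary satisfies the
    same comparison, which also excludes 2 as a Dirichlet eigenvalue. *)

Lemma continuous_of_is_derive (f : R -> R) (x l : R) :
  is_derive f x l -> continuous f x.
Proof. intros H; apply (ex_derive_continuous f); now exists l. Qed.

Lemma is_derive_Rconst (c x : R) : is_derive (fun _ : R => c) x 0.
Proof. exact (is_derive_const (V := R_NormedModule) c x). Qed.

Lemma is_derive_Rplus (f g : R -> R) (x l m : R) :
  is_derive f x l -> is_derive g x m -> is_derive (fun x => f x + g x) x (l + m).
Proof. exact (is_derive_plus (V := R_NormedModule) f g x l m). Qed.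

Lemma is_derive_Rminus (f g : R -> R) (x l m : R) :
  is_derive f x l -> is_derive g x m -> is_derive (fun x => f x - g x) x (l - m).
Proof. exact (is_derive_minus (V := R_NormedModule) f g x l m). Qed.

Lemma is_derive_Rmult (f g : R -> R) (x l m : R) :
  is_derive f x l -> is_derive g x m ->
  is_derive (fun x => f x * g x) x (l * g x + f x * m).
Proof. intros hf hg; apply (is_derive_mult f g); auto. intros; apply Rmult_comm. Qed.

Lemma is_derive_Rcomp (f g : R -> R) (x l m : R) :
  is_derive f (g x) l -> is_derive g x m -> is_derive (fun x => f (g x)) x (m * l).
Proof. exact (is_derive_comp f g x l m). Qed.

Lemma is_derive_eq (f : R -> R) (x l m : R) : is_derive f x l -> l = m -> is_derive f x m.
Proof. intros h <-; exact h. Qed.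

Lemma is_derive_continuity_pt (f : R -> R) (x l : R) :
  is_derive f x l -> continuity_pt f x.
Proof.
  intros H; apply continuity_pt_filterlim; exact (continuous_of_is_derive f x l H).
Qed.

Lemma mean_value (f f' : R -> R) (a b : R) :
  a <= b -> (forall x, a <= x <= b -> is_derive f x (f' x)) ->
  exists c, a <= c <= b /\ f b - f a = f' c * (b - a).
Proof.
  intros hab hd.
  destruct (MVT_gen f a b f') as [c [hc hc']].
  - intros x; rewrite Rmin_left, Rmax_right by lra; intros; apply hd; lra.
  - intros x; rewrite Rmin_left, Rmax_right by lra; intros.
    apply (is_derive_continuity_pt f x (f' x)), hd; lra.
  - rewrite Rmin_left, Rmax_right in hc by lra. now exists c.
Qed.

Lemma nondecreasing_of_deriv (f f' : R -> R) (a b : R) :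
  a <= b -> (forall x, a <= x <= b -> is_derive f x (f' x)) ->
  (forall x, a <= x <= b -> 0 <= f' x) -> f a <= f b.
Proof.
  intros hab hd hp.
  destruct (mean_value f f' a b hab hd) as [c [hc e]].
  specialize (hp c hc); nra.
Qed.

Lemma constant_of_deriv (f f' : R -> R) (a b : R) :
  a <= b -> (forall x, a <= x <= b -> is_derive f x (f' x)) ->
  (forall x, a <= x <= b -> f' x = 0) -> f a = f b.
Proof.
  intros hab hd hp.
  destruct (mean_value f f' a b hab hd) as [c [hc e]].
  rewrite (hp c hc) in e; lra.
Qed.

(** Comparing derivatives rather than integrals gives an estimate on both sides of [t0] at once; the
    bounds on the Picard iterates over the whole line rest on it. *)
Lemma Rabs_le_of_deriv (f g f' g' : R -> R) (t0 t : R) :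
  (forall x, is_derive f x (f' x)) -> (forall x, is_derive g x (g' x)) ->
  (forall x, Rabs (f' x) <= g' x) ->
  Rabs (f t - f t0) <= Rabs (g t - g t0).
Proof.
  intros hf hg hb.
  assert (hs : forall a b, a <= b -> Rabs (f b - f a) <= g b - g a).
  { intros a b hab. apply Rabs_le; split.
    - enough (g a + f a <= g b + f b) by lra.
      apply (nondecreasing_of_deriv (fun x => g x + f x) (fun x => g' x + f' x)); auto.
      + intros x _; apply is_derive_Rplus; auto.
      + intros x _; specialize (hb x); apply Rabs_le_between in hb; lra.
    - enough (g a - f a <= g b - f b) by lra.
      apply (nondecreasing_of_deriv (fun x => g x - f x) (fun x => g' x - f' x)); auto.
      + intros x _; apply is_derive_Rminus; auto.
      + intros x _; specialize (hb x); apply Rabs_le_between in hb; lra. }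
  destruct (Rle_dec t0 t) as [h | h].
  - eapply Rle_trans; [now apply hs | apply Rle_abs].
  - rewrite (Rabs_minus_sym (f t)), (Rabs_minus_sym (g t)).
    eapply Rle_trans; [apply hs; lra | apply Rle_abs].
Qed.

Lemma ex_RInt_of_continuous (f : R -> R) (a b : R) :
  (forall x, continuous f x) -> ex_RInt f a b.
Proof. intros h; apply (ex_RInt_continuous f); auto. Qed.

Lemma is_derive_primitive (f : R -> R) (c a t : R) :
  (forall x, continuous f x) -> is_derive (fun t => c + RInt f a t) t (f t).
Proof.
  intros hf.
  replace (f t) with (0 + f t) by ring.
  apply is_derive_Rplus; [apply is_derive_Rconst|].
  apply (is_derive_RInt (V := R_NormedModule) f _ a); auto.
  apply filter_forall; intros x.
  apply (RInt_correct (V := R_CompleteNormedModule)), ex_RInt_of_continuous, hf.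
Qed.

Lemma continuous_of_Lipschitz (f : R -> R) (K t : R) :
  (forall s, Rabs (f s - f t) <= K * Rabs (s - t)) -> continuous f t.
Proof.
  intros h. apply continuity_pt_filterlim. intros eps he.
  exists (eps / (Rabs K + 1)); split.
  - apply Rdiv_lt_0_compat; [lra | pose proof (Rabs_pos K); lra].
  - intros x [_ hx]. simpl in *. unfold Rdist in *.
    eapply Rle_lt_trans; [apply h|].
    pose proof (Rabs_pos K); pose proof (Rle_abs K); pose proof (Rabs_pos (x - t)).
    apply Rle_lt_trans with ((Rabs K + 1) * Rabs (x - t)); [nra|].
    replace eps with ((Rabs K + 1) * (eps / (Rabs K + 1))) by (field; lra).
    apply Rmult_lt_compat_l; lra.
Qed.

(** * Ordinary differential equations *)

Section Picard.

Variables (I : Type) (F : (I -> R) -> I -> R) (L M : R).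
Hypothesis L_pos : 0 < L.
Hypothesis F_bounded : forall x i, Rabs (F x i) <= M.
Hypothesis F_Lipschitz : forall x y B, (forall j, Rabs (x j - y j) <= B) ->
  forall i, Rabs (F x i - F y i) <= L * B.
Variable y0 : I -> R.

Fixpoint picard (n : nat) (i : I) (t : R) : R :=
  match n with
  | O => y0 i
  | S n => y0 i + RInt (fun s => F (fun j => picard n j s) i) 0 t
  end.

Lemma continuous_field (y : I -> R -> R) :
  (forall i s t, Rabs (y i s - y i t) <= M * Rabs (s - t)) ->
  forall i t, continuous (fun s => F (fun j => y j s) i) t.
Proof.
  intros hy i t. apply continuous_of_Lipschitz with (L * M); intros s.
  rewrite Rmult_assoc. apply F_Lipschitz. intros j; apply hy.
Qed.

Lemma Rabs_sub_le_of_bounded_deriv (f f' : R -> R) (s t : R) :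
  (forall x, is_derive f x (f' x)) -> (forall x, Rabs (f' x) <= M) ->
  Rabs (f s - f t) <= M * Rabs (s - t).
Proof.
  intros hf hb.
  assert (hM : 0 <= M) by (eapply Rle_trans; [apply Rabs_pos | apply (hb 0)]).
  replace (M * Rabs (s - t)) with (Rabs (M * s - M * t)).
  - apply (Rabs_le_of_deriv f (fun x => M * x) f' (fun _ => M)); auto.
    intros x; auto_derive; auto; ring.
  - rewrite <- Rmult_minus_distr_l, Rabs_mult, (Rabs_pos_eq M); auto.
Qed.

Lemma picard_Lipschitz (n : nat) (i : I) (s t : R) :
  Rabs (picard n i s - picard n i t) <= M * Rabs (s - t).
Proof.
  assert (hM : 0 <= M) by (eapply Rle_trans; [apply Rabs_pos | apply (F_bounded y0 i)]).
  revert i s t; induction n as [|n IH]; intros i s t.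
  - simpl. rewrite Rminus_diag, Rabs_R0. pose proof (Rabs_pos (s - t)); nra.
  - apply Rabs_sub_le_of_bounded_deriv with (fun x => F (fun j => picard n j x) i); auto.
    intros x. apply is_derive_primitive. intros; apply continuous_field; auto.
Qed.

Lemma is_derive_picard (n : nat) (i : I) (t : R) :
  is_derive (picard (S n) i) t (F (fun j => picard n j t) i).
Proof.
  apply is_derive_primitive.
  intros; apply continuous_field, picard_Lipschitz.
Qed.

(** A Bielecki weight: integrating [2 * L * weight] from 0 gives at most [weight], so that with
    Lipschitz constant [L] each Picard step halves the weighted error, uniformly over the whole
    line. *)
Let weight (t : R) : R := exp (2 * L * t) + exp (- (2 * L * t)).

Lemma weight_ge_2 (t : R) : 2 <= weight t.
Proof.
  unfold weight. rewrite exp_Ropp. pose proof (exp_pos (2 * L * t)) as h.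
  set (e := exp (2 * L * t)) in *.
  enough (0 <= (e - 1) ^ 2 / e) as h2.
  { replace ((e - 1) ^ 2 / e) with (e + / e - 2) in h2 by (field; lra). lra. }
  apply Rle_mult_inv_pos; auto. apply pow2_ge_0.
Qed.

Lemma Rabs_le_weight (f f' : R -> R) (c t : R) :
  0 <= c -> f 0 = 0 -> (forall x, is_derive f x (f' x)) ->
  (forall x, Rabs (f' x) <= c * (2 * L * weight x)) ->
  Rabs (f t) <= c * weight t.
Proof.
  intros hc h0 hf hb.
  set (g := fun t => c * (exp (2 * L * t) - exp (- (2 * L * t)))).
  apply Rle_trans with (Rabs (g t - g 0)).
  - replace (f t) with (f t - f 0) by lra.
    apply Rabs_le_of_deriv with f' (fun x => c * (2 * L * weight x)); auto.
    intros x; unfold g, weight; auto_derive; auto; ring.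
  - unfold g, weight. rewrite Rmult_0_r, Ropp_0.
    pose proof (exp_pos (2 * L * t)); pose proof (exp_pos (- (2 * L * t))).
    apply Rabs_le; split; nra.
Qed.

(** Chosen for the first step: [F] is bounded by [M], and [M <= C * (2 * L * weight)] because
    [weight >= 2]. *)
Let C := M / (4 * L).

Lemma C_nonneg (i : I) : 0 <= C.
Proof.
  assert (hM : 0 <= M) by (eapply Rle_trans; [apply Rabs_pos | apply (F_bounded y0 i)]).
  apply Rle_mult_inv_pos; lra.
Qed.

Lemma picard_step (n : nat) (i : I) (t : R) :
  Rabs (picard (S n) i t - picard n i t) <= C * (/ 2) ^ n * weight t.
Proof.
  assert (hC := C_nonneg i).
  assert (h0 : forall n i, picard n i 0 = y0 i).
  { intros [|k] j; simpl; [reflexivity|]. rewrite RInt_point. apply Rplus_0_r. }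
  revert i t; induction n as [|n IH]; intros i t.
  - apply (Rabs_le_weight (fun t => picard 1 i t - picard 0 i t) (fun _ => F y0 i)).
    + simpl; lra.
    + rewrite !h0; ring.
    + intros x. replace (F y0 i) with (F y0 i - 0) by ring.
      apply is_derive_Rminus.
      * apply (is_derive_picard 0).
      * apply is_derive_Rconst.
    + intros x. eapply Rle_trans; [apply F_bounded|].
      pose proof (weight_ge_2 x).
      unfold C. replace (M / (4 * L) * (/ 2) ^ 0 * (2 * L * weight x))
        with (M * (weight x / 2)) by (simpl; field; lra).
      assert (hM : 0 <= M) by (eapply Rle_trans; [apply Rabs_pos | apply (F_bounded y0 i)]).
      nra.
  - apply (Rabs_le_weight (fun t => picard (S (S n)) i t - picard (S n) i t)
      (fun t => F (fun j => picard (S n) j t) i - F (fun j => picard n j t) i)).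
    + apply Rmult_le_pos; auto. apply pow_le; lra.
    + rewrite !h0; ring.
    + intros x. apply is_derive_Rminus; apply is_derive_picard.
    + intros x. replace (C * (/ 2) ^ S n * (2 * L * weight x))
        with (L * (C * (/ 2) ^ n * weight x)) by (simpl; field).
      apply F_Lipschitz; intros j; apply IH.
Qed.

Lemma picard_Cauchy (n k : nat) (i : I) (t : R) :
  Rabs (picard (n + k) i t - picard n i t) <= 2 * C * (/ 2) ^ n * weight t.
Proof.
  assert (hC := C_nonneg i). pose proof (weight_ge_2 t).
  (* The partial geometric sum is kept exactly, since the weaker bound of the statement does not
     pass through the induction on [k]. *)
  enough (Rabs (picard (n + k) i t - picard n i t)
    <= 2 * C * ((/ 2) ^ n - (/ 2) ^ (n + k)) * weight t) as h.
  { eapply Rle_trans; [exact h|]. assert (0 <= (/ 2) ^ (n + k)) by (apply pow_le; lra).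
    apply Rmult_le_compat_r; [lra|]. apply Rmult_le_compat_l; lra. }
  induction k as [|k IH].
  - rewrite Nat.add_0_r, !Rminus_diag, Rabs_R0; lra.
  - rewrite Nat.add_succ_r.
    replace (picard (S (n + k)) i t - picard n i t) with
      (picard (S (n + k)) i t - picard (n + k) i t + (picard (n + k) i t - picard n i t))
      by ring.
    eapply Rle_trans; [apply Rabs_triang|].
    pose proof (picard_step (n + k) i t). simpl pow. nra.
Qed.

Definition picard_limit (i : I) (t : R) : R := real (Lim_seq (fun n => picard n i t)).

Lemma is_lim_seq_picard_error (t : R) :
  is_lim_seq (fun n => 2 * C * (/ 2) ^ n * weight t) 0.
Proof.
  replace (Finite 0) with (Finite (2 * C * 0 * weight t)) by (f_equal; ring).
  apply (is_lim_seq_scal_r _ (weight t) (Finite _)), (is_lim_seq_scal_l _ (2 * C) (Finite _)).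
  apply is_lim_seq_geom. rewrite Rabs_pos_eq; lra.
Qed.

Lemma is_lim_seq_picard (i : I) (t : R) :
  is_lim_seq (fun n => picard n i t) (picard_limit i t).
Proof.
  apply Lim_seq_correct', ex_lim_seq_cauchy_corr.
  intros eps.
  assert (h := is_lim_seq_picard_error t).
  apply is_lim_seq_spec in h. destruct (h (pos_div_2 eps)) as [N hN].
  exists N. intros n m hn hm. specialize (hN N (le_n N)).
  replace n with (N + (n - N))%nat by lia. replace m with (N + (m - N))%nat by lia.
  pose proof (picard_Cauchy N (n - N) i t) as h1.
  pose proof (picard_Cauchy N (m - N) i t) as h2.
  rewrite Rminus_0_r in hN. apply Rabs_lt_between in hN. simpl in hN.
  apply Rabs_le_between in h1, h2. apply Rabs_lt_between. lra.
Qed.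

Lemma picard_limit_error (n : nat) (i : I) (t : R) :
  Rabs (picard_limit i t - picard n i t) <= 2 * C * (/ 2) ^ n * weight t.
Proof.
  apply (is_lim_seq_le (fun k => Rabs (picard (k + n) i t - picard n i t))
    (fun _ => 2 * C * (/ 2) ^ n * weight t)
    (Finite (Rabs (picard_limit i t - picard n i t)))
    (Finite (2 * C * (/ 2) ^ n * weight t))).
  - intros k. rewrite Nat.add_comm. apply picard_Cauchy.
  - apply (is_lim_seq_abs _ (Finite _)).
    apply (is_lim_seq_minus' _ _ (picard_limit i t) (picard n i t)); [|apply is_lim_seq_const].
    apply (is_lim_seq_incr_n (fun n => picard n i t)), is_lim_seq_picard.
  - apply is_lim_seq_const.
Qed.

Lemma eq_of_picard_error (t x c : R) :
  (forall n, Rabs x <= c * (2 * C * (/ 2) ^ n * weight t)) -> x = 0.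
Proof.
  intros h. apply Rabs_eq_0. apply Rle_antisym; [|apply Rabs_pos].
  apply (is_lim_seq_le (fun _ => Rabs x) (fun n => c * (2 * C * (/ 2) ^ n * weight t))
    (Finite (Rabs x)) (Finite 0)); auto.
  - apply is_lim_seq_const.
  - replace (Finite 0) with (Finite (c * 0)) by (f_equal; ring).
    apply (is_lim_seq_scal_l _ c (Finite _)), is_lim_seq_picard_error.
Qed.

Lemma picard_limit_Lipschitz (i : I) (s t : R) :
  Rabs (picard_limit i s - picard_limit i t) <= M * Rabs (s - t).
Proof.
  apply (is_lim_seq_le (fun n => Rabs (picard n i s - picard n i t))
    (fun _ => M * Rabs (s - t))
    (Finite (Rabs (picard_limit i s - picard_limit i t))) (Finite (M * Rabs (s - t)))).
  - intros n; apply picard_Lipschitz.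
  - apply (is_lim_seq_abs _ (Finite _)).
    apply (is_lim_seq_minus' _ _ (picard_limit i s) (picard_limit i t));
      apply is_lim_seq_picard.
  - apply is_lim_seq_const.
Qed.

(** Both sides are close to [picard (S n)]: the left by the error of the limit, the right because
    one more iteration halves the error of [picard n]. Each contributes
    [C * (/ 2) ^ n * weight t]. *)
Lemma picard_limit_eq (i : I) (t : R) :
  picard_limit i t = y0 i + RInt (fun s => F (fun j => picard_limit j s) i) 0 t.
Proof.
  set (Z := fun t => y0 i + RInt (fun s => F (fun j => picard_limit j s) i) 0 t).
  change (picard_limit i t = Z t).
  assert (hC := C_nonneg i).
  assert (hpow : forall n, 0 <= (/ 2) ^ n) by (intros; apply pow_le; lra).
  apply Rminus_diag_uniq, eq_of_picard_error with t 1. intros n.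
  assert (hZ : Rabs (picard (S n) i t - Z t) <= C * (/ 2) ^ n * weight t).
  { apply (Rabs_le_weight (fun t => picard (S n) i t - Z t)
      (fun t => F (fun j => picard n j t) i - F (fun j => picard_limit j t) i)).
    - specialize (hpow n); nra.
    - unfold Z; simpl. rewrite !RInt_point. apply Rminus_diag.
    - intros x. apply is_derive_Rminus.
      + apply is_derive_picard.
      + apply is_derive_primitive. intros; apply continuous_field, picard_limit_Lipschitz.
    - intros x.
      replace (C * (/ 2) ^ n * (2 * L * weight x))
        with (L * (2 * C * (/ 2) ^ n * weight x)) by (simpl; field).
      apply F_Lipschitz; intros j. rewrite Rabs_minus_sym. apply picard_limit_error. }
  replace (picard_limit i t - Z t) with
    (picard_limit i t - picard (S n) i t + (picard (S n) i t - Z t)) by ring.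
  eapply Rle_trans; [apply Rabs_triang|].
  pose proof (picard_limit_error (S n) i t) as h. simpl pow in h.
  lra.
Qed.

Lemma picard_limit_initial (i : I) : picard_limit i 0 = y0 i.
Proof. rewrite picard_limit_eq, RInt_point. apply Rplus_0_r. Qed.

Lemma is_derive_picard_limit (i : I) (t : R) :
  is_derive (picard_limit i) t (F (fun j => picard_limit j t) i).
Proof.
  apply (is_derive_ext
    (fun t => y0 i + RInt (fun s => F (fun j => picard_limit j s) i) 0 t)).
  - intros s; symmetry; apply picard_limit_eq.
  - apply is_derive_primitive. intros; apply continuous_field, picard_limit_Lipschitz.
Qed.

End Picard.

(** * Hyperbolic functions *)

Lemma sin_sqr (x : R) : sin x ^ 2 = 1 - cos x ^ 2.
Proof. pose proof (sin2_cos2 x) as H; unfold Rsqr in H; lra. Qed.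

Lemma cosh_ge_1 (x : R) : 1 <= cosh x.
Proof.
  unfold cosh. rewrite exp_Ropp. pose proof (exp_pos x) as h. set (e := exp x) in *.
  assert (0 <= (e - 1) ^ 2 / e) as h2 by (apply Rle_mult_inv_pos; auto; apply pow2_ge_0).
  replace ((e - 1) ^ 2 / e) with (e + / e - 2) in h2 by (field; lra). lra.
Qed.

Lemma sinh_sqr (x : R) : sinh x ^ 2 = cosh x ^ 2 - 1.
Proof.
  unfold sinh, cosh. rewrite exp_Ropp. pose proof (exp_pos x). field; lra.
Qed.

Lemma is_derive_cosh (x : R) : is_derive cosh x (sinh x).
Proof. apply is_derive_Reals, derivable_pt_lim_cosh. Qed.

Lemma is_derive_tanh (x : R) : is_derive tanh x (/ cosh x ^ 2).
Proof.
  pose proof (cosh_ge_1 x). pose proof (sinh_sqr x).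
  apply is_derive_eq with ((cosh x * cosh x - sinh x * sinh x) / cosh x ^ 2).
  - apply (is_derive_div sinh cosh); [| apply is_derive_cosh | lra].
    apply is_derive_Reals, derivable_pt_lim_sinh.
  - replace (cosh x * cosh x - sinh x * sinh x) with 1 by lra. field; lra.
Qed.

Lemma tanh_sqr (x : R) : tanh x ^ 2 = 1 - / cosh x ^ 2.
Proof.
  pose proof (cosh_ge_1 x).
  replace (tanh x ^ 2) with (sinh x ^ 2 / cosh x ^ 2) by (unfold tanh; field; lra).
  rewrite sinh_sqr. field; lra.
Qed.

Lemma Rabs_tanh_le_1 (x : R) : Rabs (tanh x) <= 1.
Proof.
  pose proof (tanh_sqr x). pose proof (cosh_ge_1 x).
  assert (0 < / cosh x ^ 2) by (apply Rinv_0_lt_compat; nra).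
  apply Rabs_le; split; nra.
Qed.

Lemma tanh_le (x y : R) : x <= y -> tanh x <= tanh y.
Proof.
  intros hxy. apply (nondecreasing_of_deriv tanh (fun x => / cosh x ^ 2)); auto.
  - intros; apply is_derive_tanh.
  - intros z _. pose proof (cosh_ge_1 z). left; apply Rinv_0_lt_compat; nra.
Qed.

Lemma tanh_0 : tanh 0 = 0.
Proof. unfold tanh, Rdiv. rewrite sinh_0. ring. Qed.

(** * The equation of the profile curve *)

Definition speed (x : R) : R := sqrt (1 + 3 * cos x ^ 2).

Lemma speed_sqr (x : R) : speed x ^ 2 = 1 + 3 * cos x ^ 2.
Proof. apply pow2_sqrt. pose proof (pow2_ge_0 (cos x)); lra. Qed.

Lemma speed_bounds (x : R) : 1 <= speed x <= 2.
Proof.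
  unfold speed; split.
  - rewrite <- sqrt_1 at 1. apply sqrt_le_1_alt. pose proof (pow2_ge_0 (cos x)); lra.
  - replace 2 with (sqrt (2 ^ 2)) by (apply sqrt_pow2; lra).
    apply sqrt_le_1_alt. pose proof (pow2_ge_0 (sin x)). rewrite sin_sqr in H. lra.
Qed.

Lemma is_derive_speed (x : R) : is_derive speed x (- (3 * cos x * sin x / speed x)).
Proof.
  pose proof (speed_bounds x). unfold speed.
  auto_derive.
  - pose proof (pow2_ge_0 (cos x)); lra.
  - fold (speed x). change (1 + 3 * (cos x * (cos x * 1))) with (1 + 3 * cos x ^ 2).
    fold (speed x). field; lra.
Qed.

Inductive coord := co_v | co_psi | co_chi.

(** In the [(v, psi)] plane the metric is conformally flat with logarithmic factor
    [ln (speed psi) - 2 * ln (cosh v)]. The two terms are [speed psi] times the derivative of that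
    factor along the normal [(sin chi, cos chi)] of the curve, with the sign changed: this is how a
    geodesic turns in a conformally flat plane. *)
Definition chi_rate (v psi chi : R) : R :=
  2 * (speed psi * (tanh v * sin chi)) + 3 * (cos psi * (sin psi * (cos chi * / speed psi))).

(* The system is the geodesic equation, in the time of the flat cylinder, for the metric
   [m = a^2 + 4 b^2] times the round metric on the sphere, in the coordinates
   [(p, a, b) = (tanh v, sin psi / cosh v, cos psi / cosh v)]; [chi] is the direction of the
   curve and [speed psi = sqrt m * cosh v]. *)
Definition field (x : coord -> R) (i : coord) : R :=
  match i with
  | co_v => speed (x co_psi) * cos (x co_chi)
  | co_psi => - (speed (x co_psi) * sin (x co_chi))
  | co_chi => chi_rate (x co_v) (x co_psi) (x co_chi)
  end.

(** The bound is carried along with the Lipschitz constant because together they are stable under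
    products. *)
Definition bounded_Lipschitz (f : (coord -> R) -> R) : Prop :=
  exists K, 0 < K /\ (forall x, Rabs (f x) <= K) /\
    forall x y B, (forall j, Rabs (x j - y j) <= B) -> Rabs (f x - f y) <= K * B.

Lemma bounded_Lipschitz_comp (g g' : R -> R) (K : R) (i : coord) :
  0 < K -> (forall x, is_derive g x (g' x)) -> (forall x, Rabs (g x) <= K) ->
  (forall x, Rabs (g' x) <= K) -> bounded_Lipschitz (fun x => g (x i)).
Proof.
  intros hK hd hb hb'. exists K; repeat split; auto.
  intros x y B hB.
  eapply Rle_trans; [apply (Rabs_sub_le_of_bounded_deriv K g g'); auto|].
  apply Rmult_le_compat_l; [lra | apply hB].
Qed.

Lemma bounded_Lipschitz_mult (f g : (coord -> R) -> R) :
  bounded_Lipschitz f -> bounded_Lipschitz g -> bounded_Lipschitz (fun x => f x * g x).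
Proof.
  intros [K [hK [hf hf']]] [N [hN [hg hg']]].
  exists (2 * (K * N)); repeat split.
  - nra.
  - intros x. rewrite Rabs_mult. specialize (hf x); specialize (hg x).
    pose proof (Rabs_pos (f x)); pose proof (Rabs_pos (g x)). nra.
  - intros x y B hB. specialize (hf' x y B hB); specialize (hg' x y B hB).
    replace (f x * g x - f y * g y) with ((f x - f y) * g x + f y * (g x - g y)) by ring.
    eapply Rle_trans; [apply Rabs_triang|]. rewrite !Rabs_mult.
    specialize (hf y); specialize (hg x).
    replace (2 * (K * N) * B) with (K * B * N + K * (N * B)) by ring.
    apply Rplus_le_compat; apply Rmult_le_compat; auto using Rabs_pos.
Qed.

Lemma bounded_Lipschitz_plus (f g : (coord -> R) -> R) :
  bounded_Lipschitz f -> bounded_Lipschitz g -> bounded_Lipschitz (fun x => f x + g x).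
Proof.
  intros [K [hK [hf hf']]] [N [hN [hg hg']]].
  exists (K + N); repeat split; [lra| |].
  - intros x. eapply Rle_trans; [apply Rabs_triang|]. specialize (hf x); specialize (hg x); lra.
  - intros x y B hB. specialize (hf' x y B hB); specialize (hg' x y B hB).
    replace (f x + g x - (f y + g y)) with (f x - f y + (g x - g y)) by ring.
    eapply Rle_trans; [apply Rabs_triang|]. lra.
Qed.

Lemma bounded_Lipschitz_const (c : R) : bounded_Lipschitz (fun _ => c).
Proof.
  exists (Rabs c + 1); pose proof (Rabs_pos c); repeat split; [lra | intros; lra |].
  intros x y B hB. rewrite Rminus_diag, Rabs_R0.
  specialize (hB co_v). pose proof (Rabs_pos (x co_v - y co_v)). nra.
Qed.

Lemma Rabs_sin_le_1 (x : R) : Rabs (sin x) <= 1.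
Proof. apply Rabs_le; pose proof (SIN_bound x); lra. Qed.

Lemma Rabs_cos_le_1 (x : R) : Rabs (cos x) <= 1.
Proof. apply Rabs_le; pose proof (COS_bound x); lra. Qed.

Lemma bounded_Lipschitz_sin (i : coord) : bounded_Lipschitz (fun x => sin (x i)).
Proof.
  apply bounded_Lipschitz_comp with cos 1; auto using Rlt_0_1, Rabs_sin_le_1, Rabs_cos_le_1.
  exact is_derive_sin.
Qed.

Lemma bounded_Lipschitz_cos (i : coord) : bounded_Lipschitz (fun x => cos (x i)).
Proof.
  apply bounded_Lipschitz_comp with (fun x => - sin x) 1; auto using Rlt_0_1, Rabs_cos_le_1.
  - intros; apply (is_derive_cos).
  - intros; rewrite Rabs_Ropp; apply Rabs_sin_le_1.
Qed.

Lemma bounded_Lipschitz_tanh (i : coord) : bounded_Lipschitz (fun x => tanh (x i)).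
Proof.
  apply bounded_Lipschitz_comp with (fun x => / cosh x ^ 2) 1;
    auto using Rlt_0_1, is_derive_tanh, Rabs_tanh_le_1.
  intros x. pose proof (cosh_ge_1 x).
  rewrite Rabs_pos_eq.
  - rewrite <- Rinv_1. apply Rinv_le_contravar; nra.
  - left; apply Rinv_0_lt_compat; nra.
Qed.

Lemma Rabs_cos_sin_div (x d : R) : 1 <= d -> Rabs (3 * cos x * sin x / d) <= 3.
Proof.
  intros hd. unfold Rdiv. rewrite !Rabs_mult, Rabs_inv, (Rabs_pos_eq 3), (Rabs_pos_eq d) by lra.
  pose proof (Rabs_sin_le_1 x); pose proof (Rabs_cos_le_1 x).
  pose proof (Rabs_pos (sin x)); pose proof (Rabs_pos (cos x)).
  assert (0 < / d <= 1) as [h1 h2].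
  { split; [apply Rinv_0_lt_compat; lra|]. rewrite <- Rinv_1. apply Rinv_le_contravar; lra. }
  assert (Rabs (cos x) * Rabs (sin x) <= 1) by nra.
  assert (0 <= Rabs (cos x) * Rabs (sin x)) by nra.
  nra.
Qed.

Lemma bounded_Lipschitz_speed (i : coord) : bounded_Lipschitz (fun x => speed (x i)).
Proof.
  apply bounded_Lipschitz_comp with (fun x => - (3 * cos x * sin x / speed x)) 3;
    auto using is_derive_speed; [lra | |]; intros x; pose proof (speed_bounds x).
  - apply Rabs_le; lra.
  - rewrite Rabs_Ropp. apply Rabs_cos_sin_div; lra.
Qed.

Lemma bounded_Lipschitz_inv_speed (i : coord) : bounded_Lipschitz (fun x => / speed (x i)).
Proof.
  apply (bounded_Lipschitz_comp (fun x => / speed x)) with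
    (fun x => 3 * cos x * sin x / (speed x * speed x ^ 2)) 3; [lra| | |];
    intros x; pose proof (speed_bounds x).
  - eapply is_derive_eq.
    + apply (is_derive_inv speed); [apply is_derive_speed | lra].
    + field; lra.
  - rewrite Rabs_pos_eq; [| left; apply Rinv_0_lt_compat; lra].
    apply Rle_trans with (/ 1); [apply Rinv_le_contravar|]; lra.
  - apply Rabs_cos_sin_div. nra.
Qed.

Ltac bounded_Lipschitz_tac :=
  repeat first
    [ apply bounded_Lipschitz_const | apply bounded_Lipschitz_sin
    | apply bounded_Lipschitz_cos | apply bounded_Lipschitz_tanh
    | apply bounded_Lipschitz_speed | apply bounded_Lipschitz_inv_speed
    | apply bounded_Lipschitz_plus | apply bounded_Lipschitz_mult ].

Lemma bounded_Lipschitz_field (i : coord) : bounded_Lipschitz (fun x => field x i).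
Proof.
  destruct i; unfold field, chi_rate.
  - bounded_Lipschitz_tac.
  - replace (fun x : coord -> R => - (speed (x co_psi) * sin (x co_chi)))
      with (fun x : coord -> R => - 1 * (speed (x co_psi) * sin (x co_chi)))
      by (apply functional_extensionality; intros; ring).
    bounded_Lipschitz_tac.
  - bounded_Lipschitz_tac.
Qed.

Lemma field_bounds :
  exists K, 0 < K /\ (forall x i, Rabs (field x i) <= K) /\
    forall x y B, (forall j, Rabs (x j - y j) <= B) ->
    forall i, Rabs (field x i - field y i) <= K * B.
Proof.
  destruct (bounded_Lipschitz_field co_v) as [K1 [h1 [b1 l1]]].
  destruct (bounded_Lipschitz_field co_psi) as [K2 [h2 [b2 l2]]].
  destruct (bounded_Lipschitz_field co_chi) as [K3 [h3 [b3 l3]]].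
  exists (K1 + K2 + K3); repeat split; [lra| |].
  - intros x []; [specialize (b1 x) | specialize (b2 x) | specialize (b3 x)]; lra.
  - intros x y B hB.
    assert (0 <= B) by (eapply Rle_trans; [apply Rabs_pos | apply (hB co_v)]).
    specialize (l1 x y B hB); specialize (l2 x y B hB); specialize (l3 x y B hB).
    intros []; nra.
Qed.

(** * Existence, uniqueness and continuous dependence of solutions *)

Record solution (v psi chi : R -> R) : Prop := {
  sol_v : forall s, is_derive v s (speed (psi s) * cos (chi s));
  sol_psi : forall s, is_derive psi s (- (speed (psi s) * sin (chi s)));
  sol_chi : forall s, is_derive chi s (chi_rate (v s) (psi s) (chi s))
}.

(** With [tanh v0 = cos r] the curves start on the boundary of the cap; [chi = 0] makes them
    orthogonal to it and directed towards the pole. The starting angle [q] is the shooting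
    parameter. *)
Lemma flow_exists (v0 : R) :
  exists v psi chi : R -> R -> R, forall q,
    solution (v q) (psi q) (chi q) /\ v q 0 = v0 /\ psi q 0 = q /\ chi q 0 = 0.
Proof.
  destruct field_bounds as [K [hK [hb hL]]].
  set (y0 := fun q i => match i with co_v => v0 | co_psi => q | co_chi => 0 end).
  set (y := fun q => picard_limit coord field (y0 q)).
  assert (hy0 : forall q i, y q i 0 = y0 q i)
    by (intros; apply picard_limit_initial with K K; auto).
  assert (hy : forall q i s, is_derive (y q i) s (field (fun j => y q j s) i))
    by (intros; apply is_derive_picard_limit with K K; auto).
  exists (fun q => y q co_v), (fun q => y q co_psi), (fun q => y q co_chi). intros q. split.
  - split; intros s; [exact (hy q co_v s) | exact (hy q co_psi s) | exact (hy q co_chi s)].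
  - exact (conj (hy0 q co_v) (conj (hy0 q co_psi) (hy0 q co_chi))).
Qed.

Lemma gronwall (f f' : R -> R) (K a b : R) :
  a <= b -> (forall x, is_derive f x (f' x)) -> (forall x, a <= x <= b -> f' x <= K * f x) ->
  f b <= f a * exp (K * (b - a)).
Proof.
  intros hab hd hb.
  assert (h : - (f a * exp (- K * (a - a))) <= - (f b * exp (- K * (b - a)))).
  { apply (nondecreasing_of_deriv (fun x => - (f x * exp (- K * (x - a))))
      (fun x => (K * f x - f' x) * exp (- K * (x - a)))); auto.
    - intros x _.
      assert (he : is_derive (fun x => exp (- K * (x - a))) x (- K * exp (- K * (x - a))))
        by (auto_derive; auto; unfold Rminus; ring).
      eapply is_derive_eq.
      + exact (is_derive_opp (V := R_NormedModule) _ _ _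
          (is_derive_Rmult _ _ _ _ _ (hd x) he)).
      + unfold opp; simpl. ring.
    - intros x hx. specialize (hb x hx). pose proof (exp_pos (- K * (x - a))). nra. }
  rewrite Rminus_diag, Rmult_0_r, exp_0 in h.
  replace (K * (b - a)) with (- (- K * (b - a))) by ring.
  rewrite exp_Ropp.
  pose proof (exp_pos (- K * (b - a))).
  apply Rmult_le_reg_r with (exp (- K * (b - a))); auto.
  rewrite Rmult_assoc, Rinv_l by lra. lra.
Qed.

(** The Euclidean distance, squared, is differentiable, as Gronwall's inequality requires; the
    Lipschitz bound of the field is in the maximum norm. *)
Definition dist2 (v psi chi v' psi' chi' : R -> R) (s : R) : R :=
  (v s - v' s) ^ 2 + (psi s - psi' s) ^ 2 + (chi s - chi' s) ^ 2.

Lemma continuous_dependence :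
  exists K, 0 < K /\ forall v psi chi v' psi' chi',
    solution v psi chi -> solution v' psi' chi' ->
    forall a b, a <= b ->
    dist2 v psi chi v' psi' chi' b <= dist2 v psi chi v' psi' chi' a * exp (K * (b - a)).
Proof.
  destruct field_bounds as [K [hK [_ hL]]].
  (* The derivative of the squared distance [D] is twice a sum of three terms, each at most
     [K * D]. *)
  exists (6 * K); split; [lra|].
  intros v psi chi v' psi' chi' H H' a b hab.
  set (y := fun s i => match i with co_v => v s | co_psi => psi s | co_chi => chi s end).
  set (z := fun s i => match i with co_v => v' s | co_psi => psi' s | co_chi => chi' s end).
  assert (hy : forall i s, is_derive (fun s => y s i) s (field (y s) i))
    by (intros [] s; apply H).
  assert (hz : forall i s, is_derive (fun s => z s i) s (field (z s) i))
    by (intros [] s; apply H').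
  set (d := fun i s => y s i - z s i).
  set (d' := fun i s => field (y s) i - field (z s) i).
  assert (hd : forall i s, is_derive (d i) s (d' i s))
    by (intros i s; apply is_derive_Rminus; auto).
  apply (gronwall (dist2 v psi chi v' psi' chi')
    (fun s => 2 * (d co_v s * d' co_v s + d co_psi s * d' co_psi s + d co_chi s * d' co_chi s)));
    auto.
  - intros s.
    apply (is_derive_ext (fun s => d co_v s * d co_v s + d co_psi s * d co_psi s
      + d co_chi s * d co_chi s)).
    + intros t. unfold dist2, d; simpl. ring.
    + assert (hs : forall i, is_derive (fun s => d i s * d i s) s (2 * (d i s * d' i s))).
      { intros i. eapply is_derive_eq.
        - exact (is_derive_Rmult _ _ _ _ _ (hd i s) (hd i s)).
        - ring. }
      eapply is_derive_eq; [exact (is_derive_Rplus _ _ _ _ _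
        (is_derive_Rplus _ _ _ _ _ (hs co_v) (hs co_psi)) (hs co_chi)) | ring].
  - intros s _. set (D := dist2 v psi chi v' psi' chi' s).
    assert (hD : 0 <= D)
      by (unfold D, dist2; repeat apply Rplus_le_le_0_compat; apply pow2_ge_0).
    assert (hB : forall i, Rabs (d i s) <= sqrt D).
    { intros i. rewrite <- sqrt_Rsqr_abs. apply sqrt_le_1_alt. unfold Rsqr.
      pose proof (pow2_ge_0 (v s - v' s)).
      pose proof (pow2_ge_0 (psi s - psi' s)). pose proof (pow2_ge_0 (chi s - chi' s)).
      destruct i; unfold d, D, dist2; simpl; nra. }
    assert (hd' : forall i, d i s * d' i s <= K * D).
    { intros i. eapply Rle_trans; [apply Rle_abs|]. rewrite Rabs_mult.
      replace (K * D) with (sqrt D * (K * sqrt D)).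
      - apply Rmult_le_compat; auto using Rabs_pos. now apply hL.
      - rewrite Rmult_comm, Rmult_assoc, sqrt_sqrt by auto. reflexivity. }
    pose proof (hd' co_v); pose proof (hd' co_psi); pose proof (hd' co_chi).
    cbv beta. fold D. lra.
Qed.

Lemma solution_unique (v psi chi v' psi' chi' : R -> R) (a b : R) :
  solution v psi chi -> solution v' psi' chi' -> a <= b ->
  v a = v' a -> psi a = psi' a -> chi a = chi' a ->
  v b = v' b /\ psi b = psi' b /\ chi b = chi' b.
Proof.
  intros H H' hab e1 e2 e3.
  destruct continuous_dependence as [K [_ h]].
  specialize (h _ _ _ _ _ _ H H' a b hab).
  assert (e : dist2 v psi chi v' psi' chi' a = 0) by (unfold dist2; rewrite e1, e2, e3; ring).
  rewrite e, Rmult_0_l in h. unfold dist2 in h.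
  pose proof (pow2_ge_0 (v b - v' b)); pose proof (pow2_ge_0 (psi b - psi' b));
    pose proof (pow2_ge_0 (chi b - chi' b)).
  repeat split; nra.
Qed.

(** * Connectedness, first exit times and elementary estimates *)

Lemma continuity_near (f : R -> R) (x eps : R) :
  continuity_pt f x -> 0 < eps ->
  exists d, 0 < d /\ forall y, Rabs (y - x) < d -> Rabs (f y - f x) < eps.
Proof.
  intros hf he. destruct (hf eps he) as [d [hd h]]. exists d; split; auto.
  intros y hy. destruct (Req_dec y x) as [->|hn].
  - now rewrite Rminus_diag, Rabs_R0.
  - apply h. split; [split; [exact I | auto] | exact hy].
Qed.

(** [c] is the supremum of the [x] such that [f] is positive on all of [[a, x]]; by continuity
    neither sign of [f c] is possible. *)
Lemma first_exit (f : R -> R) (a b : R) :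
  a <= b -> (forall x, continuity_pt f x) -> 0 < f a -> f b <= 0 ->
  exists c, a < c <= b /\ f c = 0 /\ forall x, a <= x < c -> 0 < f x.
Proof.
  intros hab hf ha hb.
  set (E := fun x => a <= x <= b /\ forall y, a <= y <= x -> 0 < f y).
  destruct (completeness E) as [c [hc1 hc2]].
  - exists b. intros x [hx _]; lra.
  - exists a. split; [lra|]. intros y hy. now replace y with a by lra.
  - assert (hEa : E a) by (split; [lra|]; intros y hy; now replace y with a by lra).
    assert (hac : a <= c) by (now apply hc1).
    assert (hcb : c <= b) by (apply hc2; intros x [hx _]; lra).
    assert (hlt : forall x, a <= x < c -> 0 < f x).
    { intros x hx. apply NNPP; intros hn.
      enough (c <= x) by lra. apply hc2. intros y [hy hy'].
      destruct (Rle_dec y x); auto. exfalso; apply hn, hy'; lra. }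
    assert (hfc : f c = 0).
    { destruct (Rtotal_order (f c) 0) as [h | [h | h]]; auto.
      - destruct (continuity_near f c (- f c) (hf c)) as [d [hd hnear]]; [lra|].
        assert (hca : a < c) by (destruct (Req_dec a c) as [<-|]; lra).
        set (x := Rmax a (c - d / 2)).
        assert (hx : a <= x < c) by (unfold x, Rmax; destruct Rle_dec; lra).
        assert (Rabs (x - c) < d) by (unfold x, Rmax; destruct Rle_dec; apply Rabs_lt_between; lra).
        specialize (hnear x H). specialize (hlt x hx). apply Rabs_lt_between in hnear. lra.
      - destruct (continuity_near f c (f c) (hf c)) as [d [hd hnear]]; [lra|].
        assert (c < b) by (destruct (Req_dec c b) as [->|]; lra).
        set (x := Rmin b (c + d / 2)).
        assert (hx : c < x <= b) by (unfold x, Rmin; destruct Rle_dec; lra).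
        assert (E x).
        { split; [lra|]. intros y hy. destruct (Rlt_dec y c); [apply hlt; lra|].
          assert (Rabs (y - c) < d)
            by (revert hy; unfold x, Rmin; destruct Rle_dec; intros; apply Rabs_lt_between; lra).
          specialize (hnear y H0). apply Rabs_lt_between in hnear. lra. }
        specialize (hc1 x H0). lra. }
    exists c. split; [|split; auto].
    split; auto. destruct (Req_dec a c) as [e|]; [rewrite <- e in hfc |]; lra.
Qed.

(** The supremum [c] of the points of [A] in [[a, b]] works: a neighbourhood inside [A] would
    contain larger points of [A], and one inside [B] would keep [A] away from [c]. *)
Lemma interval_connected (A B : R -> Prop) (a b : R) :
  a <= b -> A a -> B b ->
  (forall x, a <= x <= b -> A x -> exists d, 0 < d /\ forall y, Rabs (y - x) < d -> A y) ->
  (forall x, a <= x <= b -> B x -> exists d, 0 < d /\ forall y, Rabs (y - x) < d -> B y) ->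
  (forall x, A x -> B x -> False) ->
  exists x, a <= x <= b /\ ~ A x /\ ~ B x.
Proof.
  intros hab hA hB oA oB dis.
  destruct (completeness (fun x => a <= x <= b /\ A x)) as [c [hc1 hc2]].
  - exists b. intros x [hx _]; lra.
  - exists a. split; [lra | auto].
  - assert (hac : a <= c) by (apply hc1; split; [lra | auto]).
    assert (hcb : c <= b) by (apply hc2; intros x [hx _]; lra).
    exists c; repeat split; auto; intros h.
    + destruct (oA c (conj hac hcb) h) as [d [hd hn]].
      assert (c < b) by (destruct (Req_dec c b) as [->|]; [exfalso; eauto | lra]).
      set (x := Rmin b (c + d / 2)).
      assert (hx : c < x <= b) by (unfold x, Rmin; destruct Rle_dec; lra).
      assert (x <= c); [|lra].
      apply hc1. split; [lra|]. apply hn.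
      revert hx; unfold x, Rmin; destruct Rle_dec; intros; apply Rabs_lt_between; lra.
    + destruct (oB c (conj hac hcb) h) as [d [hd hn]].
      enough (c <= c - d / 2) by lra. apply hc2. intros x [hx hx'].
      destruct (Rle_dec x (c - d / 2)); auto. exfalso. apply (dis x hx'), hn.
      assert (x <= c) by (apply hc1; auto). apply Rabs_lt_between; lra.
Qed.

Lemma negative_after_zero (f : R -> R) (x l eta : R) :
  is_derive f x l -> l < 0 -> f x = 0 -> 0 < eta -> exists y, x < y < x + eta /\ f y < 0.
Proof.
  intros hd hl h0 he.
  apply is_derive_Reals in hd.
  destruct (hd (- l / 2)) as [d h]; [lra|].
  set (e := Rmin (d / 2) (eta / 2)).
  assert (hd0 := cond_pos d).
  assert (0 < e) by (unfold e, Rmin; destruct Rle_dec; lra).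
  assert (e <= d / 2) by apply Rmin_l. assert (e <= eta / 2) by apply Rmin_r.
  exists (x + e). split; [lra|].
  specialize (h e). rewrite h0, Rminus_0_r in h.
  assert (hh : Rabs (f (x + e) / e - l) < - l / 2).
  { apply h; [lra|]. rewrite Rabs_pos_eq; lra. }
  apply Rabs_lt_between in hh.
  assert (f (x + e) / e < 0) by lra.
  replace (f (x + e)) with (f (x + e) / e * e) by (field; lra). nra.
Qed.

Lemma continuity_pt_Rmin (f g : R -> R) (x : R) :
  continuity_pt f x -> continuity_pt g x -> continuity_pt (fun x => Rmin (f x) (g x)) x.
Proof.
  intros hf hg. apply continuity_pt_filterlim.
  apply (filterlim_ext (fun x => (f x + g x - Rabs (f x - g x)) / 2)).
  - intros y. unfold Rmin, Rabs. destruct Rle_dec, Rcase_abs; lra.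
  - replace (Rmin (f x) (g x)) with ((f x + g x - Rabs (f x - g x)) / 2)
      by (unfold Rmin, Rabs; destruct Rle_dec, Rcase_abs; lra).
    apply (continuity_pt_filterlim (fun x => (f x + g x - Rabs (f x - g x)) / 2)).
    apply (continuity_pt_mult (fun x => f x + g x - Rabs (f x - g x)) (fun _ => / 2)).
    + apply (continuity_pt_minus (fun x => f x + g x) (fun x => Rabs (f x - g x))).
      * now apply continuity_pt_plus.
      * apply (continuity_pt_comp (fun x => f x - g x) Rabs).
        -- now apply continuity_pt_minus.
        -- apply Rcontinuity_abs.
    + apply continuity_pt_const. intros ? ?; reflexivity.
Qed.

Lemma cos_ge_half (x : R) : Rabs x <= 1 -> / 2 <= cos x.
Proof.
  intros h. pose proof PI2_3_2 as hp.
  replace (cos x) with (cos (Rabs x))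
    by (unfold Rabs; destruct Rcase_abs; [apply cos_neg | reflexivity]).
  replace (/ 2) with (cos (PI / 3)) by (rewrite cos_PI3; lra).
  apply cos_decr_1; pose proof (Rabs_pos x); lra.
Qed.

Lemma sin_ge_half (x : R) : 0 <= x <= 1 -> x / 2 <= sin x.
Proof.
  intros h.
  enough (sin 0 - 0 / 2 <= sin x - x / 2) by (rewrite sin_0 in H; lra).
  apply (nondecreasing_of_deriv (fun x => sin x - x / 2) (fun x => cos x - / 2)); [lra| |].
  - intros y _. auto_derive; auto; field.
  - intros y hy. pose proof (cos_ge_half y). rewrite Rabs_pos_eq in H; lra.
Qed.

Lemma sin_le_sin (x y : R) : 0 <= x -> x <= y -> y <= PI / 2 -> sin x <= sin y.
Proof. intros. pose proof PI_RGT_0. apply sin_incr_1; lra. Qed.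

Lemma tanh_2_ge : 3 / 4 <= tanh 2.
Proof.
  unfold tanh, sinh, cosh. rewrite exp_Ropp.
  assert (h : 4 <= exp 2).
  { replace 2 with (1 + 1) by ring. rewrite exp_plus. pose proof (exp_ineq1 1). nra. }
  set (e := exp 2) in *.
  replace ((e - / e) / 2 / ((e + / e) / 2)) with ((e ^ 2 - 1) / (e ^ 2 + 1))
    by (field; repeat split; apply Rgt_not_eq; nra).
  apply Rmult_le_reg_r with (e ^ 2 + 1); [nra|].
  replace ((e ^ 2 - 1) / (e ^ 2 + 1) * (e ^ 2 + 1)) with (e ^ 2 - 1)
    by (field; apply Rgt_not_eq; nra).
  nra.
Qed.

(** * The shooting argument *)

Section Trajectory.

Variables (v psi chi : R -> R) (q : R).
Hypothesis sol : solution v psi chi.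
Hypothesis v0_pos : 0 < v 0.
Hypothesis psi0 : psi 0 = q.
Hypothesis chi0 : chi 0 = 0.
Hypothesis q_range : 0 < q < PI / 2.

(** The closed region in which the trajectory is monotone; the complementary bounds [0 <= chi] and
    [psi <= q] are consequences, by [inside_bounds]. *)
Definition inside (s : R) : Prop := forall x, 0 <= x <= s -> 0 <= psi x /\ chi x <= PI / 2.

Lemma psi_continuity (x : R) : continuity_pt psi x.
Proof. eapply is_derive_continuity_pt, (sol_psi v psi chi sol). Qed.
Lemma chi_continuity (x : R) : continuity_pt chi x.
Proof. eapply is_derive_continuity_pt, (sol_chi v psi chi sol). Qed.

(** Both terms of [chi_rate] are nonnegative in the region. The first and last bounds discard the
    second term, one keeping [tanh] at its initial value and the other at its current value. *)
Lemma chi_deriv_bounds (x : R) :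
  0 <= chi x <= PI / 2 -> 0 <= psi x <= q -> v 0 <= v x ->
  2 * speed (psi x) * tanh (v 0) * sin (chi x) <=
    chi_rate (v x) (psi x) (chi x) /\
  0 <= 2 * speed (psi x) * tanh (v 0) * sin (chi x) /\
  0 <= 3 * (cos (psi x) * (sin (psi x) * (cos (chi x) * / speed (psi x)))) /\
  2 * speed (psi x) * tanh (v x) * sin (chi x) <=
    chi_rate (v x) (psi x) (chi x).
Proof.
  intros hc hp hv. unfold chi_rate. pose proof PI_RGT_0.
  pose proof (speed_bounds (psi x)).
  assert (0 <= sin (chi x)) by (apply sin_ge_0; lra).
  assert (0 <= sin (psi x)) by (apply sin_ge_0; lra).
  assert (0 <= cos (chi x)) by (apply cos_ge_0; lra).
  assert (0 <= cos (psi x)) by (apply cos_ge_0; lra).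
  assert (0 <= / speed (psi x)) by (left; apply Rinv_0_lt_compat; lra).
  assert (tanh (v 0) <= tanh (v x)) by (apply tanh_le; lra).
  assert (0 <= tanh (v 0)).
  { rewrite <- tanh_0 at 1. apply tanh_le; lra. }
  assert (0 <= 3 * (cos (psi x) * (sin (psi x) * (cos (chi x) * / speed (psi x)))))
    by (apply Rmult_le_pos; [lra|]; repeat apply Rmult_le_pos; auto).
  assert (0 <= speed (psi x) * sin (chi x)) by (apply Rmult_le_pos; lra).
  repeat split; auto.
  - nra.
  - assert (0 <= tanh (v 0) * (speed (psi x) * sin (chi x))) by (apply Rmult_le_pos; lra). lra.
  - lra.
Qed.

(** The sign of [chi] is assumed provisionally, until [chi_pos] provides it. *)
Lemma basic_facts_of_nonneg (s : R) :
  inside s -> (forall x, 0 <= x <= s -> 0 <= chi x) ->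
  forall x, 0 <= x <= s -> psi x <= q /\ v 0 <= v x.
Proof.
  intros hin hchi x hx. pose proof PI_RGT_0. split.
  - rewrite <- psi0. apply Ropp_le_cancel.
    apply (nondecreasing_of_deriv (fun x => - psi x) (fun x => speed (psi x) * sin (chi x)));
      [lra| |].
    + intros y _. eapply is_derive_eq.
      * apply (is_derive_opp (V := R_NormedModule)), (sol_psi v psi chi sol).
      * unfold opp; simpl; ring.
    + intros y hy. specialize (hchi y); specialize (hin y). pose proof (speed_bounds (psi y)).
      apply Rmult_le_pos; [lra|]. apply sin_ge_0; lra.
  - apply (nondecreasing_of_deriv v (fun x => speed (psi x) * cos (chi x))); [lra| |].
    + intros y _. apply (sol_v v psi chi sol).
    + intros y hy. specialize (hchi y); specialize (hin y). pose proof (speed_bounds (psi y)).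
      apply Rmult_le_pos; [lra|]. apply cos_ge_0; lra.
Qed.

Lemma chi_nondecreasing_of_nonneg (s : R) :
  inside s -> (forall x, 0 <= x <= s -> 0 <= chi x) ->
  forall x y, 0 <= x -> x <= y -> y <= s -> chi x <= chi y.
Proof.
  intros hin hchi x y hx hxy hy.
  apply (nondecreasing_of_deriv chi (fun x => chi_rate (v x) (psi x) (chi x)) x y hxy
    (fun z _ => sol_chi v psi chi sol z)).
  intros z hz.
  destruct (basic_facts_of_nonneg s hin hchi z) as [h1 h2]; [lra|].
  specialize (hin z); specialize (hchi z).
  destruct (chi_deriv_bounds z); lra.
Qed.

(** A bootstrap. [chi] leaves 0 with slope [3 cos q sin q / speed q > 0]. Up to a first return to 0
    it would be nonnegative, hence nondecreasing by the provisional lemma, and so could not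
    return. *)
Lemma chi_pos (s : R) : inside s -> forall x, 0 < x <= s -> 0 < chi x.
Proof.
  intros hin. pose proof PI_RGT_0.
  assert (hd : 0 < 3 * (cos q * (sin q * / speed q))).
  { pose proof (speed_bounds q). repeat apply Rmult_lt_0_compat; try lra.
    - apply cos_gt_0; lra.
    - apply sin_gt_0; lra.
    - apply Rinv_0_lt_compat; lra. }
  assert (hnear : exists e, 0 < e /\ forall x, 0 < x < e -> 0 < chi x).
  { pose proof (sol_chi v psi chi sol 0) as hc.
    unfold chi_rate in hc. rewrite psi0, chi0, sin_0, cos_0 in hc. apply is_derive_Reals in hc.
    destruct (hc _ hd) as [e he]. exists e; split; [apply cond_pos|].
    intros x hx. specialize (he x). rewrite chi0, Rplus_0_l, Rminus_0_r in he.
    assert (h : Rabs (chi x / x - (2 * (speed q * (tanh (v 0) * 0)) +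
      3 * (cos q * (sin q * (1 * / speed q))))) < 3 * (cos q * (sin q * / speed q))).
    { apply he; [lra | rewrite Rabs_pos_eq; lra]. }
    apply Rabs_lt_between in h.
    assert (0 < chi x / x) by lra.
    replace (chi x) with (chi x / x * x) by (field; lra). nra. }
  destruct hnear as [e [he hnear]].
  intros x1 hx1. apply Rnot_le_lt; intros hle.
  assert (hlt : e <= x1) by (apply Rnot_lt_le; intros h; specialize (hnear x1); lra).
  destruct (first_exit chi (e / 2) x1) as [c [hc [hc0 hcp]]];
    [lra | apply chi_continuity | apply hnear; lra | lra |].
  assert (hchi : forall x, 0 <= x <= c -> 0 <= chi x).
  { intros x hx. destruct (Req_dec x 0) as [->|]; [lra|].
    destruct (Rlt_dec x e); [left; apply hnear; lra|].
    destruct (Req_dec x c) as [->|]; [lra|]. left; apply hcp; lra. }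
  assert (hin' : inside c) by (intros x hx; apply hin; lra).
  pose proof (chi_nondecreasing_of_nonneg c hin' hchi (e / 2) c).
  specialize (hnear (e / 2)). lra.
Qed.

Lemma inside_bounds (s : R) : inside s -> forall x, 0 <= x <= s ->
  0 <= chi x <= PI / 2 /\ 0 <= psi x <= q /\ v 0 <= v x.
Proof.
  intros hin x hx.
  assert (hchi : forall x, 0 <= x <= s -> 0 <= chi x).
  { intros y hy. destruct (Req_dec y 0) as [->|]; [lra|]. left; apply (chi_pos s); auto; lra. }
  destruct (basic_facts_of_nonneg s hin hchi x hx). pose proof (hin x hx). pose proof (hchi x hx).
  lra.
Qed.

Lemma chi_nondecreasing (s : R) : inside s ->
  forall x y, 0 <= x -> x <= y -> y <= s -> chi x <= chi y.
Proof.
  intros hin. apply chi_nondecreasing_of_nonneg; auto.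
  intros x hx; apply (inside_bounds s hin x hx).
Qed.

Lemma psi_nonincreasing (s : R) : inside s ->
  forall x y, 0 <= x -> x <= y -> y <= s -> psi y <= psi x.
Proof.
  intros hin x y hx hxy hy. pose proof PI_RGT_0. apply Ropp_le_cancel.
  apply (nondecreasing_of_deriv (fun x => - psi x) (fun x => speed (psi x) * sin (chi x)));
    [lra| |].
  - intros z _. eapply is_derive_eq.
    + apply (is_derive_opp (V := R_NormedModule)), (sol_psi v psi chi sol).
    + unfold opp; simpl; ring.
  - intros z hz. destruct (inside_bounds s hin z); [lra|]. pose proof (speed_bounds (psi z)).
    apply Rmult_le_pos; [lra|]. apply sin_ge_0; lra.
Qed.

Lemma tanh_v0_pos : 0 < tanh (v 0).
Proof.
  unfold tanh. pose proof (cosh_ge_1 (v 0)). apply Rdiv_lt_0_compat; [|lra].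
  rewrite <- sinh_0 at 1. apply sinh_lt; auto.
Qed.

(** As long as the trajectory stays inside, [chi] increases, and after time 1 it does so at a rate
    bounded below; it cannot stay under [PI / 2] forever. The minimum of [psi] and [PI / 2 - chi]
    turns the two exits into the vanishing of one function. *)
Lemma exit_exists : exists s, 0 < s /\
  (forall x, 0 <= x < s -> 0 < psi x /\ chi x < PI / 2) /\ inside s /\
  (psi s = 0 \/ chi s = PI / 2).
Proof.
  pose proof PI_RGT_0. pose proof tanh_v0_pos as ht.
  set (f := fun x => Rmin (psi x) (PI / 2 - chi x)).
  assert (hf : forall x, continuity_pt f x).
  { intros x. apply continuity_pt_Rmin; [apply psi_continuity|].
    apply continuity_pt_minus; [|apply chi_continuity].
    apply continuity_pt_const; intros ? ?; reflexivity. }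
  assert (hf0 : 0 < f 0) by (unfold f; rewrite psi0, chi0; apply Rmin_glb_lt; lra).
  assert (hex : exists b, 0 <= b /\ f b <= 0).
  { apply NNPP; intros hn.
    assert (hp : forall x, 0 <= x -> 0 < psi x /\ chi x < PI / 2).
    { intros x hx. assert (0 < f x) as h by (apply Rnot_le_lt; intros h; apply hn; now exists x).
      unfold f in h. pose proof (Rmin_l (psi x) (PI / 2 - chi x)).
      pose proof (Rmin_r (psi x) (PI / 2 - chi x)). lra. }
    assert (hin : forall s, inside s) by (intros s x hx; specialize (hp x); lra).
    assert (hc1 : 0 < chi 1) by (apply (chi_pos 1); [auto | lra]).
    assert (hs : 0 < sin (chi 1)) by (specialize (hp 1); apply sin_gt_0; lra).
    set (k := 2 * tanh (v 0) * sin (chi 1)).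
    assert (hk : 0 < k) by (unfold k; apply Rmult_lt_0_compat; [apply Rmult_lt_0_compat|]; lra).
    (* Growing at rate at least [k] from time 1 on, [chi] would gain [PI] by time [S]. *)
    set (S := 1 + PI / k). assert (0 < PI / k) by (now apply Rdiv_lt_0_compat).
    assert (h : chi 1 - k * 1 <= chi S - k * S).
    { apply (nondecreasing_of_deriv (fun x => chi x - k * x)
        (fun x => chi_rate (v x) (psi x) (chi x) - k)).
      - unfold S; lra.
      - intros x _. apply is_derive_Rminus; [apply (sol_chi v psi chi sol)|].
        auto_derive; auto; ring.
      - intros x hx.
        assert (hx0 : 0 <= x <= x) by lra.
        destruct (inside_bounds x (hin x) x hx0) as [h1 [h2 h3]].
        destruct (chi_deriv_bounds x h1 h2 h3) as [h4 _].
        enough (k <= 2 * speed (psi x) * tanh (v 0) * sin (chi x)) by (cbv beta; lra).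
        assert (sin (chi 1) <= sin (chi x)).
        { apply sin_le_sin; try lra. apply (chi_nondecreasing x); auto; lra. }
        pose proof (speed_bounds (psi x)).
        unfold k. assert (tanh (v 0) * sin (chi 1) <= tanh (v 0) * sin (chi x)) by nra.
        assert (0 <= tanh (v 0) * sin (chi x)) by nra. nra. }
    assert (0 <= S) by (unfold S; lra).
    specialize (hp S H1). unfold S in h.
    replace (k * (1 + PI / k)) with (k + PI) in h by (field; lra). fold S in h. lra. }
  destruct hex as [b [hb hfb]].
  destruct (first_exit f 0 b hb hf hf0 hfb) as [s [hs [hs0 hsp]]].
  assert (hp : forall x, 0 <= x < s -> 0 < psi x /\ chi x < PI / 2).
  { intros x hx. specialize (hsp x hx). unfold f in hsp.
    pose proof (Rmin_l (psi x) (PI / 2 - chi x)).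
    pose proof (Rmin_r (psi x) (PI / 2 - chi x)). lra. }
  assert (hs' : 0 <= psi s /\ chi s <= PI / 2 /\ (psi s = 0 \/ chi s = PI / 2)).
  { unfold f, Rmin in hs0. destruct Rle_dec; lra. }
  exists s. split; [lra|]. split; [auto|]. split; [|tauto].
  intros x hx. destruct (Req_dec x s) as [->|]; [lra|]. specialize (hp x). lra.
Qed.

(** The inequalities here and in [hits_chi_first] are strict, which makes both conditions open in
    the starting point. *)
Definition hits_psi_first : Prop :=
  exists s, 0 <= s /\ (forall x, 0 <= x <= s -> chi x < PI / 2) /\ psi s < 0.

Definition hits_chi_first : Prop :=
  exists s, 0 <= s /\ (forall x, 0 <= x <= s -> 0 < psi x) /\ PI / 2 < chi s.

Lemma hits_disjoint : hits_psi_first -> hits_chi_first -> False.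
Proof.
  intros [s [hs [hc hp]]] [s' [hs' [hp' hc']]].
  destruct (Rle_dec s s') as [h | h].
  - specialize (hp' s); lra.
  - specialize (hc s'); lra.
Qed.

(** The crossing is transversal: [psi' = - speed * sin chi < 0] because [chi > 0]. Shortly
    afterwards [psi] is negative while [chi] is still below [PI / 2]. *)
Lemma hits_psi_of_zero (s : R) :
  0 < s -> inside s -> psi s = 0 -> chi s < PI / 2 -> hits_psi_first.
Proof.
  intros hs hin hp hc.
  assert (hcs : 0 < chi s) by (apply (chi_pos s); auto; lra).
  destruct (continuity_near chi s (PI / 2 - chi s) (chi_continuity s)) as [d [hd hnear]]; [lra|].
  destruct (negative_after_zero psi s _ d (sol_psi v psi chi sol s)) as [y [hy hy']]; auto.
  { pose proof (speed_bounds (psi s)). pose proof PI_RGT_0.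
    assert (0 < sin (chi s)) by (apply sin_gt_0; lra). nra. }
  exists y. split; [lra|]. split; auto.
  intros x hx. destruct (Rle_dec x s).
  - apply Rle_lt_trans with (chi s); auto. apply (chi_nondecreasing s); auto; lra.
  - assert (hx' : Rabs (x - s) < d) by (apply Rabs_lt_between; lra).
    specialize (hnear x hx'). apply Rabs_lt_between in hnear. lra.
Qed.

(** At [chi = PI / 2] the slope of [chi] is [2 * speed * tanh v > 0], so this crossing is
    transversal as well. *)
Lemma hits_chi_of_right_angle (s : R) :
  0 < s -> inside s -> 0 < psi s -> chi s = PI / 2 -> hits_chi_first.
Proof.
  intros hs hin hp hc.
  destruct (continuity_near psi s (psi s) (psi_continuity s)) as [d [hd hnear]]; [lra|].
  assert (hs1 : 0 <= s <= s) by lra.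
  destruct (negative_after_zero (fun x => PI / 2 - chi x) s
    (0 - chi_rate (v s) (psi s) (chi s)) d) as [y [hy hy']]; auto.
  { apply is_derive_Rminus; [apply is_derive_Rconst|].
    apply (sol_chi v psi chi sol). }
  { unfold chi_rate. rewrite hc, sin_PI2, cos_PI2.
    pose proof (speed_bounds (psi s)). pose proof tanh_v0_pos.
    assert (tanh (v 0) <= tanh (v s)) by (apply tanh_le, (inside_bounds s hin s hs1)).
    assert (0 < speed (psi s) * tanh (v s)) by (apply Rmult_lt_0_compat; lra). lra. }
  { lra. }
  exists y. split; [lra|]. split; [|lra].
  intros x hx. destruct (Rle_dec x s).
  - apply Rlt_le_trans with (psi s); auto. apply (psi_nonincreasing s); auto; lra.
  - assert (hx' : Rabs (x - s) < d) by (apply Rabs_lt_between; lra).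
    specialize (hnear x hx'). apply Rabs_lt_between in hnear. lra.
Qed.

(** If only one of the two borders were reached at the exit time, transversality would turn it into
    one of the excluded open conditions. *)
Lemma hits_both : ~ hits_psi_first -> ~ hits_chi_first ->
  exists s, 0 < s /\ (forall x, 0 <= x < s -> 0 < psi x) /\ inside s /\
    psi s = 0 /\ chi s = PI / 2.
Proof.
  intros nA nB. destruct exit_exists as [s [hs [hx [hin h]]]].
  exists s. split; auto. split; [intros; now apply hx|]. split; auto.
  assert (hs1 : 0 <= s <= s) by lra. pose proof (hin s hs1).
  destruct h as [h | h]; split; auto.
  - apply NNPP; intros hn. apply nA, (hits_psi_of_zero s); auto; lra.
  - apply NNPP; intros hn. apply nB, (hits_chi_of_right_angle s); auto; lra.
Qed.

(* Along the trajectory [z = chi / psi] satisfies [z' >= (1 + z^2) / 8], so that [psi]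
   vanishes before time [17 > 8 * PI / 2] as long as [psi] and [chi] remain small. *)
Lemma hits_psi_of_small :
  (forall x, 0 <= x <= 17 -> Rabs (psi x) <= 1 /\ Rabs (chi x) <= 1) -> hits_psi_first.
Proof.
  intros hsm. pose proof PI2_3_2 as hPI.
  assert (hex : exists b, 0 <= b <= 17 /\ psi b <= 0).
  { apply NNPP; intros hn.
    assert (hp : forall x, 0 <= x <= 17 -> 0 < psi x).
    { intros x hx. apply Rnot_le_lt; intros h; apply hn; now exists x. }
    assert (hin : inside 17).
    { intros x hx. specialize (hp x hx); specialize (hsm x hx).
      destruct hsm as [_ hsm]. apply Rabs_le_between in hsm. lra. }
    set (c' := fun x => chi_rate (v x) (psi x) (chi x)).
    set (z := fun x => chi x / psi x).
    assert (hz : forall x, 0 <= x <= 17 -> is_derive z x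
      (c' x / psi x + chi x * (speed (psi x) * sin (chi x)) / psi x ^ 2)).
    { intros x hx. specialize (hp x hx).
      eapply is_derive_eq.
      - apply (is_derive_div chi psi);
          [apply (sol_chi v psi chi sol) | apply (sol_psi v psi chi sol) | lra].
      - unfold c'. field. pose proof (speed_bounds (psi x)). lra. }
    assert (hb : forall x, 0 <= x <= 17 -> (1 + z x ^ 2) / 8 <=
      c' x / psi x + chi x * (speed (psi x) * sin (chi x)) / psi x ^ 2).
    { intros x hx. destruct (inside_bounds 17 hin x hx) as [h1 [h2 h3]].
      destruct (chi_deriv_bounds x h1 h2 h3) as [h4 [h5 _]].
      specialize (hp x hx). destruct (hsm x hx) as [h6 h7].
      pose proof (cos_ge_half _ h6) as hcp. pose proof (cos_ge_half _ h7) as hcc.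
      apply Rabs_le_between in h6, h7.
      assert (hsp : psi x / 2 <= sin (psi x)) by (apply sin_ge_half; lra).
      assert (hsc : chi x / 2 <= sin (chi x)) by (apply sin_ge_half; lra).
      pose proof (speed_bounds (psi x)) as hv.
      assert (hi : / 2 <= / speed (psi x)) by (apply Rinv_le_contravar; lra).
      (* The lower bounds [/ 2] for both cosines and for [/ speed], and [psi / 2] for [sin psi],
         give [3 / 16 * psi]. *)
      assert (hc : psi x / 8 <= c' x).
      { unfold c', chi_rate.
        assert (0 <= 2 * (speed (psi x) * (tanh (v x) * sin (chi x)))).
        { assert (tanh (v 0) <= tanh (v x)) by (now apply tanh_le).
          pose proof tanh_v0_pos.
          apply Rmult_le_pos; [lra|]. apply Rmult_le_pos; [lra|]. apply Rmult_le_pos; lra. }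
        assert (/ 2 * / 2 <= cos (chi x) * / speed (psi x)) by (apply Rmult_le_compat; lra).
        assert (psi x / 2 * (/ 2 * / 2) <= sin (psi x) * (cos (chi x) * / speed (psi x)))
          by (apply Rmult_le_compat; lra).
        assert (/ 2 * (psi x / 2 * (/ 2 * / 2)) <=
          cos (psi x) * (sin (psi x) * (cos (chi x) * / speed (psi x))))
          by (apply Rmult_le_compat; lra).
        lra. }
      assert (hs : chi x * (1 * (chi x / 2)) <= chi x * (speed (psi x) * sin (chi x)))
        by (apply Rmult_le_compat_l; [lra|]; apply Rmult_le_compat; lra).
      unfold z. apply Rmult_le_reg_r with (psi x ^ 2); [nra|].
      replace ((1 + (chi x / psi x) ^ 2) / 8 * psi x ^ 2)
        with ((psi x ^ 2 + chi x ^ 2) / 8) by (field; lra).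
      replace ((c' x / psi x + chi x * (speed (psi x) * sin (chi x)) / psi x ^ 2) * psi x ^ 2)
        with (c' x * psi x + chi x * (speed (psi x) * sin (chi x))) by (field; lra).
      nra. }
    assert (h : atan (z 0) - 0 / 8 <= atan (z 17) - 17 / 8).
    { apply (nondecreasing_of_deriv (fun x => atan (z x) - x / 8) (fun x =>
        (c' x / psi x + chi x * (speed (psi x) * sin (chi x)) / psi x ^ 2)
        * / (1 + z x ^ 2) - / 8)); [lra| |].
      - intros x hx. apply is_derive_Rminus.
        + apply is_derive_Rcomp; [|now apply hz].
          apply is_derive_Reals, derivable_pt_lim_atan.
        + auto_derive; auto; field.
      - intros x hx. specialize (hb x hx).
        assert (h1 : 0 < 1 + z x ^ 2) by (pose proof (pow2_ge_0 (z x)); lra).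
        set (A := c' x / psi x + chi x * (speed (psi x) * sin (chi x)) / psi x ^ 2) in *.
        enough (0 <= (A - (1 + z x ^ 2) / 8) * / (1 + z x ^ 2)).
        { replace (A * / (1 + z x ^ 2) - / 8)
            with ((A - (1 + z x ^ 2) / 8) * / (1 + z x ^ 2)) by (field; lra). auto. }
        apply Rmult_le_pos; [lra|]. left; now apply Rinv_0_lt_compat. }
    (* [PI <= 4] is precise enough: [17 / 8 > 2 >= PI / 2]. *)
    pose proof (atan_bound (z 17)) as h17. pose proof PI_4.
    assert (z 0 = 0) as hz0 by (unfold z; rewrite chi0; unfold Rdiv; ring).
    rewrite hz0, atan_0 in h. lra. }
  destruct hex as [b [hb hpb]].
  destruct (first_exit psi 0 b) as [s [hs [hs0 hsp]]];
    [lra | apply psi_continuity | lra | auto |].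
  apply (hits_psi_of_zero s); auto; [lra| |].
  - intros x hx. destruct (hsm x) as [_ h]; [lra|]. apply Rabs_le_between in h.
    split; [|lra]. destruct (Req_dec x s) as [->|]; [lra|]. left; apply hsp; lra.
  - destruct (hsm s) as [_ h]; [lra|]. apply Rabs_le_between in h. lra.
Qed.

(* After time 4 one has [tanh v >= 3/4], whence [chi + 3/2 psi] is nondecreasing. *)
Lemma hits_chi_of_near_equator :
  (forall x, 0 <= x <= 4 -> Rabs (psi x - PI / 2) <= / 10 /\ Rabs (chi x) <= / 10) ->
  hits_chi_first.
Proof.
  intros hsm. pose proof PI2_3_2 as hPI.
  destruct exit_exists as [s [hs [_ [hin he]]]].
  assert (hs1 : 0 <= s <= s) by lra.
  assert (hs4 : 4 < s).
  { apply Rnot_le_lt; intros h. destruct (hsm s) as [h1 h2]; [lra|].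
    apply Rabs_le_between in h1, h2. destruct he; lra. }
  assert (hv4 : 2 <= v 4).
  { enough (v 0 - 0 / 2 <= v 4 - 4 / 2) by lra.
    apply (nondecreasing_of_deriv (fun x => v x - x / 2)
      (fun x => speed (psi x) * cos (chi x) - / 2)); [lra| |].
    - intros x _. apply is_derive_Rminus; [apply (sol_v v psi chi sol)|].
      auto_derive; auto; field.
    - intros x hx. destruct (hsm x hx) as [_ h]. pose proof (cos_ge_half (chi x)).
      pose proof (speed_bounds (psi x)). nra. }
  assert (hmono : chi 4 + 3 / 2 * psi 4 <= chi s + 3 / 2 * psi s).
  { apply (nondecreasing_of_deriv (fun x => chi x + 3 / 2 * psi x)
      (fun x => chi_rate (v x) (psi x) (chi x) + 3 / 2 * - (speed (psi x) * sin (chi x)))).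
    - lra.
    - intros x _. apply is_derive_Rplus; [apply (sol_chi v psi chi sol)|].
      apply (is_derive_scal psi), (sol_psi v psi chi sol).
    - intros x hx. assert (hx0 : 0 <= x <= s) by lra.
      destruct (inside_bounds s hin x hx0) as [h1 [h2 h3]].
      destruct (chi_deriv_bounds x h1 h2 h3) as [_ [_ [h5 h6]]].
      assert (hvx : v 4 <= v x).
      { apply (nondecreasing_of_deriv v (fun x => speed (psi x) * cos (chi x))); [lra| |].
        - intros y _. apply (sol_v v psi chi sol).
        - intros y hy. assert (hy0 : 0 <= y <= s) by lra.
          destruct (inside_bounds s hin y hy0) as [h7 _].
          pose proof (speed_bounds (psi y)).
          apply Rmult_le_pos; [lra | apply cos_ge_0; lra]. }
      assert (3 / 4 <= tanh (v x)).
      { eapply Rle_trans; [apply tanh_2_ge | apply tanh_le; lra]. }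
      pose proof (speed_bounds (psi x)).
      assert (0 <= sin (chi x)) by (apply sin_ge_0; lra).
      assert (0 <= speed (psi x) * sin (chi x)) by (apply Rmult_le_pos; lra).
      cbv beta. nra. }
  destruct (hsm 4) as [h1 h2]; [lra|]. apply Rabs_le_between in h1, h2.
  pose proof (hin s hs1).
  apply (hits_chi_of_right_angle s); auto; [|destruct he; auto]; [| ].
  (* Were [psi s <= 0], then [chi s] would be at least [chi 4 + 3 / 2 * psi 4 >= 3 / 2 * (PI / 2) -
     / 4], more than [PI / 2] since [PI / 2 > 3 / 2]. *)
  - apply Rnot_le_lt; intros h. lra.
  - lra.
Qed.

End Trajectory.

(** * The geodesics as a family depending on the starting point *)

Lemma Rabs_lt_of_sqr_lt (x e : R) : 0 < e -> x ^ 2 < e ^ 2 -> Rabs x < e.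
Proof. intros he h. apply Rabs_lt_between. split; nra. Qed.

Lemma max_on_segment (f : R -> R) (a b : R) :
  a <= b -> (forall x, continuity_pt f x) ->
  exists m, a <= m <= b /\ forall x, a <= x <= b -> f x <= f m.
Proof.
  intros hab hf. destruct (continuity_ab_maj f a b hab) as [m [h1 h2]]; auto.
  exists m; auto.
Qed.

Section Flow.

Variables (v psi chi : R -> R -> R) (v0 : R).
Hypothesis sol : forall q, solution (v q) (psi q) (chi q).
Hypothesis init : forall q, v q 0 = v0 /\ psi q 0 = q /\ chi q 0 = 0.
Hypothesis v0_pos : 0 < v0.

Lemma flow_close (q S e : R) : 0 <= S -> 0 < e -> exists d, 0 < d /\
  forall q', Rabs (q' - q) < d -> forall x, 0 <= x <= S ->
    Rabs (psi q' x - psi q x) < e /\ Rabs (chi q' x - chi q x) < e.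
Proof.
  intros hS he. destruct continuous_dependence as [K [hK h]].
  pose proof (exp_pos (K * S)) as hE. set (E := exp (K * S)) in *.
  assert (hE1 : 1 <= E).
  { unfold E. rewrite <- exp_0. destruct (Req_dec S 0) as [->|].
    - rewrite Rmult_0_r; lra.
    - left; apply exp_increasing; nra. }
  (* The squared distance grows by at most the factor [E], and [(e / E) ^ 2 * E <= e ^ 2] because
     [E >= 1]. *)
  exists (e / E). split; [now apply Rdiv_lt_0_compat|].
  intros q' hq x hx.
  specialize (h _ _ _ _ _ _ (sol q') (sol q) 0 x (proj1 hx)).
  assert (hd : dist2 (v q') (psi q') (chi q') (v q) (psi q) (chi q) x < e ^ 2).
  { eapply Rle_lt_trans; [exact h|].
    unfold dist2. destruct (init q') as [e1 [e2 e3]], (init q) as [e4 [e5 e6]].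
    rewrite e1, e2, e3, e4, e5, e6.
    assert (hEx : exp (K * (x - 0)) <= E).
    { unfold E. destruct (Req_dec x S) as [->|]; [rewrite Rminus_0_r; lra|].
      left; apply exp_increasing; nra. }
    assert (hq2 : (q' - q) ^ 2 < (e / E) ^ 2).
    { rewrite <- (pow2_abs (q' - q)). pose proof (Rabs_pos (q' - q)).
      nra. }
    pose proof (exp_pos (K * (x - 0))).
    apply Rle_lt_trans with ((q' - q) ^ 2 * E).
    - replace ((v0 - v0) ^ 2 + (q' - q) ^ 2 + (0 - 0) ^ 2) with ((q' - q) ^ 2) by ring.
      apply Rmult_le_compat_l; [apply pow2_ge_0 | auto].
    - apply Rlt_le_trans with ((e / E) ^ 2 * E); [nra|].
      replace ((e / E) ^ 2 * E) with (e ^ 2 * / E) by (field; lra).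
      rewrite <- (Rmult_1_r (e ^ 2)) at 2. apply Rmult_le_compat_l; [nra|].
      rewrite <- Rinv_1. apply Rinv_le_contravar; lra. }
  unfold dist2 in hd.
  pose proof (pow2_ge_0 (v q' x - v q x)); pose proof (pow2_ge_0 (psi q' x - psi q x));
    pose proof (pow2_ge_0 (chi q' x - chi q x)).
  split; apply Rabs_lt_of_sqr_lt; lra.
Qed.

(** The maximum of [chi] on [[0, s]] is attained, hence leaves a positive margin below [PI / 2];
    curves closer than this margin and than [- psi s] behave in the same way. *)
Lemma hits_psi_open (q : R) : hits_psi_first (psi q) (chi q) ->
  exists d, 0 < d /\ forall q', Rabs (q' - q) < d -> hits_psi_first (psi q') (chi q').
Proof.
  intros [s [hs [hc hp]]].
  destruct (max_on_segment (chi q) 0 s hs) as [m [hm hmax]].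
  { intros x; eapply chi_continuity; eauto. }
  specialize (hc m hm).
  destruct (flow_close q s (Rmin (PI / 2 - chi q m) (- psi q s)) hs) as [d [hd h]].
  { apply Rmin_glb_lt; lra. }
  exists d; split; auto. intros q' hq. exists s; split; auto.
  pose proof (Rmin_l (PI / 2 - chi q m) (- psi q s)).
  pose proof (Rmin_r (PI / 2 - chi q m) (- psi q s)).
  split.
  - intros x hx. destruct (h q' hq x hx) as [_ h2]. specialize (hmax x hx).
    apply Rabs_lt_between in h2. lra.
  - assert (hs1 : 0 <= s <= s) by lra. destruct (h q' hq s hs1) as [h1 _].
    apply Rabs_lt_between in h1. lra.
Qed.

Lemma hits_chi_open (q : R) : hits_chi_first (psi q) (chi q) ->
  exists d, 0 < d /\ forall q', Rabs (q' - q) < d -> hits_chi_first (psi q') (chi q').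
Proof.
  intros [s [hs [hp hc]]].
  destruct (max_on_segment (fun x => - psi q x) 0 s hs) as [m [hm hmax]].
  { intros x. apply continuity_pt_opp. eapply psi_continuity; eauto. }
  specialize (hp m hm).
  destruct (flow_close q s (Rmin (psi q m) (chi q s - PI / 2)) hs) as [d [hd h]].
  { apply Rmin_glb_lt; lra. }
  exists d; split; auto. intros q' hq. exists s; split; auto.
  pose proof (Rmin_l (psi q m) (chi q s - PI / 2)).
  pose proof (Rmin_r (psi q m) (chi q s - PI / 2)).
  split.
  - intros x hx. destruct (h q' hq x hx) as [h1 _]. specialize (hmax x hx).
    apply Rabs_lt_between in h1. lra.
  - assert (hs1 : 0 <= s <= s) by lra. destruct (h q' hq s hs1) as [_ h2].
    apply Rabs_lt_between in h2. lra.
Qed.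

(** The geodesic is the meridian [a = 0], run through with constant speed 2 in [v]. *)
Lemma flow_at_0 (x : R) : 0 <= x -> psi 0 x = 0 /\ chi 0 x = 0.
Proof.
  intros hx. destruct (init 0) as [e1 [e2 e3]].
  assert (H : solution (fun s => v0 + 2 * s) (fun _ => 0) (fun _ => 0)).
  { assert (hs : speed 0 = 2).
    { unfold speed. rewrite cos_0. replace (1 + 3 * 1 ^ 2) with (2 ^ 2) by ring.
      apply sqrt_pow2; lra. }
    split; intros s; unfold chi_rate; rewrite ?hs, ?sin_0, ?cos_0.
    - auto_derive; auto; ring.
    - auto_derive; auto; ring.
    - auto_derive; auto; ring. }
  destruct (solution_unique _ _ _ _ _ _ 0 x (sol 0) H hx) as [_ h]; auto.
  rewrite e1; ring.
Qed.

(** The geodesic is the meridian [b = 0], run through with constant speed 1 in [v]. *)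
Lemma flow_at_equator (x : R) : 0 <= x -> psi (PI / 2) x = PI / 2 /\ chi (PI / 2) x = 0.
Proof.
  intros hx. destruct (init (PI / 2)) as [e1 [e2 e3]].
  assert (H : solution (fun s => v0 + s) (fun _ => PI / 2) (fun _ => 0)).
  { assert (hs : speed (PI / 2) = 1).
    { unfold speed. rewrite cos_PI2. replace (1 + 3 * 0 ^ 2) with 1 by ring. apply sqrt_1. }
    split; intros s; unfold chi_rate; rewrite ?hs, ?sin_0, ?cos_0, ?cos_PI2.
    - auto_derive; auto; ring.
    - auto_derive; auto; ring.
    - auto_derive; auto; ring. }
  destruct (solution_unique _ _ _ _ _ _ 0 x (sol (PI / 2)) H hx) as [_ h]; auto.
  rewrite e1; ring.
Qed.

(** The bound [/ 2], here from above and in [exists_hits_chi] from below, puts the two starting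
    points in the order that the connectedness argument expects. *)
Lemma exists_hits_psi : exists q, 0 < q < / 2 /\ hits_psi_first (psi q) (chi q).
Proof.
  pose proof PI2_3_2.
  destruct (flow_close 0 17 1) as [d [hd h]]; [lra | lra |].
  set (q := Rmin (d / 2) (/ 3)).
  assert (0 < q) by (apply Rmin_glb_lt; lra).
  assert (q <= d / 2) by apply Rmin_l. assert (q <= / 3) by apply Rmin_r.
  exists q. split; [lra|]. destruct (init q) as [e1 [e2 e3]].
  apply (hits_psi_of_small (v q) (psi q) (chi q) q); auto; [lra | lra |].
  intros x hx.
  assert (hq : Rabs (q - 0) < d) by (rewrite Rminus_0_r, Rabs_pos_eq; lra).
  specialize (h q hq x hx). destruct (flow_at_0 x) as [h1 h2]; [lra|].
  rewrite h1, h2, !Rminus_0_r in h. lra.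
Qed.

Lemma exists_hits_chi :
  exists q, / 2 < q < PI / 2 /\ hits_chi_first (psi q) (chi q).
Proof.
  pose proof PI2_3_2.
  destruct (flow_close (PI / 2) 4 (/ 10)) as [d [hd h]]; [lra | lra |].
  set (e := Rmin (d / 2) (/ 3)).
  assert (0 < e) by (apply Rmin_glb_lt; lra).
  assert (e <= d / 2) by apply Rmin_l. assert (e <= / 3) by apply Rmin_r.
  exists (PI / 2 - e). split; [lra|]. destruct (init (PI / 2 - e)) as [e1 [e2 e3]].
  apply (hits_chi_of_near_equator _ _ _ (PI / 2 - e) (sol _)); auto; [lra | lra |].
  intros x hx.
  assert (hq : Rabs (PI / 2 - e - PI / 2) < d) by (apply Rabs_lt_between; lra).
  specialize (h _ hq x hx). destruct (flow_at_equator x) as [h1 h2]; [lra|].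
  rewrite h1, h2, !Rminus_0_r in h. lra.
Qed.

Lemma shooting_flow : exists q, 0 < q < PI / 2 /\
  ~ hits_psi_first (psi q) (chi q) /\ ~ hits_chi_first (psi q) (chi q).
Proof.
  destruct exists_hits_psi as [a [ha hA]]. destruct exists_hits_chi as [b [hb hB]].
  destruct (interval_connected (fun q => hits_psi_first (psi q) (chi q))
    (fun q => hits_chi_first (psi q) (chi q)) a b) as [q [hq hn]]; auto.
  - lra.
  - intros q _. apply hits_psi_open.
  - intros q _. apply hits_chi_open.
  - intros q. apply hits_disjoint.
  - exists q. split; [lra | exact hn].
Qed.

End Flow.

Lemma shooting (v0 : R) : 0 < v0 -> exists v psi chi q s,
  solution v psi chi /\ v 0 = v0 /\ psi 0 = q /\ chi 0 = 0 /\ 0 < q < PI / 2 /\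
  0 < s /\ (forall x, 0 <= x < s -> 0 < psi x) /\ inside psi chi s /\
  psi s = 0 /\ chi s = PI / 2.
Proof.
  intros hv0. destruct (flow_exists v0) as [v [psi [chi H]]].
  destruct (shooting_flow v psi chi v0) as [q [hq [nA nB]]]; auto.
  { intros q; apply H. }
  { intros q; apply H. }
  destruct (H q) as [sol [e1 [e2 e3]]].
  destruct (hits_both (v q) (psi q) (chi q) q) as [s hs]; auto.
  { lra. }
  exists (v q), (psi q), (chi q), q, s. tauto.
Qed.

(** * Symmetry and boundary conditions of the profile curve *)

(** The polynomial identity behind [a'' = (1 - 2 * m) * a]. The letters stand for [speed psi], its
    inverse, sine and cosine of [psi], sine and cosine of [chi], [tanh v] and [/ cosh v]; the left
    side has the shape in which the product rule delivers the derivative of [da_of]. *)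
Lemma profile_algebra_a (h k s c sg ka t C : R) :
  s ^ 2 = 1 - c ^ 2 -> sg ^ 2 = 1 - ka ^ 2 -> h ^ 2 = 1 + 3 * c ^ 2 ->
  C ^ 2 = 1 - t ^ 2 -> h * k = 1 ->
  - 1 * ((3 * c * s * sg * C + h * - (C * t * (h * ka))) * (c * sg + s * ka * t)
    + h * C * (s * (h * sg) * sg + c * (ka * (2 * (h * (t * sg)) + 3 * (c * (s * (ka * k)))))
      + ((- (c * (h * sg)) * ka + s * - (sg * (2 * (h * (t * sg)) + 3 * (c * (s * (ka * k))))))
        * t + s * ka * (C ^ 2 * (h * ka)))))
  = (1 - 2 * (h ^ 2 * C ^ 2)) * (s * C).
Proof.
  intros e1 e2 e3 e4 e5. simpl in *. rewrite !Rmult_1_r in *. nsatz.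
Qed.

Lemma profile_algebra_b (h k s c sg ka t C : R) :
  s ^ 2 = 1 - c ^ 2 -> sg ^ 2 = 1 - ka ^ 2 -> h ^ 2 = 1 + 3 * c ^ 2 ->
  C ^ 2 = 1 - t ^ 2 -> h * k = 1 ->
  (3 * c * s * sg * C + h * - (C * t * (h * ka))) * (s * sg - c * ka * t)
    + h * C * (- (c * (h * sg)) * sg + s * (ka * (2 * (h * (t * sg)) + 3 * (c * (s * (ka * k)))))
      - ((s * (h * sg) * ka + c * - (sg * (2 * (h * (t * sg)) + 3 * (c * (s * (ka * k))))))
        * t + c * ka * (C ^ 2 * (h * ka))))
  = (4 - 2 * (h ^ 2 * C ^ 2)) * (c * C).
Proof.
  intros e1 e2 e3 e4 e5. simpl in *. rewrite !Rmult_1_r in *. nsatz.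
Qed.

Section Profile_coordinates.

Variables v psi chi : R -> R.
Hypothesis sol : solution v psi chi.

Let h s := speed (psi s).
Let k s := / speed (psi s).
Let sp s := sin (psi s).
Let cp s := cos (psi s).
Let sc s := sin (chi s).
Let cc s := cos (chi s).
Let th s := tanh (v s).
Let C s := / cosh (v s).

Lemma profile_algebra (s : R) :
  sp s ^ 2 = 1 - cp s ^ 2 /\ sc s ^ 2 = 1 - cc s ^ 2 /\ h s ^ 2 = 1 + 3 * cp s ^ 2 /\
  C s ^ 2 = 1 - th s ^ 2 /\ h s * k s = 1.
Proof.
  pose proof (speed_bounds (psi s)). pose proof (cosh_ge_1 (v s)).
  unfold sp, sc, h, C, th, k. rewrite !sin_sqr, speed_sqr, tanh_sqr.
  repeat split; try lra; field; lra.
Qed.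

Lemma profile_derivatives (s : R) :
  is_derive h s (3 * cp s * sp s * sc s) /\
  is_derive sp s (- (cp s * (h s * sc s))) /\
  is_derive cp s (sp s * (h s * sc s)) /\
  is_derive sc s (cc s * (2 * (h s * (th s * sc s)) + 3 * (cp s * (sp s * (cc s * k s))))) /\
  is_derive cc s (- (sc s * (2 * (h s * (th s * sc s)) + 3 * (cp s * (sp s * (cc s * k s)))))) /\
  is_derive th s (C s ^ 2 * (h s * cc s)) /\
  is_derive C s (- (C s * th s * (h s * cc s))).
Proof.
  pose proof (sol_v _ _ _ sol s) as dv. pose proof (sol_psi _ _ _ sol s) as dp.
  pose proof (sol_chi _ _ _ sol s) as dc. unfold chi_rate in dc.
  pose proof (speed_bounds (psi s)). pose proof (cosh_ge_1 (v s)).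
  refine (conj _ (conj _ (conj _ (conj _ (conj _ (conj _ _)))))).
  - eapply is_derive_eq; [exact (is_derive_Rcomp _ _ _ _ _ (is_derive_speed _) dp)|].
    unfold sp, cp, sc; field; lra.
  - eapply is_derive_eq; [exact (is_derive_Rcomp _ _ _ _ _ (is_derive_sin _) dp)|].
    unfold cp, h, sc; ring.
  - eapply is_derive_eq; [exact (is_derive_Rcomp _ _ _ _ _ (is_derive_cos _) dp)|].
    unfold sp, h, sc; ring.
  - eapply is_derive_eq; [exact (is_derive_Rcomp _ _ _ _ _ (is_derive_sin _) dc)|].
    unfold h, cc, th, sc, cp, sp, k; ring.
  - eapply is_derive_eq; [exact (is_derive_Rcomp _ _ _ _ _ (is_derive_cos _) dc)|].
    unfold h, cc, th, sc, cp, sp, k; ring.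
  - eapply is_derive_eq; [exact (is_derive_Rcomp _ _ _ _ _ (is_derive_tanh _) dv)|].
    unfold C, h, cc. field; lra.
  - eapply is_derive_eq.
    + apply (is_derive_inv (fun s => cosh (v s))); [|lra].
      exact (is_derive_Rcomp _ _ _ _ _ (is_derive_cosh _) dv).
    + unfold C, th, h, cc, tanh. field; lra.
Qed.

Definition p_of (s : R) : R := th s.
Definition a_of (s : R) : R := sp s * C s.
Definition b_of (s : R) : R := cp s * C s.
Definition dp_of (s : R) : R := C s ^ 2 * (h s * cc s).
Definition da_of (s : R) : R := - (h s * C s * (cp s * sc s + sp s * cc s * th s)).
Definition db_of (s : R) : R := h s * C s * (sp s * sc s - cp s * cc s * th s).
Let m s := a_of s ^ 2 + 4 * b_of s ^ 2.

Lemma profile_m (s : R) : m s = h s ^ 2 * C s ^ 2.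
Proof.
  destruct (profile_algebra s) as [e1 [_ [e3 _]]].
  unfold m, a_of, b_of. rewrite !Rpow_mult_distr, e1, e3. ring.
Qed.

Lemma profile_sphere (s : R) : p_of s ^ 2 + a_of s ^ 2 + b_of s ^ 2 = 1.
Proof.
  destruct (profile_algebra s) as [e1 [_ [_ [e4 _]]]].
  unfold p_of, a_of, b_of. rewrite !Rpow_mult_distr, e1, e4. ring.
Qed.

Lemma profile_conformal (s : R) : dp_of s ^ 2 + da_of s ^ 2 + db_of s ^ 2 = m s.
Proof.
  destruct (profile_algebra s) as [e1 [e2 [e3 [e4 e5]]]].
  rewrite profile_m. unfold dp_of, da_of, db_of.
  transitivity (h s ^ 2 * C s ^ 2 * (C s ^ 2 * cc s ^ 2
    + (cp s ^ 2 + sp s ^ 2) * (sc s ^ 2 + cc s ^ 2 * th s ^ 2))); [ring|].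
  rewrite e1, e2, e4. ring.
Qed.

Lemma is_derive_profile (s : R) :
  is_derive p_of s (dp_of s) /\ is_derive a_of s (da_of s) /\ is_derive b_of s (db_of s).
Proof.
  destruct (profile_derivatives s) as [dh [dsp [dcp [dsc [dcc [dth dC]]]]]].
  refine (conj _ (conj _ _)).
  - exact dth.
  - eapply is_derive_eq; [exact (is_derive_Rmult _ _ _ _ _ dsp dC)|]. unfold da_of; ring.
  - eapply is_derive_eq; [exact (is_derive_Rmult _ _ _ _ _ dcp dC)|]. unfold db_of; ring.
Qed.

Lemma is_derive_profile2 (s : R) :
  is_derive dp_of s (- 2 * m s * p_of s) /\
  is_derive da_of s ((1 - 2 * m s) * a_of s) /\
  is_derive db_of s ((4 - 2 * m s) * b_of s).
Proof.
  destruct (profile_derivatives s) as [dh [dsp [dcp [dsc [dcc [dth dC]]]]]].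
  destruct (profile_algebra s) as [e1 [e2 [e3 [e4 e5]]]].
  assert (dC2 := is_derive_Rmult _ _ _ _ _ dC dC).
  assert (dhC := is_derive_Rmult _ _ _ _ _ dh dC).
  assert (dhcc := is_derive_Rmult _ _ _ _ _ dh dcc).
  rewrite profile_m. refine (conj _ (conj _ _)).
  - apply (is_derive_ext (fun s => C s * C s * (h s * cc s))).
    { intros t; unfold dp_of; simpl; ring. }
    eapply is_derive_eq; [exact (is_derive_Rmult _ _ _ _ _ dC2 dhcc)|].
    unfold p_of.
    transitivity (3 * cp s * sp s * sc s * cc s * C s ^ 2 * (1 - h s * k s)
      - 2 * h s ^ 2 * th s * C s ^ 2 * (sc s ^ 2 + cc s ^ 2)); [ring|].
    rewrite e2, e5. ring.
  - assert (d1 := is_derive_Rmult _ _ _ _ _ dcp dsc).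
    assert (d2 := is_derive_Rmult _ _ _ _ _ (is_derive_Rmult _ _ _ _ _ dsp dcc) dth).
    apply (is_derive_ext (fun s => - 1 * (h s * C s * (cp s * sc s + sp s * cc s * th s)))).
    { intros t; unfold da_of; simpl; ring. }
    eapply is_derive_eq.
    { apply (is_derive_scal (fun s => h s * C s * (cp s * sc s + sp s * cc s * th s))).
      exact (is_derive_Rmult _ _ _ _ _ dhC (is_derive_Rplus _ _ _ _ _ d1 d2)). }
    apply profile_algebra_a; auto.
  - assert (d1 := is_derive_Rmult _ _ _ _ _ dsp dsc).
    assert (d2 := is_derive_Rmult _ _ _ _ _ (is_derive_Rmult _ _ _ _ _ dcp dcc) dth).
    eapply is_derive_eq.
    { exact (is_derive_Rmult _ _ _ _ _ dhC (is_derive_Rminus _ _ _ _ _ d1 d2)). }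
    apply profile_algebra_b; auto.
Qed.

End Profile_coordinates.

Lemma speed_opp (x : R) : speed (- x) = speed x.
Proof. unfold speed. now rewrite cos_neg. Qed.

(** The metric is invariant under [a -> - a], that is [psi -> - psi]. Combined with reversal of time
    this sends the direction [chi] to [PI - chi]. *)
Lemma solution_reflect (v psi chi : R -> R) (c : R) : solution v psi chi ->
  solution (fun s => v (c - s)) (fun s => - psi (c - s)) (fun s => PI - chi (c - s)).
Proof.
  intros sol.
  assert (hc : forall s, is_derive (fun s => c - s) s (-1)).
  { intros s. auto_derive; auto; ring. }
  assert (ecos : forall x, cos (PI - x) = - cos x)
    by (intros x; rewrite cos_minus, cos_PI, sin_PI; ring).
  assert (esin : forall x, sin (PI - x) = sin x)
    by (intros x; rewrite sin_minus, cos_PI, sin_PI; ring).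
  split; intros s; rewrite ?speed_opp; unfold chi_rate; rewrite ?ecos, ?esin, ?speed_opp,
    ?cos_neg, ?sin_neg.
  - eapply is_derive_eq; [exact (is_derive_Rcomp _ _ _ _ _ (sol_v _ _ _ sol (c - s)) (hc s))|].
    ring.
  - eapply is_derive_eq.
    + exact (is_derive_opp (V := R_NormedModule) _ _ _
        (is_derive_Rcomp _ _ _ _ _ (sol_psi _ _ _ sol (c - s)) (hc s))).
    + unfold opp; simpl; ring.
  - eapply is_derive_eq.
    + exact (is_derive_Rminus _ _ _ _ _ (is_derive_Rconst PI s)
        (is_derive_Rcomp _ _ _ _ _ (sol_chi _ _ _ sol (c - s)) (hc s))).
    + unfold chi_rate. ring.
Qed.

(** The state [psi = 0], [chi = PI / 2] at time [S] is fixed by the reflection, so the solution and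
    its mirror image agree. Uniqueness runs forward in time; times before [S] are reached by
    exchanging [s] and [2 * S - s]. *)
Lemma solution_symmetric (v psi chi : R -> R) (S : R) :
  solution v psi chi -> psi S = 0 -> chi S = PI / 2 ->
  forall s, v (2 * S - s) = v s /\ psi (2 * S - s) = - psi s /\ chi (2 * S - s) = PI - chi s.
Proof.
  intros sol hp hc.
  assert (h : forall s, S <= s ->
    v s = v (2 * S - s) /\ psi s = - psi (2 * S - s) /\ chi s = PI - chi (2 * S - s)).
  { intros s hs.
    apply (solution_unique _ _ _ _ _ _ S s sol (solution_reflect v psi chi (2 * S) sol) hs);
      replace (2 * S - S) with S by ring; rewrite ?hp, ?hc; lra. }
  intros s. destruct (Rle_dec S s) as [hs | hs].
  - destruct (h s hs) as [h1 [h2 h3]]. lra.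
  - destruct (h (2 * S - s)) as [h1 [h2 h3]]; [lra|].
    replace (2 * S - (2 * S - s)) with s in * by ring. lra.
Qed.

(** Everything that the rest of the proof uses of the curve, with [t = 0] at the core and [t = T] on
    the boundary. As [d/dt] has length [sqrt m], the fields [dp_T], [da_T], [db_T] express that the
    conormal is the normal of the cap. [da_0] says that [a] vanishes to first order at the core,
    which controls [a' / a] there. *)
Record profile (r T : R) (p a b dp da db : R -> R) : Prop := {
  T_pos : 0 < T;
  der_p : forall t, is_derive p t (dp t);
  der_a : forall t, is_derive a t (da t);
  der_b : forall t, is_derive b t (db t);
  der_dp : forall t, is_derive dp t (- 2 * (a t ^ 2 + 4 * b t ^ 2) * p t);
  der_da : forall t, is_derive da t ((1 - 2 * (a t ^ 2 + 4 * b t ^ 2)) * a t);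
  der_db : forall t, is_derive db t ((4 - 2 * (a t ^ 2 + 4 * b t ^ 2)) * b t);
  sphere : forall t, p t ^ 2 + a t ^ 2 + b t ^ 2 = 1;
  conformal : forall t, dp t ^ 2 + da t ^ 2 + db t ^ 2 = a t ^ 2 + 4 * b t ^ 2;
  m_pos : forall t, 0 < a t ^ 2 + 4 * b t ^ 2;
  p_even : forall t, p (- t) = p t;
  a_odd : forall t, a (- t) = - a t;
  b_even : forall t, b (- t) = b t;
  p_cap : forall t, Rabs t <= T -> cos r <= p t;
  a_pos : forall t, 0 < t <= T -> 0 < a t;
  b_pos : forall t, 0 <= t <= T -> 0 < b t;
  da_0 : 0 < da 0;
  p_T : p T = cos r;
  dp_T : dp T = - sin r * sqrt (a T ^ 2 + 4 * b T ^ 2);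
  da_T : da T = cos r / sin r * sqrt (a T ^ 2 + 4 * b T ^ 2) * a T;
  db_T : db T = cos r / sin r * sqrt (a T ^ 2 + 4 * b T ^ 2) * b T
}.

Lemma artanh_cos (r : R) : 0 < r < PI / 2 ->
  exists x, 0 < x /\ tanh x = cos r /\ cosh x = / sin r.
Proof.
  intros hr.
  assert (hs : 0 < sin r) by (apply sin_gt_0; lra).
  assert (hc : 0 < cos r) by (apply cos_gt_0; lra).
  pose proof (SIN_bound r). pose proof (sin_sqr r) as e.
  assert (h1 : 1 < (1 + cos r) / sin r).
  { apply Rmult_lt_reg_r with (sin r); auto.
    replace ((1 + cos r) / sin r * sin r) with (1 + cos r) by (field; lra). lra. }
  (* The logarithm of [cot (r / 2)]; the inverse of its exponential is [(1 - cos r) / sin r]. *)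
  exists (ln ((1 + cos r) / sin r)).
  assert (h2 : / ((1 + cos r) / sin r) = (1 - cos r) / sin r).
  { apply Rmult_eq_reg_r with ((1 + cos r) / sin r); [|lra]. rewrite Rinv_l by lra.
    replace ((1 - cos r) / sin r * ((1 + cos r) / sin r))
      with ((1 - cos r ^ 2) / sin r ^ 2) by (field; lra).
    rewrite <- e. field; lra. }
  split; [rewrite <- ln_1; apply ln_increasing; lra|].
  unfold tanh, sinh, cosh. rewrite exp_Ropp, exp_ln, h2 by lra. split; field; lra.
Qed.

Lemma profile_exists (r : R) : 0 < r < PI / 2 ->
  exists T p a b dp da db, profile r T p a b dp da db.
Proof.
  intros hr. destruct (artanh_cos r hr) as [v0 [hv0 [ht hC]]].
  destruct (shooting v0 hv0) as [v [psi [chi [q [S H]]]]].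
  destruct H as [sol [iv [ip [ic [hq [hS [hpos [hin [hpS hcS]]]]]]]]].
  assert (hs : 0 < sin r) by (apply sin_gt_0; lra).
  assert (sym := solution_symmetric v psi chi S sol hpS hcS).
  assert (bd : forall t, 0 <= t <= S -> 0 <= psi (S - t) <= q /\ v0 <= v (S - t)).
  { intros t h. destruct (inside_bounds v psi chi q sol) with (s := S) (x := S - t) as [_ h2];
      auto; lra. }
  assert (hrev : forall t, is_derive (fun t => S - t) t (-1)) by (intros; auto_derive; auto; ring).
  assert (rev : forall (f f' : R -> R) t, (forall s, is_derive f s (f' s)) ->
    is_derive (fun t => f (S - t)) t (- f' (S - t))).
  { intros f f' t hf. eapply is_derive_eq.
    - exact (is_derive_Rcomp _ _ _ _ _ (hf (S - t)) (hrev t)).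
    - ring. }
  assert (orev : forall (f f' : R -> R) t, (forall s, is_derive f s (f' s)) ->
    is_derive (fun t => - f (S - t)) t (f' (S - t))).
  { intros f f' t hf. eapply is_derive_eq.
    - exact (is_derive_opp (V := R_NormedModule) _ _ _ (rev f f' t hf)).
    - unfold opp; simpl; ring. }
  assert (d1 := is_derive_profile v psi chi sol).
  assert (d2 := is_derive_profile2 v psi chi sol).
  assert (hm : forall s, 0 < a_of v psi s ^ 2 + 4 * b_of v psi s ^ 2).
  { intros s. rewrite (profile_m v psi chi). pose proof (speed_bounds (psi s)).
    pose proof (cosh_ge_1 (v s)).
    assert (0 < / cosh (v s)) by (apply Rinv_0_lt_compat; lra).
    apply Rmult_lt_0_compat; apply pow_lt; lra. }
  assert (hsm : sqrt (a_of v psi 0 ^ 2 + 4 * b_of v psi 0 ^ 2) = speed q * sin r).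
  { rewrite (profile_m v psi chi), iv, ip, hC, Rinv_inv, <- Rpow_mult_distr.
    apply sqrt_pow2. pose proof (speed_bounds q). apply Rmult_le_pos; lra. }
  (* The trajectory runs from the boundary to the core; [t = S - s] reverses it, whence the signs of
     the derivatives. *)
  exists S, (fun t => p_of v (S - t)), (fun t => a_of v psi (S - t)),
    (fun t => b_of v psi (S - t)), (fun t => - dp_of v psi chi (S - t)),
    (fun t => - da_of v psi chi (S - t)), (fun t => - db_of v psi chi (S - t)).
  assert (eS : forall t, S - - t = 2 * S - (S - t)) by (intros; ring).
  split; intros; rewrite ?Rminus_diag, ?hsm.
  - auto.
  - apply rev. apply d1.
  - apply rev. apply d1.
  - apply rev. apply d1.
  - apply (orev (dp_of v psi chi)
      (fun s => - 2 * (a_of v psi s ^ 2 + 4 * b_of v psi s ^ 2) * p_of v s)). apply d2.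
  - apply (orev (da_of v psi chi)
      (fun s => (1 - 2 * (a_of v psi s ^ 2 + 4 * b_of v psi s ^ 2)) * a_of v psi s)). apply d2.
  - apply (orev (db_of v psi chi)
      (fun s => (4 - 2 * (a_of v psi s ^ 2 + 4 * b_of v psi s ^ 2)) * b_of v psi s)). apply d2.
  - apply (profile_sphere v psi chi).
  - rewrite <- (profile_conformal v psi chi). ring.
  - apply hm.
  - rewrite eS. destruct (sym (S - t)) as [e1 [e2 e3]]. unfold p_of. now rewrite e1.
  - rewrite eS. destruct (sym (S - t)) as [e1 [e2 e3]]. unfold a_of.
    rewrite e1, e2, sin_neg. ring.
  - rewrite eS. destruct (sym (S - t)) as [e1 [e2 e3]]. unfold b_of.
    now rewrite e1, e2, cos_neg.
  - unfold p_of. rewrite <- ht. apply tanh_le.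
    destruct (Rle_dec 0 t) as [h | h].
    + rewrite Rabs_pos_eq in H by auto. apply bd; lra.
    + rewrite Rabs_left in H by lra.
      replace t with (- - t) by ring. rewrite eS. destruct (sym (S - - t)) as [e1 _].
      rewrite e1. apply bd; lra.
  - unfold a_of. destruct (bd t); [lra|]. pose proof (hpos (S - t)).
    apply Rmult_lt_0_compat; [apply sin_gt_0; lra|].
    apply Rinv_0_lt_compat. pose proof (cosh_ge_1 (v (S - t))). lra.
  - unfold b_of. destruct (bd t); [lra|].
    apply Rmult_lt_0_compat; [apply cos_gt_0; lra|].
    apply Rinv_0_lt_compat. pose proof (cosh_ge_1 (v (S - t))). lra.
  - rewrite Rminus_0_r. unfold da_of. rewrite hpS, hcS, sin_0, cos_0, sin_PI2, cos_PI2.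
    pose proof (speed_bounds 0). pose proof (cosh_ge_1 (v S)).
    assert (0 < / cosh (v S)) by (apply Rinv_0_lt_compat; lra).
    assert (0 < speed 0 * / cosh (v S)) by (apply Rmult_lt_0_compat; lra). lra.
  - unfold p_of. now rewrite iv.
  - unfold dp_of. rewrite ip, iv, ic, hC, cos_0, Rinv_inv. ring.
  - unfold da_of, a_of. rewrite ip, iv, ic, hC, cos_0, sin_0, ht, Rinv_inv. field; lra.
  - unfold db_of, b_of. rewrite ip, iv, ic, hC, cos_0, sin_0, ht, Rinv_inv. field; lra.
Qed.

(* Coquelicot states equations between real integrals in a structure convertible to [R],
   which [ring] does not recognize. *)
Ltac eq_R := match goal with |- @eq _ ?x ?y => change (@eq R x y) end.

(** * Wirtinger inequalities *)

Lemma RInt_deriv (f f' : R -> R) (a b : R) :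
  (forall x, is_derive f x (f' x)) -> (forall x, continuous f' x) ->
  RInt f' a b = f b - f a.
Proof.
  intros hf hc. apply is_RInt_unique, (is_RInt_derive f f'); intros; auto.
Qed.

Lemma is_derive_sqr (f : R -> R) (x l : R) :
  is_derive f x l -> is_derive (fun x => f x ^ 2) x (2 * f x * l).
Proof.
  intros h. eapply is_derive_eq; [exact (is_derive_pow f 2 x l h)|].
  change (INR 2) with (1 + 1). simpl pred. ring.
Qed.

Lemma RInt_Rext (f g : R -> R) (a b : R) :
  (forall x, f x = g x) -> RInt f a b = RInt g a b.
Proof. intros h; apply RInt_ext; intros; apply h. Qed.

Lemma RInt_Rplus (f g : R -> R) (a b : R) :
  (forall x, continuous f x) -> (forall x, continuous g x) ->
  RInt (fun x => f x + g x) a b = RInt f a b + RInt g a b.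
Proof.
  intros; apply (RInt_plus f g); apply ex_RInt_of_continuous; auto.
Qed.

Lemma RInt_Rscal (f : R -> R) (c a b : R) :
  (forall x, continuous f x) -> RInt (fun x => c * f x) a b = c * RInt f a b.
Proof.
  intros; apply (RInt_scal f); apply ex_RInt_of_continuous; auto.
Qed.

Lemma RInt_Rconst (c a b : R) : RInt (fun _ => c) a b = (b - a) * c.
Proof. exact (RInt_const (V := R_CompleteNormedModule) a b c). Qed.

Lemma RInt_add_interval (f : R -> R) (a b c : R) :
  (forall x, continuous f x) -> RInt f a b + RInt f b c = RInt f a c.
Proof.
  intros; apply (RInt_Chasles f); apply ex_RInt_of_continuous; auto.
Qed.

Lemma RInt_nonneg (f : R -> R) (a b : R) :
  a <= b -> (forall x, continuous f x) -> (forall x, 0 <= f x) -> 0 <= RInt f a b.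
Proof. intros; apply RInt_ge_0; auto using ex_RInt_of_continuous. Qed.

Lemma continuous_Rmult (f g : R -> R) (x : R) :
  continuous f x -> continuous g x -> continuous (fun x => f x * g x) x.
Proof. exact (continuous_mult f g x). Qed.

Lemma continuous_Rplus (f g : R -> R) (x : R) :
  continuous f x -> continuous g x -> continuous (fun x => f x + g x) x.
Proof. exact (continuous_plus f g x). Qed.

Lemma continuous_Rconst (c x : R) : continuous (fun _ : R => c) x.
Proof. apply continuous_const. Qed.

Lemma continuous_sqr (f : R -> R) (x : R) : continuous f x -> continuous (fun x => f x ^ 2) x.
Proof.
  intros h. apply (continuous_ext (fun x => f x * f x)).
  { intros y; change (f y * f y = f y ^ 2); ring. }
  now apply continuous_Rmult.
Qed.

(** The increment of a primitive over one period has derivative [f (y + P) - f y = 0]. *)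
Lemma RInt_periodic_shift (f : R -> R) (P x : R) :
  (forall x, continuous f x) -> (forall x, f (x + P) = f x) ->
  RInt f x (x + P) = RInt f 0 P.
Proof.
  intros hc hper.
  set (G := fun x => 0 + RInt f 0 x).
  assert (dG : forall x, is_derive G x (f x)) by (intros; now apply is_derive_primitive).
  assert (hG : forall y, G (y + P) - G y = RInt f y (y + P)).
  { intros y. unfold G. rewrite <- (RInt_add_interval f 0 y (y + P) hc). ring. }
  assert (hd : forall y, is_derive (fun y => G (y + P) - G y) y (1 * f (y + P) - f y)).
  { intros y. apply is_derive_Rminus; auto.
    apply (is_derive_Rcomp G (fun y => y + P)); auto. auto_derive; auto. }
  rewrite <- hG. replace (RInt f 0 P) with (G (0 + P) - G 0).
  2: { rewrite hG, Rplus_0_l. reflexivity. }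
  assert (hcst : forall u w, u <= w -> G (u + P) - G u = G (w + P) - G w).
  { intros u w huw.
    apply (constant_of_deriv (fun y => G (y + P) - G y) (fun y => 1 * f (y + P) - f y)); auto.
    intros y _. rewrite hper. ring. }
  destruct (Rle_dec x 0); [| symmetry]; apply hcst; lra.
Qed.

(** On the period centred at [x], a primitive of [f] is monotone with equal end values, hence
    constant near [x]; its derivative there is [f x]. *)
Lemma zero_of_RInt_periodic (f : R -> R) (P : R) :
  0 < P -> (forall x, continuous f x) -> (forall x, f (x + P) = f x) ->
  (forall x, 0 <= f x) -> RInt f 0 P = 0 -> forall x, f x = 0.
Proof.
  intros hP hc hper hpos h0 x.
  set (G := fun y => 0 + RInt f (x - P / 2) y).
  assert (dG : forall y, is_derive G y (f y)) by (intros; now apply is_derive_primitive).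
  assert (mono : forall u w, u <= w -> G u <= G w)
    by (intros u w huw; apply (nondecreasing_of_deriv G f); auto).
  assert (e0 : G (x - P / 2) = 0) by (unfold G; rewrite RInt_point; apply Rplus_0_l).
  assert (e1 : G (x + P / 2) = 0).
  { unfold G. replace (x + P / 2) with (x - P / 2 + P) by field.
    rewrite RInt_periodic_shift, h0; auto. ring. }
  rewrite <- (is_derive_unique _ _ _ (dG x)).
  apply is_derive_unique, (is_derive_ext_loc (fun _ => 0)); [|apply is_derive_Rconst].
  assert (hP2 : 0 < P / 2) by lra.
  exists (mkposreal _ hP2). intros y hy.
  assert (hy' : Rabs (y - x) < P / 2) by exact hy. apply Rabs_lt_between in hy'.
  pose proof (mono (x - P / 2) y). pose proof (mono y (x + P / 2)). lra.
Qed.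

(* With [c = - k tan (k (x - mid))] one has [c' = - k^2 - c^2], so
   [y'^2 - k^2 y^2 - (c y^2)' = (y' - c y)^2]. *)
Lemma wirtinger_dirichlet_lt (y y' : R -> R) (a l k : R) :
  0 < l -> 0 <= k -> k * l < PI ->
  (forall x, is_derive y x (y' x)) -> (forall x, continuous y' x) ->
  y a = 0 -> y (a + l) = 0 ->
  k ^ 2 * RInt (fun x => y x ^ 2) a (a + l) <= RInt (fun x => y' x ^ 2) a (a + l).
Proof.
  intros hl hk hkl hy hc ha hb.
  assert (cy : forall x, continuous y x) by (intros; eapply continuous_of_is_derive; auto).
  set (mid := a + l / 2).
  set (G := fun x => 0 + RInt (fun x => y' x ^ 2 - k ^ 2 * y x ^ 2) a x
    + k * tan (k * (x - mid)) * y x ^ 2).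
  assert (cF : forall x, continuous (fun x => y' x ^ 2 - k ^ 2 * y x ^ 2) x).
  { intros x. apply (continuous_minus (fun x => y' x ^ 2) (fun x => k ^ 2 * y x ^ 2)).
    - now apply continuous_sqr.
    - apply continuous_Rmult; [apply continuous_Rconst | now apply continuous_sqr]. }
  assert (hG : G a <= G (a + l)).
  { apply (nondecreasing_of_deriv G
      (fun x => (y' x + k * tan (k * (x - mid)) * y x) ^ 2)); [lra| |].
    - intros x hx.
      assert (hcos : 0 < cos (k * (x - mid))).
      { assert (Rabs (x - mid) <= l / 2) by (apply Rabs_le; unfold mid; lra).
        assert (Rabs (k * (x - mid)) < PI / 2).
        { rewrite Rabs_mult, (Rabs_pos_eq k) by auto. nra. }
        apply Rabs_lt_between in H0. apply cos_gt_0; lra. }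
      assert (htan : is_derive (fun x => k * tan (k * (x - mid))) x
        (k ^ 2 + (k * tan (k * (x - mid))) ^ 2)).
      { unfold tan, Rminus in *. auto_derive; [lra|].
        set (z := k * (x + - mid)) in *.
        pose proof (sin_sqr z) as e.
        replace (k ^ 2 + (k * (sin z / cos z)) ^ 2)
          with (k ^ 2 * (cos z ^ 2 + sin z ^ 2) / cos z ^ 2) by (field; lra).
        field; lra. }
      eapply is_derive_eq.
      + apply is_derive_Rplus; [now apply is_derive_primitive|].
        apply is_derive_Rmult; [exact htan | apply is_derive_sqr, hy].
      + cbv beta; ring.
    - intros; apply pow2_ge_0. }
  unfold G in hG. rewrite RInt_point, ha, hb in hG. unfold zero in hG; simpl in hG.
  assert (e : RInt (fun x => y' x ^ 2 - k ^ 2 * y x ^ 2) a (a + l) =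
    RInt (fun x => y' x ^ 2) a (a + l) - k ^ 2 * RInt (fun x => y x ^ 2) a (a + l)).
  { rewrite <- RInt_Rscal by (intros; now apply continuous_sqr).
    apply (RInt_minus (fun x => y' x ^ 2) (fun x => k ^ 2 * y x ^ 2));
      apply ex_RInt_of_continuous; intros.
    - now apply continuous_sqr.
    - apply continuous_Rmult; [apply continuous_Rconst | now apply continuous_sqr]. }
  simpl in e, hG. rewrite e in hG. simpl. lra.
Qed.

(** In the limit case [k * l = PI] the tangent is infinite at both ends. If the inequality failed,
    it would already fail for a slightly smaller [k1], where the strict case applies. *)
Lemma wirtinger_dirichlet (y y' : R -> R) (a l k : R) :
  0 < l -> k * l = PI ->
  (forall x, is_derive y x (y' x)) -> (forall x, continuous y' x) ->
  y a = 0 -> y (a + l) = 0 ->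
  k ^ 2 * RInt (fun x => y x ^ 2) a (a + l) <= RInt (fun x => y' x ^ 2) a (a + l).
Proof.
  intros hl hkl hy hc ha hb. pose proof PI_RGT_0.
  assert (cy : forall x, continuous y x) by (intros; eapply continuous_of_is_derive; auto).
  assert (hk : 0 < k) by nra.
  set (A := RInt (fun x => y x ^ 2) a (a + l)). set (B := RInt (fun x => y' x ^ 2) a (a + l)).
  assert (hA : 0 <= A).
  { apply RInt_nonneg; [lra | | intros; apply pow2_ge_0]. intros; now apply continuous_sqr. }
  assert (hB : 0 <= B).
  { apply RInt_nonneg; [lra | | intros; apply pow2_ge_0]. intros; now apply continuous_sqr. }
  apply Rnot_lt_le; intros hlt.
  assert (hA' : 0 < A) by nra.
  assert (hBA : B / A < k ^ 2).
  { apply Rmult_lt_reg_r with A; auto. unfold Rdiv. rewrite Rmult_assoc, Rinv_l; lra. }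
  assert (hBA0 : 0 <= B / A) by (apply Rle_mult_inv_pos; auto).
  (* [k1 ^ 2] is midway between the Rayleigh quotient [B / A] and [k ^ 2]. *)
  set (k1 := sqrt ((B / A + k ^ 2) / 2)).
  assert (hk1 : k1 ^ 2 = (B / A + k ^ 2) / 2) by (apply pow2_sqrt; nra).
  assert (hk1' : 0 <= k1) by apply sqrt_pos.
  assert (k1 < k) by nra.
  assert (k1 * l < PI) by nra.
  pose proof (wirtinger_dirichlet_lt y y' a l k1 hl hk1' H1 hy hc ha hb) as h.
  fold A B in h. rewrite hk1 in h.
  replace ((B / A + k ^ 2) / 2 * A) with ((B + k ^ 2 * A) / 2) in h by (field; lra). lra.
Qed.

(** Since [y PI = - y 0], there is a zero [z], and [z + PI] is another one: the Dirichlet inequality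
    with [k = 1] applies between them. *)
Lemma wirtinger_antiperiodic (y y' : R -> R) :
  (forall x, is_derive y x (y' x)) -> (forall x, continuous y' x) ->
  (forall x, y (x + PI) = - y x) -> (forall x, y' (x + PI) = - y' x) ->
  RInt (fun x => y x ^ 2) 0 PI <= RInt (fun x => y' x ^ 2) 0 PI.
Proof.
  intros hy hc ha ha'. pose proof PI_RGT_0.
  assert (cy : forall x, continuous y x) by (intros; eapply continuous_of_is_derive; auto).
  destruct (IVT_gen y 0 PI 0) as [z [_ hz]].
  - intros x. eapply is_derive_continuity_pt; eauto.
  - pose proof (ha 0) as e. rewrite Rplus_0_l in e. rewrite e.
    unfold Rmin, Rmax; repeat destruct Rle_dec; lra.
  - rewrite <- (RInt_periodic_shift (fun x => y x ^ 2) PI z),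
      <- (RInt_periodic_shift (fun x => y' x ^ 2) PI z);
      try (intros; now apply continuous_sqr).
    + pose proof (wirtinger_dirichlet y y' z PI 1) as h. rewrite pow1, !Rmult_1_l in h.
      apply h; auto. rewrite ha, hz; ring.
    + intros; rewrite ha'; ring.
    + intros; rewrite ha; ring.
Qed.

(* Hurwitz: [y] takes the same value at two points at distance [PI / 2]; subtracting it, one
   is reduced to Dirichlet conditions on two intervals of length [PI / 2]. *)
Lemma wirtinger_periodic (y y' : R -> R) :
  (forall x, is_derive y x (y' x)) -> (forall x, continuous y' x) ->
  (forall x, y (x + PI) = y x) -> (forall x, y' (x + PI) = y' x) ->
  RInt y 0 PI = 0 ->
  4 * RInt (fun x => y x ^ 2) 0 PI <= RInt (fun x => y' x ^ 2) 0 PI.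
Proof.
  intros hy hc hp hp' h0. pose proof PI_RGT_0.
  assert (cy : forall x, continuous y x) by (intros; eapply continuous_of_is_derive; auto).
  destruct (IVT_gen (fun x => y (x + PI / 2) - y x) 0 (PI / 2) 0) as [z [_ hz]].
  - intros x. eapply is_derive_continuity_pt. apply is_derive_Rminus; [|apply hy].
    apply (is_derive_Rcomp y (fun x => x + PI / 2)); [apply hy|]. auto_derive; auto.
  - replace (PI / 2 + PI / 2) with (0 + PI) by field. rewrite hp, Rplus_0_l.
    unfold Rmin, Rmax; repeat destruct Rle_dec; lra.
  - set (c := y z). assert (hz' : y (z + PI / 2) = c) by (unfold c; lra).
    set (u := fun x => y x - c).
    assert (du : forall x, is_derive u x (y' x)).
    { intros x. eapply is_derive_eq; [apply is_derive_Rminus; [apply hy | apply is_derive_Rconst]|].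
      ring. }
    assert (cu : forall x, continuous u x) by (intros; eapply continuous_of_is_derive; auto).
    assert (cu2 : forall x, continuous (fun x => u x ^ 2) x) by (intros; now apply continuous_sqr).
    assert (cy2 : forall x, continuous (fun x => y x ^ 2) x) by (intros; now apply continuous_sqr).
    assert (cy'2 : forall x, continuous (fun x => y' x ^ 2) x)
      by (intros; now apply continuous_sqr).
    assert (h1 : 2 ^ 2 * RInt (fun x => u x ^ 2) z (z + PI / 2) <=
      RInt (fun x => y' x ^ 2) z (z + PI / 2)).
    { apply wirtinger_dirichlet; [lra | field | exact du | exact hc | unfold u, c; ring |].
      unfold u; rewrite hz'; ring. }
    assert (h2 : 2 ^ 2 * RInt (fun x => u x ^ 2) (z + PI / 2) (z + PI / 2 + PI / 2) <=
      RInt (fun x => y' x ^ 2) (z + PI / 2) (z + PI / 2 + PI / 2)).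
    { apply wirtinger_dirichlet;
        [lra | field | exact du | exact hc | unfold u; rewrite hz'; ring |].
      replace (z + PI / 2 + PI / 2) with (z + PI) by field.
      unfold u; rewrite hp; unfold c; ring. }
    replace (z + PI / 2 + PI / 2) with (z + PI) in h2 by field.
    pose proof (RInt_add_interval (fun x => u x ^ 2) z (z + PI / 2) (z + PI) cu2) as e1.
    pose proof (RInt_add_interval (fun x => y' x ^ 2) z (z + PI / 2) (z + PI) cy'2) as e2.
    rewrite (RInt_periodic_shift (fun x => u x ^ 2) PI z cu2) in e1
      by (intros; unfold u; rewrite hp; reflexivity).
    rewrite (RInt_periodic_shift (fun x => y' x ^ 2) PI z cy'2) in e2
      by (intros; rewrite hp'; reflexivity).
    assert (e3 : RInt (fun x => u x ^ 2) 0 PI = RInt (fun x => y x ^ 2) 0 PI + c ^ 2 * PI).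
    { rewrite (RInt_Rext _ (fun x => y x ^ 2 + (- 2 * c * y x + c ^ 2)))
        by (intros; unfold u; ring).
      rewrite RInt_Rplus, RInt_Rplus, RInt_Rscal, h0, RInt_Rconst; auto.
      - eq_R. ring.
      - intros; apply continuous_Rmult; [apply continuous_Rconst | auto].
      - intros; apply continuous_Rconst.
      - intros; apply continuous_Rplus; [|apply continuous_Rconst].
        apply continuous_Rmult; [apply continuous_Rconst | auto]. }
    pose proof (pow2_ge_0 c). nra.
Qed.

(** * Comparison with a positive solution of the radial equation *)

Lemma continuous_2d_r (f : R -> R -> R) (x y : R) :
  continuity_2d_pt f x y -> continuous (fun v => f x v) y.
Proof.
  intros h. apply continuity_pt_filterlim. intros eps he.
  destruct (h (mkposreal eps he)) as [d hd].
  exists d; split; [apply cond_pos|]. intros v [_ hv].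
  apply hd; [rewrite Rminus_diag, Rabs_R0; apply cond_pos | exact hv].
Qed.

Lemma is_derive_RInt_parameter (f ft : R -> R -> R) (a b t : R) :
  (forall s x, is_derive (fun s => f s x) s (ft s x)) ->
  (forall s x, continuity_2d_pt f s x) -> (forall s x, continuity_2d_pt ft s x) ->
  is_derive (fun t => RInt (fun x => f t x) a b) t (RInt (fun x => ft t x) a b).
Proof.
  intros hd hc hct.
  assert (e : forall s x, Derive (fun u => f u x) s = ft s x)
    by (intros; apply is_derive_unique, hd).
  rewrite <- (RInt_Rext (fun x => Derive (fun u => f u x) t)) by (intros; apply e).
  apply (is_derive_RInt_param f).
  - apply filter_forall. intros s x _. exists (ft s x). apply hd.
  - intros x _. apply (continuity_2d_pt_ext ft); auto.
  - apply filter_forall. intros s. apply ex_RInt_of_continuous.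
    intros x. apply continuous_2d_r, hc.
Qed.

(** The derivatives are named functions, so that shifts and linear combinations of [f] and [p] have
    explicit ones. *)
Record C2 (g gt gh gtt ghh : R -> R -> R) : Prop := {
  C2_t : forall t x, is_derive (fun s => g s x) t (gt t x);
  C2_tt : forall t x, is_derive (fun s => gt s x) t (gtt t x);
  C2_h : forall t x, is_derive (fun y => g t y) x (gh t x);
  C2_hh : forall t x, is_derive (fun y => gh t y) x (ghh t x);
  C2_c : forall t x, continuity_2d_pt g t x;
  C2_ct : forall t x, continuity_2d_pt gt t x;
  C2_ch : forall t x, continuity_2d_pt gh t x;
  C2_ctt : forall t x, continuity_2d_pt gtt t x;
  C2_chh : forall t x, continuity_2d_pt ghh t x
}.

Lemma continuity_2d_sqr (f : R -> R -> R) (x y : R) :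
  continuity_2d_pt f x y -> continuity_2d_pt (fun u v => f u v ^ 2) x y.
Proof.
  intros h. apply (continuity_2d_pt_ext (fun u v => f u v * f u v)); [intros; ring|].
  now apply continuity_2d_pt_mult.
Qed.

Section Comparison.

Variables (g gt gh gtt ghh : R -> R -> R) (w w' m : R -> R) (k T L L1 : R).
Hypothesis reg : C2 g gt gh gtt ghh.
Hypothesis T_pos : 0 < T.
Hypothesis pde : forall t x, 0 <= t <= T -> gtt t x + ghh t x + 2 * m t * g t x = 0.
Hypothesis dw : forall t, is_derive w t (w' t).
Hypothesis dw' : forall t, is_derive w' t ((k - 2 * m t) * w t).
Hypothesis w_pos : forall t, 0 < t <= T -> 0 < w t.
(** The boundary terms of the integration by parts cancel. Like [periodic] below, this is stated for
    a product so as to cover both [PI]-periodic and [PI]-antiperiodic [g]. *)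
Hypothesis ends : forall t, 0 <= t <= T -> g t PI * gh t PI = g t 0 * gh t 0.
Hypothesis wirtinger : forall t, 0 <= t <= T ->
  k * RInt (fun x => g t x ^ 2) 0 PI <= RInt (fun x => gh t x ^ 2) 0 PI.
(** The first alternative is meant for [w = b] with the even part of [f], the second for [w = a]
    with the odd part. *)
Hypothesis start :
  (0 < w 0 /\ w' 0 = 0 /\ forall x, gt 0 x = 0) \/
  (w 0 = 0 /\ 0 < w' 0 /\ forall x, g 0 x = 0).
Hypothesis bc_w : w' T = L1 * w T.
(** Multiplied by [g], the condition also holds when [g] vanishes on the boundary, whatever [L]
    is. *)
Hypothesis bc_g : forall x, g T x * gt T x = L * g T x ^ 2.
Hypothesis L_lt : L < L1.
Hypothesis periodic : forall t x, 0 <= t <= T -> g t (x + PI) ^ 2 = g t x ^ 2.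

Let N t := RInt (fun x => g t x ^ 2) 0 PI.
Let P t := RInt (fun x => g t x * gt t x) 0 PI.
Let Q t := RInt (fun x => gt t x ^ 2) 0 PI.
Let H t := RInt (fun x => gh t x ^ 2) 0 PI.
(** Since [N' = 2 * P], the derivative of [N / w ^ 2] is [2 * J / w ^ 2]. *)
Let J t := P t - w' t / w t * N t.

Lemma continuous_g t x : continuous (fun x => g t x) x.
Proof. apply continuous_2d_r, (C2_c _ _ _ _ _ reg). Qed.
Lemma continuous_gt t x : continuous (fun x => gt t x) x.
Proof. apply continuous_2d_r, (C2_ct _ _ _ _ _ reg). Qed.
Lemma continuous_gh t x : continuous (fun x => gh t x) x.
Proof. apply continuous_2d_r, (C2_ch _ _ _ _ _ reg). Qed.
Lemma continuous_gtt t x : continuous (fun x => gtt t x) x.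
Proof. apply continuous_2d_r, (C2_ctt _ _ _ _ _ reg). Qed.
Lemma continuous_ghh t x : continuous (fun x => ghh t x) x.
Proof. apply continuous_2d_r, (C2_chh _ _ _ _ _ reg). Qed.

Ltac cont :=
  lazymatch goal with
  | |- continuous (fun _ => ?c) _ => apply (continuous_Rconst c)
  | |- continuous (fun x => @?f x ^ 2) _ => apply (continuous_sqr f); cont
  | |- continuous (fun x => @?f x + @?g x) _ => apply (continuous_Rplus f g); cont
  | |- continuous (fun x => @?f x * @?g x) _ => apply (continuous_Rmult f g); cont
  | |- continuous (fun x => g ?t x) ?y => exact (continuous_g t y)
  | |- continuous (fun x => gt ?t x) ?y => exact (continuous_gt t y)
  | |- continuous (fun x => gh ?t x) ?y => exact (continuous_gh t y)
  | |- continuous (fun x => gtt ?t x) ?y => exact (continuous_gtt t y)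
  | |- continuous (fun x => ghh ?t x) ?y => exact (continuous_ghh t y)
  end.

Lemma is_derive_N t : is_derive N t (2 * P t).
Proof.
  unfold P. rewrite <- RInt_Rscal by (intros; cont).
  apply (is_derive_RInt_parameter (fun t x => g t x ^ 2) (fun t x => 2 * (g t x * gt t x))).
  - intros s x. eapply is_derive_eq; [apply is_derive_sqr, (C2_t _ _ _ _ _ reg) | cbv beta; ring].
  - intros. apply continuity_2d_sqr, (C2_c _ _ _ _ _ reg).
  - intros. apply continuity_2d_pt_mult; [apply continuity_2d_pt_const|].
    apply continuity_2d_pt_mult; [apply (C2_c _ _ _ _ _ reg) | apply (C2_ct _ _ _ _ _ reg)].
Qed.

Lemma is_derive_P t : is_derive P t (Q t + RInt (fun x => g t x * gtt t x) 0 PI).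
Proof.
  unfold Q. rewrite <- RInt_Rplus by (intros; cont).
  apply (is_derive_RInt_parameter (fun t x => g t x * gt t x)
    (fun t x => gt t x ^ 2 + g t x * gtt t x)).
  - intros s x. eapply is_derive_eq.
    + apply is_derive_Rmult; [apply (C2_t _ _ _ _ _ reg) | apply (C2_tt _ _ _ _ _ reg)].
    + cbv beta. ring.
  - intros. apply continuity_2d_pt_mult;
      [apply (C2_c _ _ _ _ _ reg) | apply (C2_ct _ _ _ _ _ reg)].
  - intros. apply continuity_2d_pt_plus.
    + apply continuity_2d_sqr, (C2_ct _ _ _ _ _ reg).
    + apply continuity_2d_pt_mult;
      [apply (C2_c _ _ _ _ _ reg) | apply (C2_ctt _ _ _ _ _ reg)].
Qed.

Lemma integrate_pde t : 0 <= t <= T ->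
  RInt (fun x => g t x * gtt t x) 0 PI = H t - 2 * m t * N t.
Proof.
  intros ht.
  assert (e : RInt (fun x => gh t x ^ 2 + g t x * ghh t x) 0 PI = 0).
  { rewrite (RInt_deriv (fun x => g t x * gh t x)).
    - rewrite ends; auto. eq_R; ring.
    - intros x. eapply is_derive_eq.
      + apply is_derive_Rmult; [apply (C2_h _ _ _ _ _ reg) | apply (C2_hh _ _ _ _ _ reg)].
      + cbv beta. ring.
    - intros; cont. }
  rewrite RInt_Rplus in e by (intros; cont).
  rewrite (RInt_Rext _ (fun x => - 1 * (g t x * ghh t x) + - 2 * m t * g t x ^ 2)).
  - rewrite RInt_Rplus by (intros; cont).
    rewrite (RInt_Rscal (fun x => g t x * ghh t x)), (RInt_Rscal (fun x => g t x ^ 2))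
      by (intros; cont).
    unfold H, N. lra.
  - intros x. specialize (pde t x ht).
    replace (gtt t x) with (- ghh t x - 2 * m t * g t x) by lra. ring.
Qed.

Lemma square_nonneg t o : 0 <= Q t - 2 * o * P t + o ^ 2 * N t.
Proof.
  replace (Q t - 2 * o * P t + o ^ 2 * N t)
    with (RInt (fun x => (gt t x + - o * g t x) ^ 2) 0 PI).
  - pose proof PI_RGT_0. apply RInt_nonneg; [lra | intros; cont | intros; apply pow2_ge_0].
  - rewrite (RInt_Rext _ (fun x => gt t x ^ 2 + (- 2 * o * (g t x * gt t x) + o ^ 2 * g t x ^ 2)))
      by (intros; ring).
    rewrite RInt_Rplus, RInt_Rplus by (intros; cont).
    rewrite (RInt_Rscal (fun x => g t x * gt t x)), (RInt_Rscal (fun x => g t x ^ 2))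
      by (intros; cont).
    unfold Q, P, N. eq_R. ring.
Qed.

Lemma is_derive_J t : 0 < w t -> is_derive J t
  (Q t + RInt (fun x => g t x * gtt t x) 0 PI
   - (((k - 2 * m t) - (w' t / w t) ^ 2) * N t + w' t / w t * (2 * P t))).
Proof.
  intros hw.
  assert (dq : is_derive (fun t => w' t / w t) t ((k - 2 * m t) - (w' t / w t) ^ 2)).
  { eapply is_derive_eq; [apply (is_derive_div w' w); auto; lra|]. field; lra. }
  apply is_derive_Rminus; [apply is_derive_P|].
  exact (is_derive_Rmult _ _ _ _ _ dq (is_derive_N t)).
Qed.

(** After the equation is integrated the terms with [m] cancel, and the derivative of [J] is the
    integral of [(gt - w' / w * g) ^ 2] plus the Wirtinger defect [H - k * N]. *)
Lemma J_nondecreasing s t : 0 < s -> s <= t -> t <= T -> J s <= J t.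
Proof.
  intros hs hst ht.
  apply (nondecreasing_of_deriv J (fun t => Q t + RInt (fun x => g t x * gtt t x) 0 PI
   - (((k - 2 * m t) - (w' t / w t) ^ 2) * N t + w' t / w t * (2 * P t)))); auto.
  - intros x hx. apply is_derive_J, w_pos; lra.
  - intros x hx. assert (hx' : 0 <= x <= T) by lra. rewrite (integrate_pde x hx').
    pose proof (square_nonneg x (w' x / w x)). specialize (wirtinger x hx').
    fold (N x) (H x) in wirtinger. nra.
Qed.

Lemma P_0 : P 0 = 0.
Proof.
  unfold P. rewrite (RInt_Rext _ (fun _ => 0)).
  - rewrite RInt_Rconst. apply Rmult_0_r.
  - intros x. destruct start as [[_ [_ h]] | [_ [_ h]]]; rewrite h; ring.
Qed.

(** If [w 0 > 0], then [J] is continuous at 0 and vanishes there. If [w 0 = 0], the quotient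
    [w' / w] blows up like [/ t], but [N] and its derivative [2 * P] vanish at 0, so the product
    with [N] still tends to 0. *)
Lemma J_start e eta : 0 < e -> 0 < eta -> exists t, 0 < t < eta /\ - e < J t.
Proof.
  intros he heta. destruct start as [[h1 [h2 h3]] | [h1 [h2 h3]]].
  - destruct (continuity_near J 0 e (is_derive_continuity_pt _ _ _ (is_derive_J 0 h1)) he)
      as [d [hd h]].
    assert (hJ0 : J 0 = 0) by (unfold J; rewrite P_0, h2; unfold Rdiv; ring).
    set (t := Rmin (d / 2) (eta / 2)).
    assert (0 < t) by (apply Rmin_glb_lt; lra).
    assert (t <= d / 2) by apply Rmin_l. assert (t <= eta / 2) by apply Rmin_r.
    exists t. split; [lra|].
    assert (ht : Rabs (t - 0) < d) by (rewrite Rminus_0_r, Rabs_pos_eq; lra).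
    specialize (h t ht). apply Rabs_lt_between in h. lra.
  - assert (hN0 : N 0 = 0).
    { unfold N. rewrite (RInt_Rext _ (fun _ => 0)).
      - rewrite RInt_Rconst. apply Rmult_0_r.
      - intros x. rewrite h3. ring. }
    assert (dN := is_derive_N 0). rewrite P_0, Rmult_0_r in dN.
    apply is_derive_Reals in dN. assert (he8 : 0 < e / 8) by lra.
    destruct (dN (e / 8) he8) as [d1 hd1].
    assert (dw0 := dw 0). apply is_derive_Reals in dw0. assert (hw2 : 0 < w' 0 / 2) by lra.
    destruct (dw0 (w' 0 / 2) hw2) as [d2 hd2].
    destruct (continuity_near w' 0 (w' 0) (is_derive_continuity_pt _ _ _ (dw' 0)) h2)
      as [d3 [hd3 h3']].
    assert (he2 : 0 < e / 2) by lra.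
    destruct (continuity_near P 0 (e / 2) (is_derive_continuity_pt _ _ _ (is_derive_P 0)) he2)
      as [d4 [hd4 h4]].
    set (t := Rmin (Rmin (d1 / 2) (d2 / 2)) (Rmin (d3 / 2) (Rmin (d4 / 2) (eta / 2)))).
    pose proof (cond_pos d1). pose proof (cond_pos d2).
    assert (0 < t) by (unfold t; repeat apply Rmin_glb_lt; lra).
    assert (t <= d1 / 2 /\ t <= d2 / 2 /\ t <= d3 / 2 /\ t <= d4 / 2 /\ t <= eta / 2)
      as [? [? [? [? ?]]]].
    { unfold t. repeat split.
      - eapply Rle_trans; [apply Rmin_l | apply Rmin_l].
      - eapply Rle_trans; [apply Rmin_l | apply Rmin_r].
      - eapply Rle_trans; [apply Rmin_r | apply Rmin_l].
      - eapply Rle_trans; [apply Rmin_r|]. eapply Rle_trans; [apply Rmin_r | apply Rmin_l].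
      - eapply Rle_trans; [apply Rmin_r|]. eapply Rle_trans; [apply Rmin_r | apply Rmin_r]. }
    exists t. split; [lra|].
    assert (ht : t <> 0) by lra.
    assert (at' : Rabs t = t) by (apply Rabs_pos_eq; lra).
    specialize (hd1 t ht). specialize (hd2 t ht). rewrite at' in hd1, hd2.
    rewrite Rplus_0_l in hd1, hd2. rewrite hN0, !Rminus_0_r in hd1.
    rewrite h1, Rminus_0_r in hd2.
    assert (q1 : Rabs (N t / t) < e / 8) by (apply hd1; lra).
    assert (q2 : Rabs (w t / t - w' 0) < w' 0 / 2) by (apply hd2; lra).
    specialize (h3' t). specialize (h4 t). rewrite Rminus_0_r, at' in h3', h4.
    assert (q3 : Rabs (w' t - w' 0) < w' 0) by (apply h3'; lra).
    assert (q4 : Rabs (P t - P 0) < e / 2) by (apply h4; lra).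
    rewrite P_0 in q4.
    apply Rabs_lt_between in q1, q2, q3, q4.
    unfold J.
    assert (hw : 0 < w t / t) by lra.
    (* The factors are at most [2 * w' 0], [e / 8] and the inverse of [w' 0 / 2] in absolute value,
       with product [e / 2]. *)
    replace (w' t / w t * N t) with (w' t * (N t / t) * / (w t / t)).
    2: { assert (w t <> 0) by (intros hz; rewrite hz in hw; unfold Rdiv in hw; lra).
         field. auto. }
    assert (hb : w' t * (N t / t) <= 2 * w' 0 * (e / 8)).
    { apply Rle_trans with (Rabs (w' t * (N t / t))); [apply Rle_abs|].
      rewrite Rabs_mult. apply Rmult_le_compat; auto using Rabs_pos; apply Rabs_le; lra. }
    assert (hb' : w' t * (N t / t) * / (w t / t) <= e / 2).
    { apply Rmult_le_reg_r with (w t / t); auto.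
      rewrite Rmult_assoc, Rinv_l, Rmult_1_r by lra.
      assert (e / 2 * (w' 0 / 2) <= e / 2 * (w t / t)) by (apply Rmult_le_compat_l; lra).
      lra. }
    lra.
Qed.

Lemma J_nonneg t : 0 < t <= T -> 0 <= J t.
Proof.
  intros ht. apply Rnot_lt_le; intros hn.
  destruct (J_start (- J t) t) as [s [hs hs']]; [lra | lra |].
  pose proof (J_nondecreasing s t). lra.
Qed.

(** At the boundary [J T = (L - L1) * N T <= 0], while [J] is nonnegative and nondecreasing. So [J]
    vanishes identically, [N / w ^ 2] is constant, and its value at [T] is 0. The core [t = 0],
    where [w] may vanish, is reached by continuity. *)
Lemma vanishing_of_comparison : forall t x, 0 <= t <= T -> g t x = 0.
Proof.
  pose proof PI_RGT_0.
  assert (hT : 0 < T <= T) by lra.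
  pose proof (J_nonneg T hT) as hJT. pose proof (w_pos T hT) as hwT.
  assert (hNT : 0 <= N T) by (apply RInt_nonneg; [lra | intros; cont | intros; apply pow2_ge_0]).
  assert (eJ : J T = (L - L1) * N T).
  { unfold J. rewrite bc_w. replace (L1 * w T / w T) with L1 by (field; lra).
    unfold P. rewrite (RInt_Rext _ (fun x => L * g T x ^ 2)) by auto.
    rewrite RInt_Rscal by (intros; cont). unfold N. eq_R. ring. }
  assert (eNT : N T = 0) by nra.
  assert (eN : forall t, 0 < t <= T -> N t = 0).
  { intros t ht. pose proof (w_pos t ht) as hwt.
    assert (e : N t / w t ^ 2 = N T / w T ^ 2).
    { apply (constant_of_deriv (fun t => N t / w t ^ 2) (fun t => 2 * J t / w t ^ 2)); [lra| |].
      - intros x hx. assert (0 < w x) by (apply w_pos; lra).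
        eapply is_derive_eq.
        + apply (is_derive_div N (fun t => w t ^ 2)); [apply is_derive_N | | nra].
          apply is_derive_sqr, dw.
        + unfold J. field. lra.
      - intros x hx. assert (hx' : 0 < x <= T) by lra.
        pose proof (J_nonneg x hx'). pose proof (J_nondecreasing x T).
        replace (J x) with 0 by nra. unfold Rdiv. ring. }
    rewrite eNT in e. unfold Rdiv in e. rewrite Rmult_0_l in e.
    apply Rmult_integral in e. destruct e as [e|e]; auto.
    exfalso. apply (Rinv_neq_0_compat (w t ^ 2)); auto. apply pow_nonzero; lra. }
  assert (eg : forall t x, 0 < t <= T -> g t x = 0).
  { intros t x ht.
    assert (e : g t x ^ 2 = 0).
    { apply (zero_of_RInt_periodic (fun x => g t x ^ 2) PI).
      - lra.
      - intros; cont.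
      - intros; apply periodic; lra.
      - intros; apply pow2_ge_0.
      - exact (eN t ht). }
    nra. }
  intros t x ht. destruct (Req_dec t 0) as [->|]; [|apply eg; lra].
  apply NNPP; intros hn.
  destruct (continuity_near (fun s => g s x) 0 (Rabs (g 0 x))) as [d [hd h]].
  - eapply is_derive_continuity_pt, (C2_t _ _ _ _ _ reg).
  - now apply Rabs_pos_lt.
  - set (s := Rmin (d / 2) T).
    assert (0 < s) by (apply Rmin_glb_lt; lra).
    assert (s <= d / 2) by apply Rmin_l. assert (s <= T) by apply Rmin_r.
    assert (hs : Rabs (s - 0) < d) by (rewrite Rminus_0_r, Rabs_pos_eq; lra).
    specialize (h s hs). rewrite eg in h by lra.
    rewrite Rminus_0_l, Rabs_Ropp in h. lra.
Qed.

End Comparison.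

(** * Eigenfunctions below the eigenvalue of the profile *)

Lemma smooth_d_t (f : R -> R -> R) : smooth f -> smooth (d_t f).
Proof. intros h n t x. destruct (h (S n) t x) as [_ [_ [_ [h' _]]]]. exact h'. Qed.

Lemma smooth_d_th (f : R -> R -> R) : smooth f -> smooth (d_th f).
Proof. intros h n t x. destruct (h (S n) t x) as [_ [_ [_ [_ h']]]]. exact h'. Qed.

Lemma smooth_continuity_2d (f : R -> R -> R) (t x : R) : smooth f -> continuity_2d_pt f t x.
Proof. intros h. exact (proj1 (h 0%nat t x)). Qed.

Lemma smooth_is_derive_t (f : R -> R -> R) (t x : R) :
  smooth f -> is_derive (fun s => f s x) t (d_t f t x).
Proof. intros h. apply Derive_correct, (h 1%nat t x). Qed.

Lemma smooth_is_derive_th (f : R -> R -> R) (t x : R) :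
  smooth f -> is_derive (fun y => f t y) x (d_th f t x).
Proof. intros h. apply Derive_correct, (h 1%nat t x). Qed.

Lemma C2_of_smooth (f : R -> R -> R) :
  smooth f -> C2 f (d_t f) (d_th f) (d_t (d_t f)) (d_th (d_th f)).
Proof.
  intros h. split; intros;
    auto using smooth_d_t, smooth_d_th, smooth_continuity_2d, smooth_is_derive_t,
      smooth_is_derive_th.
Qed.

Lemma continuity_2d_shift (f : R -> R -> R) (c x y : R) :
  continuity_2d_pt f x (y + c) -> continuity_2d_pt (fun u v => f u (v + c)) x y.
Proof.
  intros h eps. destruct (h eps) as [d hd]. exists d. intros u v hu hv.
  apply hd; auto. now replace (v + c - (y + c)) with (v - y) by ring.
Qed.

Lemma is_derive_shift (f : R -> R) (c x l : R) :
  is_derive f (x + c) l -> is_derive (fun x => f (x + c)) x l.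
Proof.
  intros h. eapply is_derive_eq.
  - apply (is_derive_Rcomp f (fun x => x + c) x l 1 h). auto_derive; auto.
  - ring.
Qed.

Lemma C2_shift (g gt gh gtt ghh : R -> R -> R) (c : R) : C2 g gt gh gtt ghh ->
  C2 (fun t x => g t (x + c)) (fun t x => gt t (x + c)) (fun t x => gh t (x + c))
    (fun t x => gtt t (x + c)) (fun t x => ghh t (x + c)).
Proof.
  intros []. split; intros; auto using continuity_2d_shift.
  - apply (is_derive_shift (fun y => g t y)); auto.
  - apply (is_derive_shift (fun y => gh t y)); auto.
Qed.

Lemma C2_lin (g gt gh gtt ghh k kt kh ktt khh : R -> R -> R) (c : R) :
  C2 g gt gh gtt ghh -> C2 k kt kh ktt khh ->
  C2 (fun t x => g t x + c * k t x) (fun t x => gt t x + c * kt t x)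
    (fun t x => gh t x + c * kh t x) (fun t x => gtt t x + c * ktt t x)
    (fun t x => ghh t x + c * khh t x).
Proof.
  assert (hd : forall (u w : R -> R) x l n, is_derive u x l -> is_derive w x n ->
    is_derive (fun x => u x + c * w x) x (l + c * n)).
  { intros u w x l n hu hw. apply is_derive_Rplus; auto. now apply (is_derive_scal w). }
  assert (hc : forall u w x y, continuity_2d_pt u x y -> continuity_2d_pt w x y ->
    continuity_2d_pt (fun x y => u x y + c * w x y) x y).
  { intros u w x y hu hw. apply continuity_2d_pt_plus; auto.
    apply continuity_2d_pt_mult; auto. apply continuity_2d_pt_const. }
  intros [] []. split; intros t x; auto.
Qed.

Lemma continuity_2d_radial (f : R -> R) (t x : R) :
  (forall t, continuity_pt f t) -> continuity_2d_pt (fun u _ => f u) t x.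
Proof.
  intros h. apply (continuity_1d_2d_pt_comp f (fun u _ => u)); auto.
  apply continuity_2d_pt_id1.
Qed.

Lemma C2_radial (f f' f'' : R -> R) :
  (forall t, is_derive f t (f' t)) -> (forall t, is_derive f' t (f'' t)) ->
  (forall t, continuity_pt f'' t) ->
  C2 (fun t _ => f t) (fun t _ => f' t) (fun _ _ => 0) (fun t _ => f'' t) (fun _ _ => 0).
Proof.
  intros h h' hc. split; intros; auto using is_derive_Rconst, continuity_2d_pt_const.
  - apply continuity_2d_radial. intros; eapply is_derive_continuity_pt; auto.
  - apply continuity_2d_radial. intros; eapply is_derive_continuity_pt; auto.
  - apply continuity_2d_radial. auto.
Qed.

Lemma even_deriv_0 (f : R -> R) (l : R) :
  (forall t, f (- t) = f t) -> is_derive f 0 l -> l = 0.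
Proof.
  intros he hd.
  assert (h : is_derive f 0 (-1 * l)).
  { apply (is_derive_ext (fun t => f (- t))); [exact he|].
    apply (is_derive_Rcomp f (fun t => - t)); [now rewrite Ropp_0 | auto_derive; auto]. }
  apply is_derive_unique in hd, h. rewrite hd in h. lra.
Qed.

Section Spectrum.

Variables (r T : R) (p a b dp da db : R -> R).
Hypothesis hr : 0 < r < PI / 2.
Hypothesis prof : profile r T p a b dp da db.

Let m t := a t ^ 2 + 4 * b t ^ 2.
(** The eigenvalues [- tan r] and [cot r], rescaled by [sqrt (m T)] because the conormal derivative
    is [d_t / sqrt (m T)]. *)
Let L0 := - (sin r / cos r) * sqrt (m T).
Let L1 := cos r / sin r * sqrt (m T).

Lemma p_pos t : 0 <= t <= T -> 0 < p t.
Proof.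
  intros ht. apply Rlt_le_trans with (cos r); [apply cos_gt_0; lra|].
  apply (p_cap _ _ _ _ _ _ _ _ prof). rewrite Rabs_pos_eq; lra.
Qed.

Section Function.

Variable f : R -> R -> R.
Hypothesis f_smooth : smooth_function T f.
Hypothesis f_pde : forall t x, in_strip T t ->
  d_t (d_t f) t x + d_th (d_th f) t x + 2 * m t * f t x = 0.

Lemma f_2PI t x : 0 <= t <= T -> f t (x + PI + PI) = f t x.
Proof.
  intros ht. destruct f_smooth as [_ h].
  assert (h1 : in_strip T t) by (unfold in_strip; rewrite Rabs_pos_eq; lra).
  assert (h2 : in_strip T (- t)) by (unfold in_strip; rewrite Rabs_Ropp; exact h1).
  rewrite <- (h t x h1), <- (h (- t) (x + PI) h2). now rewrite Ropp_involutive.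
Qed.

Lemma d_th_f_2PI t x : 0 <= t <= T -> d_th f t (x + PI + PI) = d_th f t x.
Proof.
  intros ht. symmetry. apply is_derive_unique.
  apply (is_derive_ext (fun y => f t (y + (PI + PI)))).
  - intros y. rewrite <- (f_2PI t y ht). now rewrite Rplus_assoc.
  - apply (is_derive_shift (fun y => f t y)). rewrite <- Rplus_assoc.
    apply smooth_is_derive_th, f_smooth.
Qed.

Lemma f_core x : f 0 (x + PI) = f 0 x.
Proof.
  destruct f_smooth as [_ h]. rewrite <- (h 0 x), Ropp_0; auto.
  unfold in_strip. rewrite Rabs_R0. left; apply (T_pos _ _ _ _ _ _ _ _ prof).
Qed.

(** Differentiating the invariance under [iota] across the core reverses the sign of [t]. The
    invariance is only known in the strip, which is a neighbourhood of [t = 0]. *)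
Lemma d_t_f_core x : d_t f 0 (x + PI) = - d_t f 0 x.
Proof.
  destruct f_smooth as [hs h].
  assert (e : d_t f 0 x = - 1 * d_t f 0 (x + PI)); [|lra].
  apply is_derive_unique.
  apply (is_derive_ext_loc (fun t => f (- t) (x + PI))).
  - exists (mkposreal T (T_pos _ _ _ _ _ _ _ _ prof)). intros y hy.
    apply h. unfold in_strip. assert (hy' : Rabs (y - 0) < T) by exact hy.
    rewrite Rminus_0_r in hy'. lra.
  - apply (is_derive_Rcomp (fun t => f t (x + PI)) (fun t => - t)).
    + rewrite Ropp_0. apply smooth_is_derive_t, hs.
    + auto_derive; auto.
Qed.

Variable L : R.
Hypothesis L_lt : L < L1.
(** The alternative of vanishing boundary values lets the same argument rule out Dirichlet
    eigenfunctions. *)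
Hypothesis bc : (forall x, d_t f T x = L * f T x) \/ (forall x, f T x = 0).

(** Twice the antiperiodic part is compared with [a], with [k = 1]; invariance under [iota] makes it
    vanish on the core. *)
Lemma odd_part_vanishes t x : 0 <= t <= T -> f t x + - 1 * f t (x + PI) = 0.
Proof.
  pose proof PI_RGT_0.
  assert (reg := C2_of_smooth f (proj1 f_smooth)).
  apply (vanishing_of_comparison _ _ _ _ _ a da m 1 T L L1
    (C2_lin _ _ _ _ _ _ _ _ _ _ (- 1) reg (C2_shift _ _ _ _ _ PI reg))).
  - apply prof.
  - intros s y hs.
    assert (hs' : in_strip T s) by (unfold in_strip; rewrite Rabs_pos_eq; lra).
    pose proof (f_pde s y hs'). pose proof (f_pde s (y + PI) hs'). lra.
  - apply prof.
  - apply prof.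
  - apply prof.
  - intros s hs. pose proof (f_2PI s 0 hs) as e1. pose proof (d_th_f_2PI s 0 hs) as e2.
    rewrite Rplus_0_l in e1, e2. rewrite e1, e2, Rplus_0_l. ring.
  - intros s hs. rewrite Rmult_1_l. apply wirtinger_antiperiodic.
    + intros y. apply (C2_h _ _ _ _ _ (C2_lin _ _ _ _ _ _ _ _ _ _ (- 1) reg
        (C2_shift _ _ _ _ _ PI reg)) s y).
    + intros y. apply (continuous_2d_r (fun t x => d_th f t x + - 1 * d_th f t (x + PI))).
      apply (C2_ch _ _ _ _ _ (C2_lin _ _ _ _ _ _ _ _ _ _ (- 1) reg
        (C2_shift _ _ _ _ _ PI reg)) s y).
    + intros y. rewrite f_2PI by auto. ring.
    + intros y. rewrite d_th_f_2PI by auto. ring.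
  - right. split; [|split].
    + pose proof (a_odd _ _ _ _ _ _ _ _ prof 0) as e. rewrite Ropp_0 in e. lra.
    + apply prof.
    + intros y. rewrite f_core. ring.
  - apply prof.
  - intros y. destruct bc as [h | h]; rewrite !h; ring.
  - exact L_lt.
  - intros s y hs. rewrite f_2PI by auto. ring.
Qed.

(** Twice the [PI]-periodic part of [f]; [M] below is its integral over a circle. *)
Let ge t x := f t x + 1 * f t (x + PI).
Let ge_t t x := d_t f t x + 1 * d_t f t (x + PI).
Let ge_h t x := d_th f t x + 1 * d_th f t (x + PI).
Let ge_tt t x := d_t (d_t f) t x + 1 * d_t (d_t f) t (x + PI).
Let ge_hh t x := d_th (d_th f) t x + 1 * d_th (d_th f) t (x + PI).
Let M (t : R) : R := RInt (ge t) 0 PI.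
Let M1 (t : R) : R := RInt (ge_t t) 0 PI.

Lemma C2_ge : C2 ge ge_t ge_h ge_tt ge_hh.
Proof.
  assert (reg := C2_of_smooth f (proj1 f_smooth)).
  exact (C2_lin _ _ _ _ _ _ _ _ _ _ 1 reg (C2_shift _ _ _ _ _ PI reg)).
Qed.

Lemma ge_pde t x : 0 <= t <= T -> ge_tt t x + ge_hh t x + 2 * m t * ge t x = 0.
Proof.
  intros ht. assert (hs : in_strip T t) by (unfold in_strip; rewrite Rabs_pos_eq; lra).
  pose proof (f_pde t x hs). pose proof (f_pde t (x + PI) hs).
  unfold ge_tt, ge_hh, ge. lra.
Qed.

Lemma ge_periodic t x : 0 <= t <= T -> ge t (x + PI) = ge t x.
Proof. intros ht. unfold ge. rewrite f_2PI by auto. ring. Qed.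

Lemma ge_h_periodic t x : 0 <= t <= T -> ge_h t (x + PI) = ge_h t x.
Proof. intros ht. unfold ge_h. rewrite d_th_f_2PI by auto. ring. Qed.

Lemma ge_t_0 x : ge_t 0 x = 0.
Proof. unfold ge_t. rewrite d_t_f_core. ring. Qed.

Lemma is_derive_M t : is_derive M t (M1 t).
Proof. apply (is_derive_RInt_parameter ge ge_t); apply C2_ge. Qed.

Lemma is_derive_M1 t : 0 <= t <= T -> is_derive M1 t (- 2 * m t * M t).
Proof.
  intros ht.
  assert (cg : forall x, continuous (ge t) x).
  { intros x. apply (continuous_2d_r ge), C2_ge. }
  assert (ch : forall x, continuous (ge_hh t) x).
  { intros x. apply (continuous_2d_r ge_hh), C2_ge. }
  eapply is_derive_eq; [apply (is_derive_RInt_parameter ge_t ge_tt); apply C2_ge|].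
  rewrite (RInt_Rext _ (fun x => - 1 * ge_hh t x + - 2 * m t * ge t x)).
  - rewrite RInt_Rplus, (RInt_Rscal (ge_hh t)), (RInt_Rscal (ge t)); auto;
      try (intros; apply continuous_Rmult; [apply continuous_Rconst | auto]).
    rewrite (RInt_deriv (ge_h t) (ge_hh t)); auto.
    + rewrite <- (Rplus_0_l PI) at 1. rewrite ge_h_periodic by auto. unfold M. eq_R. ring.
    + intros x. apply (C2_hh _ _ _ _ _ C2_ge).
  - intros x. pose proof (ge_pde t x ht). lra.
Qed.

(** Integration over the circle gives [M] the equation of [p]. Their Wronskian is 0 at the core,
    where both [t]-derivatives vanish, so [M / p] is constant; [p >= cos r > 0] permits the
    division. *)
Lemma mean_radial t : 0 <= t <= T -> p t * M1 t = dp t * M t /\ M t = M T / p T * p t.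
Proof.
  assert (hW : forall t, 0 <= t <= T -> p t * M1 t - dp t * M t = 0).
  { intros s hs.
    transitivity (p 0 * M1 0 - dp 0 * M 0).
    - symmetry.
      apply (constant_of_deriv (fun t => p t * M1 t - dp t * M t)
        (fun t => dp t * M1 t + p t * (- 2 * m t * M t)
          - ((- 2 * (a t ^ 2 + 4 * b t ^ 2) * p t) * M t + dp t * M1 t))); [lra| |].
      + intros x hx. apply is_derive_Rminus; apply is_derive_Rmult.
        * apply prof.
        * apply is_derive_M1; lra.
        * apply prof.
        * apply is_derive_M.
      + intros x hx. unfold m. ring.
    - rewrite (even_deriv_0 p (dp 0)); [|apply prof|apply prof].
      unfold M1. rewrite (RInt_Rext _ (fun _ => 0)) by apply ge_t_0.
      rewrite RInt_Rconst. eq_R. ring. }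
  intros ht. specialize (hW t ht) as hWt. split; [lra|].
  pose proof (p_pos t ht). assert (hT : 0 <= T <= T) by lra. pose proof (p_pos T hT).
  assert (e : M t / p t = M T / p T).
  { apply (constant_of_deriv (fun t => M t / p t) (fun t => (p t * M1 t - dp t * M t) / p t ^ 2));
      [lra| |].
    - intros x hx. assert (hx' : 0 <= x <= T) by lra. pose proof (p_pos x hx').
      eapply is_derive_eq.
      + apply (is_derive_div M p); [apply is_derive_M | apply prof | lra].
      + field; lra.
    - intros x hx. rewrite hW by lra. unfold Rdiv; ring. }
  rewrite <- e. field; lra.
Qed.

Lemma L0_spec : dp T = L0 * p T.
Proof.
  rewrite (dp_T _ _ _ _ _ _ _ _ prof), (p_T _ _ _ _ _ _ _ _ prof).
  assert (0 < cos r) by (apply cos_gt_0; lra). unfold L0, m. field; lra.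
Qed.

(** By [mean_radial] the mean of [ge t] over [[0, PI]] is [kappa * p t]. *)
Let kappa := M T / (PI * p T).

Lemma kappa_spec : (L - L0) * kappa = 0 /\ ((forall x, f T x = 0) -> kappa = 0).
Proof.
  pose proof PI_RGT_0. pose proof (T_pos _ _ _ _ _ _ _ _ prof).
  assert (hT : 0 <= T <= T) by lra. pose proof (p_pos T hT).
  assert (hB : (forall x, f T x = 0) -> kappa = 0).
  { intros h. unfold kappa, M. rewrite (RInt_Rext _ (fun _ => 0)).
    - rewrite RInt_Rconst. unfold Rdiv. eq_R. ring.
    - intros x. unfold ge. rewrite !h. ring. }
  split; auto. destruct bc as [h | h]; [|rewrite hB by auto; ring].
  assert (e : M1 T = L * M T).
  { unfold M1, M. rewrite <- RInt_Rscal.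
    - apply RInt_Rext. intros x. unfold ge_t, ge. rewrite !h. ring.
    - intros x. apply (continuous_2d_r ge), C2_ge. }
  destruct (mean_radial T hT) as [e' _]. rewrite e, L0_spec in e'.
  assert (e2 : (L - L0) * M T = 0).
  { apply Rmult_eq_reg_l with (p T); [|lra]. lra. }
  unfold kappa. replace ((L - L0) * (M T / (PI * p T))) with ((L - L0) * M T / (PI * p T))
    by (field; lra).
  rewrite e2. unfold Rdiv; ring.
Qed.

Lemma even_part_radial t x : 0 <= t <= T -> ge t x + - kappa * p t = 0.
Proof.
  pose proof PI_RGT_0. pose proof (T_pos _ _ _ _ _ _ _ _ prof).
  assert (hT : 0 <= T <= T) by lra. pose proof (p_pos T hT).
  assert (hp := C2_radial p dp (fun t => - 2 * m t * p t)
    (der_p _ _ _ _ _ _ _ _ prof) (der_dp _ _ _ _ _ _ _ _ prof)).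
  assert (cp : forall t, continuity_pt (fun t => - 2 * m t * p t) t).
  { assert (ca : forall t, continuity_pt a t)
      by (intros t'; exact (is_derive_continuity_pt _ _ _ (der_a _ _ _ _ _ _ _ _ prof t'))).
    assert (cb : forall t, continuity_pt b t)
      by (intros t'; exact (is_derive_continuity_pt _ _ _ (der_b _ _ _ _ _ _ _ _ prof t'))).
    assert (cp : forall t, continuity_pt p t)
      by (intros t'; exact (is_derive_continuity_pt _ _ _ (der_p _ _ _ _ _ _ _ _ prof t'))).
    intros s. unfold m. simpl.
    repeat first [ apply ca | apply cb | apply cp | apply continuity_pt_mult
      | apply continuity_pt_plus | (apply continuity_pt_const; intros ? ?; reflexivity) ]. }
  assert (reg := C2_lin _ _ _ _ _ _ _ _ _ _ (- kappa) C2_ge (hp cp)).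
  destruct kappa_spec as [k1 k2].
  apply (vanishing_of_comparison _ _ _ _ _ b db m 4 T L L1 reg).
  - apply prof.
  - intros s y hs. pose proof (ge_pde s y hs). lra.
  - apply prof.
  - apply prof.
  - intros s hs. apply (b_pos _ _ _ _ _ _ _ _ prof). lra.
  - intros s hs. rewrite <- (Rplus_0_l PI). rewrite ge_periodic, ge_h_periodic by auto. ring.
  - intros s hs. apply wirtinger_periodic.
    + intros y. apply (C2_h _ _ _ _ _ reg s y).
    + intros y. apply (continuous_2d_r (fun t x => ge_h t x + - kappa * 0)).
      apply (C2_ch _ _ _ _ _ reg s y).
    + intros y. rewrite ge_periodic by auto. ring.
    + intros y. rewrite ge_h_periodic by auto. ring.
    + rewrite RInt_Rplus.
      * rewrite RInt_Rconst. fold (M s). destruct (mean_radial s hs) as [_ e].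
        rewrite e. unfold kappa. eq_R. field. lra.
      * intros y. apply (continuous_2d_r ge), C2_ge.
      * intros; apply continuous_Rconst.
  - left. split; [|split].
    + apply (b_pos _ _ _ _ _ _ _ _ prof). lra.
    + apply (even_deriv_0 b); apply prof.
    + intros y. rewrite ge_t_0, (even_deriv_0 p (dp 0)); [ring | apply prof | apply prof].
  - apply prof.
  - intros y. destruct bc as [h | h].
    (* [kappa * p] has boundary slope [L0], which may be replaced by [L] because
       [(L - L0) * kappa = 0]. *)
    + rewrite L0_spec. unfold ge_t, ge. rewrite !h.
      replace (L * f T y + 1 * (L * f T (y + PI)) + - kappa * (L0 * p T)) with
        (L * (f T y + 1 * f T (y + PI) + - kappa * p T) + (L - L0) * kappa * p T) by ring.
      rewrite k1. ring.
    + rewrite k2 by auto. unfold ge. rewrite !h. ring.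
  - exact L_lt.
  - intros s y hs. rewrite ge_periodic by auto. reflexivity.
Qed.

Lemma radial_of_eigenfunction : exists c,
  (forall t x, 0 <= t <= T -> f t x = c * p t) /\ (L - L0) * c = 0 /\
  ((forall x, f T x = 0) -> c = 0).
Proof.
  (* Half, because [ge] is twice the periodic part of [f]. *)
  exists (kappa / 2). destruct kappa_spec as [k1 k2]. split; [|split].
  - intros t x ht. pose proof (odd_part_vanishes t x ht). pose proof (even_part_radial t x ht).
    unfold ge in *. lra.
  - lra.
  - intros h. rewrite k2 by auto. lra.
Qed.

End Function.

End Spectrum.

(** * Smoothness *)

Fixpoint Cn (n : nat) (f : R -> R) : Prop :=
  (forall x, continuity_pt f x) /\
  match n with
  | O => True
  | S n => exists f', (forall x, is_derive f x (f' x)) /\ Cn n f'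
  end.

Lemma Cn_continuity (n : nat) (f : R -> R) (x : R) : Cn n f -> continuity_pt f x.
Proof. destruct n; intros [h _]; auto. Qed.

Lemma Cn_succ (n : nat) (f f' : R -> R) :
  (forall x, is_derive f x (f' x)) -> Cn n f' -> Cn (S n) f.
Proof.
  intros hd hc. split; [|now exists f'].
  intros x; exact (is_derive_continuity_pt _ _ _ (hd x)).
Qed.

Lemma Cn_pred (n : nat) (f : R -> R) : Cn (S n) f -> Cn n f.
Proof.
  revert f; induction n as [|n IH]; intros f [hc [f' [hd hf]]].
  - now split.
  - apply (Cn_succ n f f'); auto.
Qed.

Lemma Cn_const (n : nat) (c : R) : Cn n (fun _ => c).
Proof.
  revert c; induction n as [|n IH]; intros c.
  - split; auto. intros x. apply continuity_pt_const. intros ? ?; reflexivity.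
  - apply (Cn_succ n _ (fun _ => 0)); auto. intros; apply is_derive_Rconst.
Qed.

Lemma Cn_plus (n : nat) (f g : R -> R) : Cn n f -> Cn n g -> Cn n (fun x => f x + g x).
Proof.
  revert f g; induction n as [|n IH]; intros f g hf hg.
  - split; auto. intros x. apply continuity_pt_plus; [apply hf | apply hg].
  - destruct hf as [_ [f' [df hf]]], hg as [_ [g' [dg hg]]].
    apply (Cn_succ n _ (fun x => f' x + g' x)); auto.
    intros; apply is_derive_Rplus; auto.
Qed.

Lemma Cn_mult (n : nat) (f g : R -> R) : Cn n f -> Cn n g -> Cn n (fun x => f x * g x).
Proof.
  revert f g; induction n as [|n IH]; intros f g hf hg.
  - split; auto. intros x. apply continuity_pt_mult; [apply hf | apply hg].
  - assert (hf1 := Cn_pred n f hf). assert (hg1 := Cn_pred n g hg).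
    destruct hf as [_ [f' [df hf]]], hg as [_ [g' [dg hg]]].
    apply (Cn_succ n _ (fun x => f' x * g x + f x * g' x)).
    + intros; apply is_derive_Rmult; auto.
    + apply Cn_plus; auto.
Qed.

Lemma Cn_cos_sin (n : nat) (k : R) : Cn n (fun x => cos (k * x)) /\ Cn n (fun x => sin (k * x)).
Proof.
  assert (dc : forall x, is_derive (fun x => cos (k * x)) x (- k * sin (k * x)))
    by (intros x; auto_derive; auto; ring).
  assert (ds : forall x, is_derive (fun x => sin (k * x)) x (k * cos (k * x)))
    by (intros x; auto_derive; auto; ring).
  induction n as [|n [h1 h2]].
  - split; (split; auto); intros x; [exact (is_derive_continuity_pt _ _ _ (dc x)) |
      exact (is_derive_continuity_pt _ _ _ (ds x))].
  - split; [apply (Cn_succ n _ (fun x => - k * sin (k * x))) |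
      apply (Cn_succ n _ (fun x => k * cos (k * x)))]; auto; apply Cn_mult; auto using Cn_const.
Qed.

(** Both partial derivatives of a product of a radial and an angular function are again of this
    form, which makes the induction close. *)
Lemma ex_diff_n_product (n : nat) (f g : R -> R) (t x : R) :
  Cn n f -> Cn n g -> ex_diff_n (fun t x => f t * g x) n t x.
Proof.
  revert f g t x; induction n as [|n IH]; intros f g t x hf hg.
  all: assert (hc : continuity_2d_pt (fun t x => f t * g x) t x) by
    (apply continuity_2d_pt_mult;
      [ apply (continuity_1d_2d_pt_comp f (fun u _ => u));
        [eapply Cn_continuity; eauto | apply continuity_2d_pt_id1]
      | apply (continuity_1d_2d_pt_comp g (fun _ v => v));
        [eapply Cn_continuity; eauto | apply continuity_2d_pt_id2] ]).
  - now split.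
  - assert (hf1 := Cn_pred n f hf). assert (hg1 := Cn_pred n g hg).
    destruct hf as [_ [f' [df hf]]], hg as [_ [g' [dg hg]]].
    assert (dt : forall t x, is_derive (fun t => f t * g x) t (f' t * g x)).
    { intros u v. eapply is_derive_eq.
      - exact (is_derive_Rmult _ _ _ _ _ (df u) (is_derive_Rconst (g v) u)).
      - cbv beta; ring. }
    assert (dx : forall t x, is_derive (fun x => f t * g x) x (f t * g' x)).
    { intros u v. apply (is_derive_scal g), dg. }
    split; [exact hc|]. split; [|split; [|split]].
    + exists (f' t * g x). apply dt.
    + exists (f t * g' x). apply dx.
    + replace (fun u v => Derive (fun z => f z * g v) u) with (fun u v => f' u * g v).
      * apply IH; auto.
      * apply functional_extensionality; intros u; apply functional_extensionality; intros v.
        symmetry; apply is_derive_unique, dt.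
    + replace (fun u v => Derive (fun z => f u * g z) v) with (fun u v => f u * g' v).
      * apply IH; auto.
      * apply functional_extensionality; intros u; apply functional_extensionality; intros v.
        symmetry; apply is_derive_unique, dx.
Qed.

(** * The immersion *)

Section Immersion.

Variables (r T : R) (p a b dp da db : R -> R).
Hypothesis hr : 0 < r < PI / 2.
Hypothesis prof : profile r T p a b dp da db.

Let m (t : R) : R := a t ^ 2 + 4 * b t ^ 2.

(** The second derivatives are polynomials in [p], [a], [b], so each order of regularity yields the
    next one. *)
Lemma Cn_profile (n : nat) : (Cn n p /\ Cn n a /\ Cn n b) /\ (Cn n dp /\ Cn n da /\ Cn n db).
Proof.
  induction n as [|n [[hp [ha hb]] [hdp [hda hdb]]]].
  - repeat split; intros x.
    + exact (is_derive_continuity_pt _ _ _ (der_p _ _ _ _ _ _ _ _ prof x)).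
    + exact (is_derive_continuity_pt _ _ _ (der_a _ _ _ _ _ _ _ _ prof x)).
    + exact (is_derive_continuity_pt _ _ _ (der_b _ _ _ _ _ _ _ _ prof x)).
    + exact (is_derive_continuity_pt _ _ _ (der_dp _ _ _ _ _ _ _ _ prof x)).
    + exact (is_derive_continuity_pt _ _ _ (der_da _ _ _ _ _ _ _ _ prof x)).
    + exact (is_derive_continuity_pt _ _ _ (der_db _ _ _ _ _ _ _ _ prof x)).
  - assert (hm : forall c, Cn n (fun t => c + - 2 * (a t * (a t * 1) + 4 * (b t * (b t * 1))))).
    { intros c. repeat first [apply Cn_plus | apply Cn_const | assumption | apply Cn_mult]. }
    split; split; [| split | | split].
    + apply (Cn_succ n p dp); [apply prof | auto].
    + apply (Cn_succ n a da); [apply prof | auto].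
    + apply (Cn_succ n b db); [apply prof | auto].
    + apply (Cn_succ n dp (fun t => (0 + - 2 * (a t * (a t * 1) + 4 * (b t * (b t * 1)))) * p t)).
      * intros t. eapply is_derive_eq; [exact (der_dp _ _ _ _ _ _ _ _ prof t) | ring].
      * apply Cn_mult; auto.
    + apply (Cn_succ n da (fun t => (1 + - 2 * (a t * (a t * 1) + 4 * (b t * (b t * 1)))) * a t)).
      * intros t. eapply is_derive_eq; [exact (der_da _ _ _ _ _ _ _ _ prof t) | ring].
      * apply Cn_mult; auto.
    + apply (Cn_succ n db (fun t => (4 + - 2 * (a t * (a t * 1) + 4 * (b t * (b t * 1)))) * b t)).
      * intros t. eapply is_derive_eq; [exact (der_db _ _ _ _ _ _ _ _ prof t) | ring].
      * apply Cn_mult; auto.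
Qed.

Definition rad (i : nat) : R -> R := match i with 0 => p | 1 | 2 => a | _ => b end.
Definition drad (i : nat) : R -> R := match i with 0 => dp | 1 | 2 => da | _ => db end.
Definition freq2 (i : nat) : R := match i with 0 => 0 | 1 | 2 => 1 | _ => 4 end.
(** The trivial factor in [1 * x] gives all the entries the form [cos (k * x)] or [sin (k * x)] of
    [Cn_cos_sin]. *)
Definition ang (i : nat) (x : R) : R :=
  match i with
  | 0 => 1 | 1 => cos (1 * x) | 2 => sin (1 * x) | 3 => cos (2 * x) | _ => sin (2 * x)
  end.
Definition dang (i : nat) (x : R) : R :=
  match i with
  | 0 => 0 | 1 => - sin (1 * x) | 2 => cos (1 * x)
  | 3 => - 2 * sin (2 * x) | _ => 2 * cos (2 * x)
  end.

Definition profile_map (i : nat) (t x : R) : R := rad i t * ang i x.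
Definition profile_metric : metric := Metric (fun t _ => m t) (fun _ _ => 0) (fun t _ => m t).

Lemma is_derive_rad i t : is_derive (rad i) t (drad i t).
Proof. destruct i as [|[|[|i]]]; apply prof. Qed.

Lemma is_derive_drad i t : is_derive (drad i) t ((freq2 i - 2 * m t) * rad i t).
Proof.
  unfold m.
  destruct i as [|[|[|i]]]; simpl rad; simpl drad; simpl freq2; [|apply prof..].
  eapply is_derive_eq; [exact (der_dp _ _ _ _ _ _ _ _ prof t) | ring].
Qed.

Lemma is_derive_ang i x : is_derive (ang i) x (dang i x).
Proof. destruct i as [|[|[|[|i]]]]; unfold ang, dang; auto_derive; auto; ring. Qed.

Lemma is_derive_dang i x : is_derive (dang i) x (- freq2 i * ang i x).
Proof. destruct i as [|[|[|[|i]]]]; unfold ang, dang, freq2; auto_derive; auto; ring. Qed.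

Lemma d_t_product (f f' h : R -> R) :
  (forall t, is_derive f t (f' t)) ->
  d_t (fun t x => f t * h x) = (fun t x => f' t * h x).
Proof.
  intros hf. apply functional_extensionality; intros t; apply functional_extensionality; intros x.
  apply is_derive_unique. eapply is_derive_eq.
  - exact (is_derive_Rmult _ _ _ _ _ (hf t) (is_derive_Rconst (h x) t)).
  - cbv beta; ring.
Qed.

Lemma d_th_product (f h h' : R -> R) :
  (forall x, is_derive h x (h' x)) ->
  d_th (fun t x => f t * h x) = (fun t x => f t * h' x).
Proof.
  intros hh. apply functional_extensionality; intros t; apply functional_extensionality; intros x.
  apply is_derive_unique. apply (is_derive_scal h), hh.
Qed.

Lemma d_t_Phi i : d_t (profile_map i) = (fun t x => drad i t * ang i x).
Proof. apply d_t_product, is_derive_rad. Qed.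

Lemma d_th_Phi i : d_th (profile_map i) = (fun t x => rad i t * dang i x).
Proof. apply d_th_product, is_derive_ang. Qed.

Lemma d_tt_Phi i : d_t (d_t (profile_map i)) = (fun t x => (freq2 i - 2 * m t) * rad i t * ang i x).
Proof.
  rewrite d_t_Phi. apply (d_t_product _ (fun t => (freq2 i - 2 * m t) * rad i t)).
  apply is_derive_drad.
Qed.

Lemma d_thth_Phi i : d_th (d_th (profile_map i)) = (fun t x => rad i t * (- freq2 i * ang i x)).
Proof.
  rewrite d_th_Phi. apply (d_th_product _ _ (fun x => - freq2 i * ang i x)).
  apply is_derive_dang.
Qed.

Lemma Phi_pde i t x :
  d_t (d_t (profile_map i)) t x + d_th (d_th (profile_map i)) t x = - 2 * m t * profile_map i t x.
Proof. rewrite d_tt_Phi, d_thth_Phi. unfold profile_map. ring. Qed.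

Lemma smooth_Phi i : smooth_function T (profile_map i).
Proof.
  split.
  - intros n t x. apply ex_diff_n_product.
    + destruct (Cn_profile n) as [[hp [ha hb]] _]. destruct i as [|[|[|i]]]; auto.
    + destruct (Cn_cos_sin n 1) as [c1 s1], (Cn_cos_sin n 2) as [c2 s2].
      destruct i as [|[|[|[|i]]]]; [exact (Cn_const n 1) | assumption..].
  - intros t x _. unfold profile_map.
    pose proof (p_even _ _ _ _ _ _ _ _ prof t) as hp.
    pose proof (a_odd _ _ _ _ _ _ _ _ prof t) as ha.
    pose proof (b_even _ _ _ _ _ _ _ _ prof t) as hb.
    assert (e2 : 2 * (x + PI) = 2 * x + 2 * PI) by ring.
    destruct i as [|[|[|[|i]]]]; simpl rad; unfold ang;
      rewrite ?hp, ?ha, ?hb, ?Rmult_1_l, ?neg_cos, ?neg_sin, ?e2, ?cos_2PI, ?sin_2PI.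
    + ring.
    + ring.
    + ring.
    + rewrite cos_plus, cos_2PI, sin_2PI. ring.
    + rewrite sin_plus, cos_2PI, sin_2PI. ring.
Qed.

Lemma m_positive t : 0 < m t.
Proof. apply prof. Qed.

Lemma gdet_g t x : gdet profile_metric t x = m t ^ 2.
Proof. unfold gdet; simpl. ring. Qed.

Lemma sqrt_gdet_g t x : sqrt (gdet profile_metric t x) = m t.
Proof. rewrite gdet_g. apply sqrt_pow2. left; apply m_positive. Qed.

Lemma riemannian_g : riemannian_metric T profile_metric.
Proof.
  assert (hm : smooth (fun t _ : R => m t)).
  { intros n t x.
    replace (fun t _ : R => m t)
      with (fun t _ : R => (a t * (a t * 1) + 4 * (b t * (b t * 1))) * 1).
    - apply (ex_diff_n_product n (fun t => a t * (a t * 1) + 4 * (b t * (b t * 1)))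
        (fun _ => 1)); [|apply Cn_const].
      destruct (Cn_profile n) as [[hp [ha hb]] _].
      repeat first [apply Cn_plus | apply Cn_const | assumption | apply Cn_mult].
    - apply functional_extensionality; intros u; apply functional_extensionality; intros v.
      unfold m. ring. }
  split; [exact hm|]. split.
  - intros n t x.
    replace (gF profile_metric) with (fun _ _ : R => 0 * 0).
    + apply (ex_diff_n_product n (fun _ => 0) (fun _ => 0)); apply Cn_const.
    + apply functional_extensionality; intros u; apply functional_extensionality; intros v.
      simpl. ring.
  - split; [exact hm|]. intros t x _.
    assert (e : m (- t) = m t).
    { unfold m. rewrite (a_odd _ _ _ _ _ _ _ _ prof), (b_even _ _ _ _ _ _ _ _ prof). ring. }
    simpl gE; simpl gF; simpl gG. rewrite e, gdet_g. pose proof (m_positive t).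
    repeat split; auto; try ring. apply pow_lt; auto.
Qed.

(** In dimension 2 the density [sqrt (gdet g)] cancels the inverse of a conformally flat metric,
    leaving the flat Laplacian over [m]. *)
Lemma laplacian_g f t x :
  laplacian profile_metric f t x = (d_t (d_t f) t x + d_th (d_th f) t x) / m t.
Proof.
  unfold laplacian, divergence. rewrite sqrt_gdet_g.
  replace (fun s x => sqrt (gdet profile_metric s x) * grad_t profile_metric f s x) with (d_t f).
  - replace (fun s x => sqrt (gdet profile_metric s x) * grad_th profile_metric f s x)
      with (d_th f); [reflexivity|].
    apply functional_extensionality; intros u; apply functional_extensionality; intros v.
    unfold grad_th, sharp_th. rewrite sqrt_gdet_g, gdet_g. simpl gE; simpl gF.
    pose proof (m_positive u). field; lra.
  - apply functional_extensionality; intros u; apply functional_extensionality; intros v.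
    unfold grad_t, sharp_t. rewrite sqrt_gdet_g, gdet_g. simpl gG; simpl gF.
    pose proof (m_positive u). field; lra.
Qed.

Lemma solves_Phi i : solves_frequency_2 T profile_metric (profile_map i).
Proof.
  split; [apply smooth_Phi|]. intros t x _. rewrite laplacian_g, Phi_pde.
  pose proof (m_positive t). field; lra.
Qed.

Lemma pde_of_solves f t x : solves_frequency_2 T profile_metric f -> in_strip T t ->
  d_t (d_t f) t x + d_th (d_th f) t x + 2 * m t * f t x = 0.
Proof.
  intros [_ h] ht. specialize (h t x ht). rewrite laplacian_g in h.
  pose proof (m_positive t).
  replace (d_t (d_t f) t x + d_th (d_th f) t x + 2 * m t * f t x) with
    (m t * ((d_t (d_t f) t x + d_th (d_th f) t x) / m t + 2 * f t x)) by (field; lra).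
  rewrite h. ring.
Qed.

Lemma sqrt_m_pos t : 0 < sqrt (m t).
Proof. apply sqrt_lt_R0, m_positive. Qed.

Lemma conormal_g f x : conormal_derivative T profile_metric f x = d_t f T x / sqrt (m T).
Proof.
  unfold conormal_derivative, nu_t, nu_th. rewrite gdet_g. simpl gG; simpl gF.
  pose proof (m_positive T). pose proof (sqrt_m_pos T).
  replace (m T / m T ^ 2) with (/ m T) by (field; lra).
  rewrite sqrt_inv. unfold Rdiv. ring.
Qed.

Lemma sin_r_pos : 0 < sin r.
Proof. apply sin_gt_0; lra. Qed.

Lemma cos_r_pos : 0 < cos r.
Proof. apply cos_gt_0; lra. Qed.

Lemma conormal_Phi i x :
  conormal_derivative T profile_metric (profile_map i) x =
  match i with 0 => - (sin r / cos r) | _ => cos r / sin r end * profile_map i T x.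
Proof.
  rewrite conormal_g, d_t_Phi. unfold profile_map. pose proof (sqrt_m_pos T) as hm.
  pose proof sin_r_pos. pose proof cos_r_pos.
  destruct i as [|[|[|i]]]; simpl rad; simpl drad.
  - rewrite (dp_T _ _ _ _ _ _ _ _ prof), (p_T _ _ _ _ _ _ _ _ prof). fold (m T).
    field; lra.
  - rewrite (da_T _ _ _ _ _ _ _ _ prof). fold (m T). field; lra.
  - rewrite (da_T _ _ _ _ _ _ _ _ prof). fold (m T). field; lra.
  - rewrite (db_T _ _ _ _ _ _ _ _ prof). fold (m T). field; lra.
Qed.

Lemma dot_4 (x y : nat -> R) :
  dot 4 x y = x 0%nat * y 0%nat + x 1%nat * y 1%nat + x 2%nat * y 2%nat
    + x 3%nat * y 3%nat + x 4%nat * y 4%nat.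
Proof. reflexivity. Qed.

Lemma dot_Phi_Phi t x : dot 4 (at_pt profile_map t x) (at_pt profile_map t x) = 1.
Proof.
  rewrite dot_4. unfold at_pt, profile_map; simpl rad; unfold ang.
  pose proof (sphere _ _ _ _ _ _ _ _ prof t).
  transitivity (p t ^ 2 + a t ^ 2 * (sin (1 * x) ^ 2 + cos (1 * x) ^ 2)
    + b t ^ 2 * (sin (2 * x) ^ 2 + cos (2 * x) ^ 2)); [ring|].
  rewrite !sin_sqr. lra.
Qed.

Lemma dot_Phi_t_Phi_t t x : dot 4 (Phi_t profile_map t x) (Phi_t profile_map t x) = m t.
Proof.
  rewrite dot_4. unfold Phi_t. rewrite !d_t_Phi; simpl drad; unfold ang.
  unfold m. rewrite <- (conformal _ _ _ _ _ _ _ _ prof t).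
  transitivity (dp t ^ 2 + da t ^ 2 * (sin (1 * x) ^ 2 + cos (1 * x) ^ 2)
    + db t ^ 2 * (sin (2 * x) ^ 2 + cos (2 * x) ^ 2)); [ring|].
  rewrite !sin_sqr. ring.
Qed.

Lemma dot_Phi_t_Phi_th t x : dot 4 (Phi_t profile_map t x) (Phi_th profile_map t x) = 0.
Proof.
  rewrite dot_4. unfold Phi_t, Phi_th. rewrite !d_t_Phi, !d_th_Phi.
  simpl drad; simpl rad; unfold ang, dang. ring.
Qed.

Lemma dot_Phi_th_Phi_th t x : dot 4 (Phi_th profile_map t x) (Phi_th profile_map t x) = m t.
Proof.
  rewrite dot_4. unfold Phi_th. rewrite !d_th_Phi. simpl rad; unfold dang, m.
  transitivity (a t ^ 2 * (sin (1 * x) ^ 2 + cos (1 * x) ^ 2)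
    + 4 * b t ^ 2 * (sin (2 * x) ^ 2 + cos (2 * x) ^ 2)); [ring|].
  rewrite !sin_sqr. ring.
Qed.

Lemma dot_Phi_Phi_th t x : dot 4 (at_pt profile_map t x) (Phi_th profile_map t x) = 0.
Proof.
  rewrite dot_4. unfold at_pt, Phi_th. rewrite !d_th_Phi. unfold profile_map.
  simpl rad; unfold ang, dang. ring.
Qed.

Lemma dot_Phi_Phi_t t x : dot 4 (at_pt profile_map t x) (Phi_t profile_map t x) = 0.
Proof.
  assert (h : p t * dp t + a t * da t + b t * db t = 0).
  { assert (hd : is_derive (fun t => p t ^ 2 + a t ^ 2 + b t ^ 2) t
      (2 * p t * dp t + 2 * a t * da t + 2 * b t * db t))
      by (repeat apply is_derive_Rplus; apply is_derive_sqr; apply prof).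
    assert (hc : is_derive (fun t => p t ^ 2 + a t ^ 2 + b t ^ 2) t 0).
    { apply (is_derive_ext (fun _ => 1)); [|apply is_derive_Rconst].
      intros s; symmetry; apply prof. }
    apply is_derive_unique in hd, hc. rewrite hd in hc. lra. }
  rewrite dot_4. unfold at_pt, Phi_t. rewrite !d_t_Phi. unfold profile_map.
  simpl rad; simpl drad; unfold ang.
  transitivity (p t * dp t + a t * da t * (sin (1 * x) ^ 2 + cos (1 * x) ^ 2)
    + b t * db t * (sin (2 * x) ^ 2 + cos (2 * x) ^ 2)); [ring|].
  rewrite !sin_sqr, <- h. ring.
Qed.

(** In conformal coordinates the trace is the normal part of [Phi_tt + Phi_thth = - 2 * m * Phi],
    and a multiple of the position vector has no normal part in the sphere. *)
Lemma mean_curvature_Phi t x i : mean_curvature 4 profile_metric profile_map t x i = 0.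
Proof.
  unfold mean_curvature. rewrite gdet_g. simpl gE; simpl gF; simpl gG.
  pose proof (m_positive t) as hm.
  set (X := fun j => d_t (d_t (profile_map j)) t x).
  set (Y := fun j => d_th (d_th (profile_map j)) t x).
  assert (h : normal_part 4 profile_metric profile_map t x X i
    + normal_part 4 profile_metric profile_map t x Y i = 0).
  { assert (hY : forall j, Y j = - 2 * m t * profile_map j t x - X j)
      by (intros j; unfold X, Y; rewrite <- Phi_pde; ring).
    assert (hdot : forall Z,
      dot 4 Y Z = - 2 * m t * dot 4 (at_pt profile_map t x) Z - dot 4 X Z).
    { intros Z. rewrite !dot_4, !hY. unfold at_pt. ring. }
    unfold normal_part. rewrite !hdot, dot_Phi_Phi, dot_Phi_Phi_t, dot_Phi_Phi_th.
    rewrite hY.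
    unfold sharp_t, sharp_th. rewrite gdet_g. simpl gE; simpl gF; simpl gG. field; lra. }
  replace (normal_part 4 profile_metric profile_map t x Y i)
    with (- normal_part 4 profile_metric profile_map t x X i) by lra.
  field; lra.
Qed.

Lemma free_boundary_Phi : free_boundary_minimal_immersion 4 r T profile_metric profile_map.
Proof.
  pose proof sin_r_pos. pose proof cos_r_pos.
  split; [intros; apply smooth_Phi|]. split; [|split; [|split; [|split]]].
  - intros t x _. rewrite dot_Phi_t_Phi_t, dot_Phi_t_Phi_th, dot_Phi_th_Phi_th.
    repeat split.
  - intros t x ht. split; [apply dot_Phi_Phi|].
    unfold at_pt, profile_map; simpl. rewrite Rmult_1_r. apply prof, ht.
  - intros x. split; [apply dot_Phi_Phi|].
    unfold at_pt, profile_map; simpl. rewrite Rmult_1_r. apply prof.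
  - intros t x i _ _. apply mean_curvature_Phi.
  - intros x i _. rewrite conormal_Phi. unfold cap_normal, at_pt.
    destruct i as [|i]; simpl e0; [|field; lra].
    unfold profile_map; simpl rad; unfold ang. rewrite (p_T _ _ _ _ _ _ _ _ prof).
    pose proof (sin_sqr r) as e.
    apply Rmult_eq_reg_l with (sin r); [|lra].
    transitivity (- sin r ^ 2); [field; lra|]. rewrite e. field; lra.
Qed.

(** Below [cot r] an eigenfunction is a multiple of [p], which is constant on the boundary; hence
    [- tan r] is the only possible eigenvalue there, and it is simple. *)
Lemma low_eigenfunction_constant (l : R) (u : R -> R) :
  D2 T profile_metric u (fun x => l * u x) -> l < cos r / sin r ->
  exists c, (forall x, u x = c) /\ (l <> - (sin r / cos r) -> c = 0).
Proof.
  intros [f [hf [hu hc]]] hl. pose proof (sqrt_m_pos T) as hm.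
  destruct (radial_of_eigenfunction r T p a b dp da db hr prof f (proj1 hf)
    (fun t x ht => pde_of_solves f t x hf ht) (l * sqrt (m T))) as [c [h1 [h2 _]]].
  - apply Rmult_lt_compat_r; auto.
  - left. intros x. specialize (hc x). rewrite conormal_g, <- hu in hc.
    replace (d_t f T x) with (d_t f T x / sqrt (m T) * sqrt (m T)) by (field; lra).
    rewrite hc. ring.
  - exists (c * p T). split.
    + intros x. rewrite <- hu. apply h1. pose proof (T_pos _ _ _ _ _ _ _ _ prof). lra.
    + intros hl'. fold (m T) in h2.
      assert (e : (l - - (sin r / cos r)) * sqrt (m T) * c = 0) by (rewrite <- h2; ring).
      apply Rmult_integral in e. destruct e as [e | ->]; [|ring].
      apply Rmult_integral in e. lra.
Qed.

Lemma not_dirichlet : ~ two_is_dirichlet_eigenvalue T profile_metric.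
Proof.
  intros [f [hf [h0 [t [x [ht hne]]]]]].
  (* For vanishing boundary values any number below [L1] can be taken for [L]. *)
  destruct (radial_of_eigenfunction r T p a b dp da db hr prof f (proj1 hf)
    (fun t x ht => pde_of_solves f t x hf ht) (cos r / sin r * sqrt (m T) - 1))
    as [c [h1 [_ h3]]].
  - fold (m T). lra.
  - now right.
  - apply hne. rewrite (h3 h0) in h1. unfold in_strip in ht. apply Rabs_le_between in ht.
    (* [radial_of_eigenfunction] covers half of the strip; [iota] carries the other half to it. *)
    destruct (Rle_dec 0 t).
    + rewrite h1 by lra. ring.
    + rewrite <- (proj2 (proj1 hf)) by (apply Rabs_le; lra). rewrite h1 by lra. ring.
Qed.

Lemma steklov_Phi i :
  steklov_eigenfunction T profile_metric
    (match i with 0%nat => - (sin r / cos r) | _ => cos r / sin r end) (profile_map i).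
Proof. split; [apply solves_Phi | intros; apply conormal_Phi]. Qed.

Lemma D2_Phi i : D2 T profile_metric (profile_map i T) (fun x =>
  match i with 0%nat => - (sin r / cos r) | _ => cos r / sin r end * profile_map i T x).
Proof. exists (profile_map i). split; [apply solves_Phi | split; auto using conormal_Phi]. Qed.

Lemma steklov_0 : steklov_eigenvalue T profile_metric 0 (- (sin r / cos r)).
Proof.
  pose proof sin_r_pos. pose proof cos_r_pos.
  assert (0 < sin r / cos r) by (apply Rdiv_lt_0_compat; auto).
  assert (0 < cos r / sin r) by (apply Rdiv_lt_0_compat; auto).
  split.
  - exists (fun _ => - (sin r / cos r)), (fun _ => profile_map 0 T). split.
    + intros j _. split; [lra | apply (D2_Phi 0)].
    + intros c hc j hj. replace j with 0%nat by lia.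
      specialize (hc 0). simpl in hc. unfold profile_map in hc. simpl in hc.
      rewrite (p_T _ _ _ _ _ _ _ _ prof) in hc.
      apply Rmult_integral in hc. destruct hc; [auto | lra].
  - intros [l [u [h1 h2]]]. destruct (h1 0%nat (le_n 0)) as [hl hD].
    destruct (low_eigenfunction_constant (l 0%nat) (u 0%nat) hD) as [c [hu hc]]; [lra|].
    assert (h := h2 (fun _ => 1)). enough (1 = 0) by lra. apply h with 0%nat; [|lia].
    intros x. simpl. rewrite hu, hc by lra. ring.
Qed.

(** [a cos th] and [a sin th], separated by their values at 0 and [PI / 2], provide two
    eigenfunctions for [cot r]. Strictly below [cot r] all eigenfunctions are constant on the
    boundary, so two of them are dependent. *)
Lemma steklov_1 : steklov_eigenvalue T profile_metric 1 (cos r / sin r).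
Proof.
  pose proof (T_pos _ _ _ _ _ _ _ _ prof).
  split.
  - exists (fun _ => cos r / sin r), (fun j => profile_map (S j) T). split.
    + intros j _. split; [lra | apply (D2_Phi (S j))].
    + intros c hc. assert (ha : 0 < a T) by (apply (a_pos _ _ _ _ _ _ _ _ prof); lra).
      assert (h0 : c 0%nat = 0).
      { specialize (hc 0). simpl in hc. unfold profile_map in hc. simpl in hc.
        rewrite Rmult_0_r, cos_0, sin_0 in hc.
        assert (e : c 0%nat * a T = 0) by lra. apply Rmult_integral in e. destruct e; [auto|lra]. }
      assert (h1 : c 1%nat = 0).
      { specialize (hc (PI / 2)). simpl in hc. unfold profile_map in hc. simpl in hc.
        rewrite Rmult_1_l, cos_PI2, sin_PI2 in hc.
        assert (e : c 1%nat * a T = 0) by lra. apply Rmult_integral in e. destruct e; [auto|lra]. }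
      intros [|[|j]] hj; auto. lia.
  - intros [l [u [h1 h2]]].
    destruct (h1 0%nat) as [hl0 hD0]; [lia|]. destruct (h1 1%nat) as [hl1 hD1]; [lia|].
    destruct (low_eigenfunction_constant _ _ hD0 hl0) as [c0 [hu0 _]].
    destruct (low_eigenfunction_constant _ _ hD1 hl1) as [c1 [hu1 _]].
    (* The relation [c1 * u 0 - c0 * u 1 = 0] forces [c0 = 0]; then [u 0] is zero, contradicting
       independence again. *)
    assert (hz : c0 = 0).
    { enough (- c0 = 0) by lra.
      apply (h2 (fun j => match j with 0%nat => c1 | _ => - c0 end)) with (j := 1%nat); [|lia].
      intros x. simpl. rewrite hu0, hu1. ring. }
    enough (1 = 0) by lra.
    apply (h2 (fun j => match j with 0%nat => 1 | _ => 0 end)) with (j := 0%nat); [|lia].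
    intros x. simpl. rewrite hu0, hz. ring.
Qed.

End Immersion.

Theorem theoremB (r : R) (hr : 0 < r < PI / 2) :
  exists (T : R) (g : metric) (Phi : nat -> R -> R -> R),
    0 < T /\
    riemannian_metric T g /\
    free_boundary_minimal_immersion 4 r T g Phi /\
    by_first_steklov_eigenfunctions 4 T g Phi.
Proof.
  destruct (profile_exists r hr) as [T [p [a [b [dp [da [db prof]]]]]]].
  exists T, (profile_metric a b), (profile_map p a b).
  split; [apply prof|]. split; [eapply riemannian_g; eauto|].
  split; [eapply free_boundary_Phi; eauto|].
  split; [eapply not_dirichlet; eauto|].
  exists (- (sin r / cos r)), (cos r / sin r).
  split; [eapply steklov_0; eauto|]. split; [eapply steklov_1; eauto|].
  split; [eapply (steklov_Phi r T p a b dp da db hr prof 0)|].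
  intros [|i] hi; [lia|]. eapply (steklov_Phi r T p a b dp da db hr prof (S i)).
Qed.
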